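(* Let $\Omega\subset\mathbb{C}$ be a Carathéodory hyperbolic domain, let $\zeta_1,\zeta_2,\zeta_3\in\mathbb{D}$ be distinct points and let $W_1,W_2,W_3\in S_n(\Omega)$, $n\geq 2$. Let $m(j,\lambda)$ denote the multiplicity of $\lambda$ as a zero of the minimal polynomial of $W_j$, $j\in\{1,2,3\}$. Given $j,k\in\{1,2,3\}$ with $j\neq k$, $z\in\Omega\setminus\sigma(W_k)$ and $\nu\in\mathbb{D}$, write \[ q_z(\nu,j,k):=\max\left\{\left[\frac{m(j,\lambda)-1}{\mathrm{ord}_{\lambda}B_{k,z}'+1}\right]+1\ :\ \lambda\in\sigma(W_j)\cap B_{k,z}^{-1}\{\nu\}\right\}. \] For each $k\in\{1,2,3\}$ let $G(k):=\max(\{1,2,3\}\setminus\{k\})$ and $L(k):=\min(\{1,2,3\}\setminus\{k\})$. If there exists a holomorphic map $F:\mathbb{D}\to S_n(\Omega)$ such that $F(\zeta_j)=W_j$ for $j\in\{1,2,3\}$, then for each $k\in\{1,2,3\}$ and each $z\in\Omega\setminus\sigma(W_k)$: (i) either $\sigma(B_{k,z}(W_{G(k)}))\subset D(0,|\psi_k(\zeta_{G(k)})|)$, $\sigma(B_{k,z}(W_{L(k)}))\subset D(0,|\psi_k(\zeta_{L(k)})|)$ and \[ \max\left\{\max_{\mu\in\sigma(B_{k,z}(W_{L(k)}))}\ \prod_{\nu\in\sigma(B_{k,z}(W_{G(k)}))}\mathcal{M}_{\mathbb{D}}\left(\frac{\mu}{\psi_k(\zeta_{L(k)})},\frac{\nu}{\psi_k(\zeta_{G(k)})}\right)^{q_z(\nu,G(k),k)},\right.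 \] \[ \left.\max_{\mu\in\sigma(B_{k,z}(W_{G(k)}))}\ \prod_{\nu\in\sigma(B_{k,z}(W_{L(k)}))}\mathcal{M}_{\mathbb{D}}\left(\frac{\mu}{\psi_k(\zeta_{G(k)})},\frac{\nu}{\psi_k(\zeta_{L(k)})}\right)^{q_z(\nu,L(k),k)}\right\}\ \leq\ \mathcal{M}_{\mathbb{D}}(\zeta_{L(k)},\zeta_{G(k)}); \] (ii) or there exists $\theta_z\in\mathbb{R}$ such that \[ B_{k,z}^{-1}\{e^{i\theta_z}\psi_k(\zeta_{G(k)})\}\subseteq\sigma(W_{G(k)})\quad\text{and}\quad B_{k,z}^{-1}\{e^{i\theta_z}\psi_k(\zeta_{L(k)})\}\subseteq\sigma(W_{L(k)}). \]
   Context: $\mathbb{D}$ is the open unit disc in $\mathbb{C}$ centered at $0$, and $D(0,r)$ is the open disc of radius $r$ centered at $0$. $\sigma(A)$ denotes the set of (distinct) eigenvalues of a matrix $A\in M_n(\mathbb{C})$. For a domain $\Omega\subseteq\mathbb{C}$, $S_n(\Omega):=\{A\in M_n(\mathbb{C}):\sigma(A)\subset\Omega\}$, a domain in $M_n(\mathbb{C})\cong\mathbb{C}^{n^2}$. The Möbius distance is $\mathcal{M}_{\mathbb{D}}(z_1,z_2):=\left|\frac{z_1-z_2}{1-\overline{z_2}z_1}\right|$ for $z_1,z_2\in\mathbb{D}$. The Carathéodory pseudo-distance on $\Omega$ is $C_\Omega(p,q):=\sup\{\mathcal{M}_{\mathbb{D}}(f(p),f(q)): f:\Omega\to\mathbb{D}\text{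 holomorphic}\}=\sup\{|f(q)|: f:\Omega\to\mathbb{D}\text{ holomorphic}, f(p)=0\}$. $\Omega$ is Carathéodory hyperbolic if $C_\Omega$ is a distance (equivalently, bounded holomorphic functions separate points of $\Omega$). For such $\Omega$ and distinct $p,q\in\Omega$, there is a unique holomorphic $g:\Omega\to\mathbb{D}$ with $g(p)=0$ and $g(q)=C_\Omega(p,q)$ (a known fact); it is denoted $G_\Omega(p,q;\cdot)$. For $k\in\{1,2,3\}$ and $z\in\Omega\setminus\sigma(W_k)$, $B_{k,z}:\Omega\to\mathbb{D}$ is the holomorphic function \[ B_{k,z}(\cdot):=\prod_{\lambda\in\sigma(W_k)}G_\Omega(\lambda,z;\cdot)^{m(k,\lambda)}. \] The same symbol denotes the map $A\mapsto B_{k,z}(A)$ on $S_n(\Omega)$ given by the holomorphic functional calculus: for $f$ holomorphic on $\Omega$ and $A\in S_n(\Omega)$, $f(A):=P(A)$ for any polynomial $P$ with $P^{(i)}(\lambda)=f^{(i)}(\lambda)$ for $0\le i\le m(\lambda)-1$ and all $\lambda\in\sigma(A)$, $m(\lambda)$ being the multiplicity of $\lambda$ as a zero of the minimal polynomial of $A$; one has $\sigma(f(A))=f(\sigma(A))$. Preimages $B_{k,z}^{-1}\{\cdot\}$ are preimages in $\Omega$ under the scalar function $B_{k,z}$. $\psi_j$ denotes the automorphism $\psi_j(\zeta)=\frac{\zeta-\zeta_j}{1-\overline{\zeta_j}\,\zeta}$ of $\mathbb{D}$. $[\cdot]$ is the greatest-integer function. For $g$ holomorphic near $a$, $\mathrm{ord}_a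 g$ is the order of vanishing of $g$ at $a$ (equal to $0$ if $g(a)\neq 0$). The numbers $q_z(\nu,j,k)$ are used only for $\nu\in\sigma(B_{k,z}(W_j))=B_{k,z}(\sigma(W_j))$, in which case the set defining the maximum is nonempty. *)

(* Defs.v *)
From HB Require Import structures.
From mathcomp Require Import all_boot all_order all_algebra.
From mathcomp Require Import all_classical all_reals all_analysis.
From mathcomp Require Import complex.

Set Implicit Arguments.
Unset Strict Implicit.
Unset Printing Implicit Defensive.
Import Order.TTheory GRing.Theory Num.Theory.
Import numFieldNormedType.Exports.
Local Open Scope classical_set_scope.
Local Open Scope ring_scope.

(* [R[i]] gets the topology of its norm, and [derivable f z 1] is then complex
   differentiability at [z]. *)
HB.instance Definition _ (R : rcfType) := GRing.ComAlgebra.copy R[i] R[i]^o.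
HB.instance Definition _ (R : rcfType) := Vector.copy R[i] R[i]^o.
HB.instance Definition _ (R : rcfType) := NormedModule.copy R[i] R[i]^o.

Section ComplexPlane.
Variable R : realType.
Local Notation C := R[i].
Implicit Types (O : set C) (f g : C -> C) (p q z w : C).

(* The modulus as an element of [R]; [`|z|] itself lives in [R[i]]. *)
Definition cabs z : R := complex.Re `|z|.

Definition open_disc (r : R) : set C := [set z | cabs z < r].

Definition unit_disc : set C := open_disc 1.

Definition domain O : Prop := [/\ open O, connected O & O !=set0].

Definition holomorphic_on (V : normedModType C) O (f : C -> V) : Prop :=
  forall z, O z -> derivable f z 1.

Definition holomorphic_maps O f : Prop :=
  holomorphic_on O f /\ (forall z, O z -> unit_disc (f z)).

Definition mobius_dist (z1 z2 : C) : R :=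
  cabs ((z1 - z2) / (1 - conjc z2 * z1)).

Definition disc_aut (a z : C) : C := (z - a) / (1 - conjc a * z).

Definition cexpi (t : R) : C := Complex (cos t) (sin t).

Definition caratheodory O p q : R :=
  sup [set mobius_dist (f p) (f q) | f in holomorphic_maps O].

Definition distance_on O (d : C -> C -> R) : Prop :=
  [/\ forall p q, O p -> O q -> 0 <= d p q,
      forall p q, O p -> O q -> (d p q = 0 <-> p = q),
      forall p q, O p -> O q -> d p q = d q p &
      forall p q s, O p -> O q -> O s -> d p s <= d p q + d q s].

Definition caratheodory_hyperbolic O : Prop := distance_on O (caratheodory O).

Definition is_extremal O p q g : Prop :=
  [/\ holomorphic_maps O g, g p = 0 & g q = real_complex R (caratheodory O p q)].

(* [G_O(p, q; .)]: for [O] hyperbolic and [p], [q] distinct points of [O], a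
   function with [is_extremal O p q] exists and its restriction to [O] is
   unique, so the zero default is then irrelevant and only the values on [O]
   are meaningful. *)
Definition extremal O p q : C -> C := xget (fun=> 0) (is_extremal O p q).

(* Order of vanishing at [a] of a function holomorphic near [a]. The default 0
   only matters for functions vanishing identically near [a]. *)
Definition is_order_at g (a : C) (m : nat) : Prop :=
  exists h : C -> C,
    [/\ \forall w \near a, derivable h w 1,
        h a != 0 &
        \forall w \near a, g w = (w - a) ^+ m * h w].

Definition order_at g (a : C) : nat := xget 0%N (is_order_at g a).

End ComplexPlane.

Section Matrices.
Variables (R : realType) (n : nat).
Local Notation C := R[i].
Implicit Types (O : set C) (A W : 'M[C]_n.+1) (B : C -> C).

Definition spectrum A : set C := [set a | eigenvalue A a].

Definition min_mult A (a : C) : nat := mup a (mxminpoly A).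

Definition spectral_domain O : set 'M[C]_n.+1 := [set A | spectrum A `<=` O].

(* Holomorphic functional calculus. A Hermite interpolant [P] always exists,
   and [horner_mx A P] does not depend on its choice. *)
Definition interpolates (f : C -> C) A (P : {poly C}) : Prop :=
  forall a, spectrum A a -> forall i, (i < min_mult A a)%N ->
    (derivn i P).[a] = derive1n i f a.

Definition fun_calc (f : C -> C) A : 'M[C]_n.+1 :=
  horner_mx A (xget 0 (interpolates f A)).

(* [B_{k,z}] with [W = W_k]; as for [extremal], only its values on [O] are
   meaningful. *)
Definition Bfun O W (z : C) : C -> C := fun w =>
  \big[*%R/1]_(a \in spectrum W) extremal O a z w ^+ min_mult W a.

(* [q_z(nu, j, k)] with [B = B_{k,z}] and [W = W_j]. All terms are positive, so
   the neutral element 0 plays no role when the index set is nonempty. *)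
Definition qnum B W (nu : C) : nat :=
  \big[maxn/0%N]_(a \in spectrum W `&` B @^-1` [set nu])
    (((min_mult W a).-1 %/ (order_at (derive1 B) a).+1).+1).

(* [max_{mu in sigma(B(W))} prod_{nu in sigma(B(W'))} M(mu/s, nu/s')^q(nu)]
   where [q] is that of [W']. The products are nonnegative, so 0 is neutral for
   their maximum. *)
Definition max_prod B W (s : C) W' (s' : C) : R :=
  \big[Num.max/0]_(mu \in spectrum (fun_calc B W))
    \big[*%R/1]_(nu \in spectrum (fun_calc B W'))
      mobius_dist (mu / s) (nu / s') ^+ qnum B W' nu.

End Matrices.

(* The points 1, 2, 3 are indexed by ['I_3] = {0, 1, 2}; [lift k ord0] is some
   index different from [k], as required by the [arg] notations. *)
Definition Gidx (k : 'I_3) : 'I_3 :=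
  [arg max_(i > lift k ord0 | i != k) nat_of_ord i]%N.

Definition Lidx (k : 'I_3) : 'I_3 :=
  [arg min_(i < lift k ord0 | i != k) nat_of_ord i]%N.

(* Main.v *)
Require Import Defs.
From HB Require Import structures.
From mathcomp Require Import all_boot all_order all_algebra.
From mathcomp Require Import all_classical all_reals all_analysis.
From mathcomp Require Import complex.
From mathcomp Require Import perm qpoly ring lra.

Set Implicit Arguments.
Unset Strict Implicit.
Unset Printing Implicit Defensive.
Import Order.TTheory GRing.Theory Num.Theory.
Import numFieldNormedType.Exports.
Local Open Scope classical_set_scope.
Local Open Scope ring_scope.

(** The theorem is proved on the eigenvalues of F w alone. Write a for zeta k
and psi for the automorphism of the disc with psi a = 0.

The unordered tuple g w of the eigenvalues of F w is a holomorphic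
multifunction: the product of the y - x, for x in g w, is holomorphic in w for
every y. This class is stable under a holomorphic f applied to the entries
([multi_holo_comp]). Indeed, near w0, write f = P + p^2 h with p the
characteristic polynomial of F w0, P a polynomial and h holomorphic
([hermite_div]). On g w one has p = O(w - w0), so the symmetric functions of
the f x and of the P x agree up to O((w - w0)^2), and those of the P x are
polynomials in those of the x. There is also a maximum principle
([multi_max]): if the entries have modulus at most tau < 1 on a circle, then
the product of the 1 - x^m is close to 1 inside the circle for large m, so no
entry inside is equal to 1. It gives a Schwarz lemma: entries of modulus at
most 1 which are O(w - z0) near z0 are bounded by the modulus of the
automorphism vanishing at z0 ([multi_schwarz]). It also gives a rigidity
statement: a unimodular value taken at one point is taken at every point
([multi_rigid]).

Near a, the minimal polynomial of W k is O(w - a) on the eigenvalues of F w,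
because it annihilates F a. The function B vanishes at the roots of that
polynomial with at least their multiplicities, so B x = O(w - a), and the
Schwarz lemma gives that the quotients B x / psi w, for x in g w, have modulus
at most 1 ([Bfun_schwarz], [quotient_le1]).

If one of these quotients is a unimodular c, then by rigidity c psi w belongs
to B (g w) for every w. Hence det (x - F (psi^-1 (c^-1 B x))), a holomorphic
function of x on Omega, has zeros accumulating at an eigenvalue of F a, and it
vanishes identically. Taking x in the fibre of B over c psi (zeta j) gives
alternative (ii) ([unimodular_case]). Otherwise all quotients lie in the open
disc. Compose them with the finite Blaschke product b whose zeros are the
nu / psi q, where q = zeta j and nu runs over the eigenvalues of B (W j), with
the exponents q_z(nu, j, k). These exponents are such that b (B x / psi w) is
O(w - q) near q, and the Schwarz lemma at q is the inequality of
alternative (i) ([two_point]).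

The function theory of one variable rests on Goursat's bisection, carried out
in the coordinates a + exp (s + i t), in which concentric circles are sides of
rectangles. This gives the mean value property on circles, then Cauchy's
formula and a Taylor expansion with remainder, from which come removable
singularities, the identity theorem and [hermite_div]. *)

(** * Complex differentiability by epsilon and delta *)

(** One statement serves real functions, complex functions and matrix-valued
functions, so that every later estimate is a plain inequality between norms. *)
Lemma diffquot_epsP (K : numFieldType) (V : normedModType K) (f : K -> V) (z : K)
  (l : V) :
  ((h^-1 *: (f (h *: (1 : K^o) + z) - f z)) @[h --> (0 : K)^'] --> l) <->
  forall e : K, 0 < e -> exists2 d : K, 0 < d &
     forall w, `|w - z| < d -> `|f w - f z - (w - z) *: l| <= e * `|w - z|.
Proof.
split.
- move=> fl e e0.
  move/cvgrPdist_le : fl => /(_ e e0) /nbhs_ballP[d /= d0 H].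
  exists d => // w wz.
  have [->|nwz] := eqVneq w z; first by rewrite !subrr scale0r subr0 !normr0 mulr0.
  have nz : w - z != 0 by rewrite subr_eq0.
  have := H (w - z); rewrite /ball /= sub0r normrN => /(_ wz nz).
  rewrite /GRing.scale/= mulr1 subrK => {}H.
  have -> : f w - f z - (w - z) *: l = - ((w - z) *: (l - (w - z)^-1 *: (f w - f z))).
    by rewrite scalerBr scalerA divff// scale1r opprB.
  by rewrite normrN normrZ mulrC ler_pM2r// normr_gt0.
- move=> H; apply/cvgrPdist_le => e e0.
  have [d d0 {}H] := H _ e0.
  apply/nbhs_ballP; exists d => //= h; rewrite /ball /= sub0r normrN => hd h0.
  have := H (z + h); rewrite addrAC subrr add0r => /(_ hd).
  have -> : l - h^-1 *: (f (h *: 1 + z) - f z) = - (h^-1 *: (f (z + h) - f z - h *: l)).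
    by rewrite [h *: 1](mulr1 h) [h + z]addrC (scalerBr h^-1 (_ - _) (h *: l)) scalerA
      mulVf// scale1r opprB.
  by rewrite normrN normrZ normrV ?unitfE// [_^-1 * _]mulrC ler_pdivrMr ?normr_gt0.
Qed.

Lemma derivable_epsP (K : numFieldType) (V : normedModType K) (f : K -> V) (z : K) :
  @derivable K K^o V f z 1 <-> exists l : V, forall e : K, 0 < e -> exists2 d : K,
    0 < d &
     forall w, `|w - z| < d -> `|f w - f z - (w - z) *: l| <= e * `|w - z|.
Proof.
split; first by move=> /cvg_ex[/= l fl]; exists l; exact/diffquot_epsP.
by move=> [l H]; apply/cvg_ex; exists l; exact/diffquot_epsP.
Qed.

Lemma is_derive_eps (R : realType) (F : R -> R) (z l : R) : is_derive z 1 F l ->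
  forall e : R, 0 < e -> exists2 d : R, 0 < d &
     forall w, `|w - z| < d -> `|F w - F z - l * (w - z)| <= e * `|w - z|.
Proof.
move=> D; have h : derivable F z 1 by exact: ex_derive.
have {}D : 'D_1 F z = l by exact: derive_val.
have /(@diffquot_epsP R R^o F z l) H : (h^-1 *: (F (h *: (1 : R^o) + z) - F z))
  @[h --> (0 : R)^'] --> l.
  by rewrite -D; exact: h.
by move=> e /H[d d0 {}H]; exists d => // w /H;
  rewrite /GRing.scale/= [(w - z) * l]mulrC.
Qed.

Section ComplexDifferentiability.

Variable R : realType.
Local Notation C := R[i].
Implicit Types (f g : C -> C) (a z w : C) (e d : R).

Lemma derivable_cplxE f z : derivable f z 1 = @derivable C C^o C^o f z 1.
Proof. by []. Qed.

Lemma cabsE (z : C) : `|z| = (cabs z)%:C%C.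
Proof. by rewrite /cabs normc_def. Qed.

Lemma gt0_cplx (e : C) : 0 < e -> exists2 d : R, 0 < d & e = d%:C%C.
Proof.
move=> e0; have er := ger0_Im (ltW e0); exists (complex.Re e).
  by move: e0; rewrite ltcE /= => /andP[].
by case: e er {e0} => a b /= ->.
Qed.

Lemma derivable_cplxP f z :
 derivable f z 1 <-> exists l : C, forall e : R, 0 < e -> exists2 d : R, 0 < d &
     forall w, cabs (w - z) < d -> cabs (f w - f z - (w - z) * l) <= e * cabs (w - z).
Proof.
rewrite derivable_cplxE derivable_epsP; split=> -[l H]; exists l => e e0.
- have [|_ /gt0_cplx[d d0 ->] {}H] := H e%:C%C; first by rewrite ltcR.
  exists d => // w; have := H w; rewrite !cabsE -rmorphM/= ltcR lecR.
  exact.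
- have [e' /H[d d0 {}H] ->] := gt0_cplx e0; exists d%:C%C; first by rewrite ltcR.
  move=> w; have := H w; rewrite !cabsE -rmorphM/= ltcR lecR.
  exact.
Qed.

Lemma cabs_ge0 z : 0 <= cabs z.
Proof. by rewrite /cabs normc_def /= sqrtr_ge0. Qed.

Lemma cabsM z w : cabs (z * w) = cabs z * cabs w.
Proof. by apply: (@complexI R); rewrite rmorphM/= -!cabsE normrM. Qed.

Lemma cabsD z w : cabs (z + w) <= cabs z + cabs w.
Proof. by rewrite -lecR rmorphD/= -!cabsE ler_normD. Qed.

Lemma cabsN z : cabs (- z) = cabs z.
Proof. by apply: (@complexI R); rewrite -!cabsE normrN. Qed.

Lemma cabs_distC z w : cabs (z - w) = cabs (w - z).
Proof. by rewrite -cabsN opprB. Qed.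

Lemma cabs0 : cabs (0 : C) = 0.
Proof. by apply: (@complexI R); rewrite -!cabsE normr0. Qed.

Lemma cabs1 : cabs (1 : C) = 1.
Proof. by apply: (@complexI R); rewrite -!cabsE normr1. Qed.

Lemma cabs_eq0 z : (cabs z == 0) = (z == 0).
Proof. by rewrite -(inj_eq (@complexI R)) -cabsE normr_eq0. Qed.

Lemma cabs_gt0 z : (0 < cabs z) = (z != 0).
Proof. by rewrite lt_def cabs_ge0 andbT cabs_eq0. Qed.

Lemma cabsV z : cabs z^-1 = (cabs z)^-1.
Proof. by apply: (@complexI R); rewrite -!cabsE normfV cabsE fmorphV. Qed.

Lemma cabsX z n : cabs (z ^+ n) = cabs z ^+ n.
Proof. by apply: (@complexI R); rewrite -!cabsE normrX cabsE rmorphXn. Qed.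

Lemma cabs_prod (I : Type) (s : seq I) (F : I -> C) :
  cabs (\prod_(i <- s) F i) = \prod_(i <- s) cabs (F i).
Proof. by elim/big_rec2: _ => [|i x y _ <-]; rewrite ?cabs1 ?cabsM. Qed.

Lemma cabs_sum (I : Type) (s : seq I) (F : I -> C) :
  cabs (\sum_(i <- s) F i) <= \sum_(i <- s) cabs (F i).
Proof.
elim/big_rec2: _ => [|i x y _ h]; rewrite ?cabs0// (le_trans (cabsD _ _))//.
by rewrite lerD2l.
Qed.

Lemma cabs_real (x : R) : cabs x%:C%C = `|x|.
Proof. by rewrite /cabs normc_def /= expr0n addr0 sqrtr_sqr. Qed.

Lemma cabsB_ge z w : cabs z - cabs w <= cabs (z - w).
Proof. by have := cabsD (z - w) w; rewrite subrK lerBlDr. Qed.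

Lemma cabs_tri z w v : cabs (z - v) <= cabs (z - w) + cabs (w - v).
Proof. by have := cabsD (z - w) (w - v); rewrite addrA subrK. Qed.

Lemma sqr_cabs z : cabs z ^+ 2 = complex.Re z ^+ 2 + complex.Im z ^+ 2.
Proof. by rewrite /cabs normc_def /= sqr_sqrtr// addr_ge0 ?sqr_ge0. Qed.

Lemma cabs_Re z : `|complex.Re z| <= cabs z.
Proof.
rewrite -(@ler_pXn2r _ 2%N) ?nnegrE ?cabs_ge0// sqr_cabs real_normK ?num_real//.
by rewrite lerDl sqr_ge0.
Qed.

Lemma cabs_Im z : `|complex.Im z| <= cabs z.
Proof.
rewrite -(@ler_pXn2r _ 2%N) ?nnegrE ?cabs_ge0// sqr_cabs real_normK ?num_real//.
by rewrite lerDr sqr_ge0.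
Qed.

Lemma cabs_ReIm z : cabs z <= `|complex.Re z| + `|complex.Im z|.
Proof.
rewrite -(@ler_pXn2r _ 2%N) ?nnegrE ?cabs_ge0 ?addr_ge0// sqr_cabs sqrrD.
rewrite !real_normK ?num_real// -addrA lerD2l lerDr.
by rewrite mulrn_wge0// mulr_ge0.
Qed.

Lemma cabs_conj z : cabs (conjc z) = cabs z.
Proof. by apply: (@complexI R); rewrite -!cabsE normcJ. Qed.

Lemma mul_conjc z : z * conjc z = ((cabs z) ^+ 2)%:C%C.
Proof. by rewrite -sqr_normc cabsE rmorphXn. Qed.

Definition cnear a (P : C -> Prop) := exists2 d : R, 0 < d & forall w,
  cabs (w - a) < d -> P w.

Lemma nbhs_cnear a (P : set C) : (\forall w \near a, P w) <-> cnear a P.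
Proof.
split.
- move=> /nbhs_ballP[e /= /gt0_cplx[d d0 ->] H]; exists d => // w wd; apply: H.
  by rewrite /ball /= -normrN opprB cabsE ltcR.
- move=> [d d0 H]; apply/nbhs_ballP; exists d%:C%C => /=; first by rewrite ltcR.
  by move=> w; rewrite /ball /= -normrN opprB cabsE ltcR; exact: H.
Qed.

Lemma open_cnear (O : set C) : open O <-> (forall z, O z -> cnear z O).
Proof.
rewrite openE; split => H z /H.
  by move=> h; apply/nbhs_cnear; exact: h.
by move=> h; apply/nbhs_cnear.
Qed.

Lemma cnear_and a (P Q : C -> Prop) : cnear a P -> cnear a Q ->
  cnear a (fun w => P w /\ Q w).
Proof.
move=> [d d0 H] [d' d0' H']; exists (Num.min d d'); first by rewrite lt_min d0.
by move=> w; rewrite lt_min => /andP[/H ? /H' ?].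
Qed.

Lemma cnear_imp a (P Q : C -> Prop) : (forall w, P w -> Q w) -> cnear a P -> cnear a Q.
Proof. by move=> PQ [d d0 H]; exists d => // w /H /PQ. Qed.

Lemma cnear_imp2 a (P Q S : C -> Prop) : (forall w, P w -> Q w -> S w) -> cnear a P ->
  cnear a Q -> cnear a S.
Proof. by move=> PQ p q; apply: cnear_imp (cnear_and p q) => w []; exact: PQ. Qed.

Lemma cnear_all a (P : C -> Prop) : (forall w, P w) -> cnear a P.
Proof. by exists 1. Qed.

Lemma cnear_self a (P : C -> Prop) : cnear a P -> P a.
Proof. by move=> [d d0]; apply; rewrite subrr cabs0. Qed.

Lemma cnear_cnear a (P : C -> Prop) : cnear a P -> cnear a (fun b => cnear b P).
Proof.
move=> [d d0 H]; exists d => // w wd; exists (d - cabs (w - a));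
  first by rewrite subr_gt0.
by move=> v; rewrite ltrBrDr => vd; apply: H; apply: le_lt_trans (cabs_tri _ w _) vd.
Qed.

Lemma cnear_ball a e : 0 < e -> cnear a (fun w => cabs (w - a) < e).
Proof. by exists e. Qed.

Lemma cnear_disc a z r : cabs (z - a) < r -> cnear z (fun w => cabs (w - a) < r).
Proof.
move=> h; exists (r - cabs (z - a)); first by rewrite subr_gt0.
by move=> v; rewrite ltrBrDr => vd; apply: le_lt_trans (cabs_tri _ z _) vd.
Qed.

Lemma cnear_neq a z : a != z -> cnear a (fun w => w != z).
Proof.
move=> az; exists (cabs (a - z)); first by rewrite cabs_gt0 subr_eq0.
by move=> w; apply: contraTneq => ->; rewrite cabs_distC ltxx.
Qed.

Lemma cnear_seq (T : eqType) a (s : seq T) (P : T -> C -> Prop) :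
  (forall x, x \in s -> cnear a (P x)) -> cnear a (fun w => forall x, x \in s -> P x w).
Proof.
elim: s => [|y s IH] H; first exact: cnear_all.
apply: (cnear_imp2 _ (H y _) (IH _)); rewrite ?mem_head//.
  by move=> w Py Ps x; rewrite inE => /predU1P[->|/Ps].
by move=> x xs; apply: H; rewrite inE xs orbT.
Qed.

Lemma cnear_notin a (s : seq C) : a \notin s -> cnear a (fun w => w \notin s).
Proof.
move=> as_; have : cnear a (fun w => forall x, x \in s -> w != x).
  by apply: cnear_seq => x xs; apply: cnear_neq; apply: contraNneq as_ => ->.
by apply: cnear_imp => w H; apply/negP => /H; rewrite eqxx.
Qed.

Definition ccont f a := forall e, 0 < e -> cnear a (fun w => cabs (f w - f a) < e).

Lemma ccont_cst (c : C) a : ccont (fun=> c) a.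
Proof. by move=> e e0; apply: cnear_all => w; rewrite subrr cabs0. Qed.

Lemma ccont_id a : ccont id a.
Proof. by move=> e e0; exact: cnear_ball. Qed.

Lemma ccontD f g a : ccont f a -> ccont g a -> ccont (fun w => f w + g w) a.
Proof.
move=> cf cg e e0; have h0 : 0 < e / 2 by rewrite divr_gt0.
apply: (cnear_imp2 _ (cf _ h0) (cg _ h0)) => w fw gw.
by rewrite opprD addrACA (le_lt_trans (cabsD _ _))// (splitr e) ltrD.
Qed.

Lemma ccontN f a : ccont f a -> ccont (fun w => - f w) a.
Proof.
by move=> cf e /cf; apply: cnear_imp => w; rewrite -opprD cabsN.
Qed.

Lemma ccontM f g a : ccont f a -> ccont g a -> ccont (fun w => f w * g w) a.
Proof.
move=> cf cg e e0; set m := cabs (f a) + cabs (g a) + 2.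
have m0 : 0 < m by rewrite ltr_wpDl ?addr_ge0 ?cabs_ge0.
have h0 : 0 < e / m by rewrite divr_gt0.
apply: (cnear_imp2 _ (cnear_and (cf _ h0) (cg _ h0)) (cg 1 ltr01)) => w [fw gw] gw1.
have -> : f w * g w - f a * g a = (f w - f a) * (g w - g a) + (f w - f a) * g a + f a *
  (g w - g a) by ring.
have eE : e = e / m * m by rewrite divfK// gt_eqF.
rewrite (le_lt_trans (cabsD _ _))// cabsM.
rewrite (le_lt_trans (lerD (cabsD _ _) (lexx _)))// !cabsM {}eE.
have := cabs_ge0 (f w - f a); have := cabs_ge0 (g w - g a).
have := cabs_ge0 (f a); have := cabs_ge0 (g a).
move: (cabs (f w - f a)) (cabs (g w - g a)) (cabs (f a)) (cabs (g a)) @m (e / m) m0 h0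
  fw gw gw1.
by move=> x y u v /= t m0 t0 xt yt y1 v0 u0 y0 x0; nra.
Qed.

Lemma ccontV f a : f a != 0 -> ccont f a -> ccont (fun w => (f w)^-1) a.
Proof.
move=> fa0 cf e e0; have m0 : 0 < cabs (f a) by rewrite cabs_gt0.
have m20 : 0 < cabs (f a) / 2 by rewrite divr_gt0.
have h0 : 0 < e * (cabs (f a) ^+ 2 / 2) by rewrite mulr_gt0// divr_gt0// exprn_gt0.
apply: (cnear_imp2 _ (cf _ m20) (cf _ h0)) => w fw1 fw2.
have fwm : cabs (f a) / 2 < cabs (f w).
  by have := cabsB_ge (f a) (f w); rewrite cabs_distC; lra.
have fw0 : f w != 0 by rewrite -cabs_gt0 (lt_trans _ fwm).
have -> : (f w)^-1 - (f a)^-1 = - (f w - f a) / (f w * f a) by field; rewrite fa0 fw0.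
rewrite cabsM cabsN cabsV cabsM ltr_pdivrMr ?mulr_gt0// ?cabs_gt0//.
apply: lt_trans fw2 _; rewrite ltr_pM2l// expr2 mulrAC ltr_pM2r//.
Qed.

Lemma ccont_comp f g a : ccont f a -> ccont g (f a) -> ccont (fun w => g (f w)) a.
Proof.
by move=> cf cg e /cg[d d0 H]; apply: cnear_imp (cf _ d0) => w; exact: H.
Qed.

Lemma ccont_near f g a : cnear a (fun w => f w = g w) -> ccont f a -> ccont g a.
Proof.
move=> fg cf e /cf; apply: cnear_imp2 (fg) => w fgw; rewrite fgw.
by rewrite -(cnear_self fg).
Qed.

Lemma ccont_bnd f a : ccont f a -> cnear a (fun w => cabs (f w) <= cabs (f a) + 1).
Proof.
move=> H0; apply: cnear_imp (H0 _ ltr01) => w H.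
rewrite -[f w](subrK (f a)) (le_trans (cabsD _ _))// addrC lerD2l; exact: ltW.
Qed.

Lemma ccont_near_neq f a c : f a != c -> ccont f a -> cnear a (fun w => f w != c).
Proof. move=> fac cf; have [d d0 H] := cnear_neq fac.
by apply: cnear_imp (cf _ d0) => w; exact: H. Qed.

Definition cdiffto f z l := forall e : R, 0 < e ->
  cnear z (fun w => cabs (f w - f z - (w - z) * l) <= e * cabs (w - z)).
Definition cdiff f z := exists l, cdiffto f z l.

Lemma derivable_cdiff f z : derivable f z 1 <-> cdiff f z.
Proof. exact: derivable_cplxP. Qed.

Lemma cdiffto_derive1 f z l : cdiffto f z l -> derive1 f z = l.
Proof.
move=> H; have : (h^-1 *: (f (h *: (1 : C^o) + z) - f z)) @[h --> (0 : C)^'] -->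
  (l : C^o).
  apply/(@diffquot_epsP C C^o f z l) => e /gt0_cplx[e' e'0 ->].
  have [d d0 {}H] := H _ e'0; exists d%:C%C; first by rewrite ltcR.
  move=> w; have := H w; rewrite !cabsE -rmorphM/= ltcR lecR; exact.
by move=> /(@cvg_lim C^o); rewrite derive1E; apply; exact: norm_hausdorff.
Qed.

(** Caratheodory's form of differentiability reduces sums, products, inverses
and composites to the corresponding facts about continuity. *)
Lemma cdifftoP f z l : cdiffto f z l <->
  exists phi, [/\ ccont phi z, phi z = l & forall w, f w = f z + phi w * (w - z)].
Proof.
split.
- move=> H; exists (fun w => if w == z then l else (f w - f z) / (w - z)).
  split=> [e e0||w].
  + have e20 : 0 < e / 2 by rewrite divr_gt0.
    apply: cnear_imp (H _ e20) => w; rewrite eqxx; case: eqVneq => [_ _|wz].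
      by rewrite subrr cabs0.
    have wz0 : w - z != 0 by rewrite subr_eq0.
    have -> : f w - f z - (w - z) * l = ((f w - f z) / (w - z) - l) * (w - z).
      by field.
    rewrite cabsM ler_pM2r ?cabs_gt0// => /le_lt_trans; apply.
    by rewrite ltr_pdivrMr// ltr_pMr// ltr1n.
  + by rewrite eqxx.
  + case: eqVneq => [->|wz]; first by rewrite subrr mulr0 addr0.
    have wz0 : w - z != 0 by rewrite subr_eq0.
    by field.
- move=> [phi [cphi <- H]] e e0; apply: cnear_imp (cphi _ e0) => w hw.
  have -> : f w - f z - (w - z) * phi z = (phi w - phi z) * (w - z) by rewrite H; ring.
  by rewrite cabsM ler_wpM2r ?cabs_ge0// ltW.
Qed.

Lemma cdiffto_ccont f z l : cdiffto f z l -> ccont f z.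
Proof.
move=> /cdifftoP[phi [cphi _ H]].
apply: (@ccont_near (fun w => f z + phi w * (w - z))).
  by apply: cnear_all => w; rewrite -H.
apply: ccontD; first exact: ccont_cst.
apply: ccontM => //; apply: ccontD; [exact: ccont_id|exact: ccont_cst].
Qed.

Lemma cdiff_ccont f z : cdiff f z -> ccont f z.
Proof. by move=> [l /cdiffto_ccont]. Qed.

Lemma cdiffto_near f g z l : cnear z (fun w => f w = g w) -> cdiffto f z l ->
  cdiffto g z l.
Proof.
move=> fg H e /H; apply: cnear_imp2 (fg) => w ->.
by rewrite (cnear_self fg).
Qed.

Lemma cdiff_near f g z : cnear z (fun w => f w = g w) -> cdiff f z -> cdiff g z.
Proof. by move=> fg [l H]; exists l; exact: cdiffto_near H. Qed.

Lemma cdiff_ext f g z : f =1 g -> cdiff f z -> cdiff g z.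
Proof. by move=> fg; apply: cdiff_near; exact: cnear_all. Qed.

Lemma cdiffto_cst c z : cdiffto (fun=> c) z 0.
Proof. by move=> e e0; apply: cnear_all => w;
  rewrite subrr mulr0 subr0 cabs0 mulr_ge0 ?cabs_ge0// ltW. Qed.

Lemma cdiffto_id z : cdiffto id z 1.
Proof. by move=> e e0; apply: cnear_all => w;
  rewrite mulr1 subrr cabs0 mulr_ge0 ?cabs_ge0// ltW. Qed.

Lemma cdifftoD f g z l m : cdiffto f z l -> cdiffto g z m ->
  cdiffto (fun w => f w + g w) z (l + m).
Proof.
move=> /cdifftoP[p [cp <- Hp]] /cdifftoP[q [cq <- Hq]]; apply/cdifftoP.
exists (fun w => p w + q w); split=> //; first exact: ccontD.
by move=> w; rewrite Hp Hq; ring.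
Qed.

Lemma cdifftoM f g z l m : cdiffto f z l -> cdiffto g z m ->
  cdiffto (fun w => f w * g w) z (l * g z + f z * m).
Proof.
move=> Hf Hg; have cg := cdiffto_ccont Hg.
move: Hf Hg => /cdifftoP[p [cp <- Hp]] /cdifftoP[q [cq <- Hq]]; apply/cdifftoP.
exists (fun w => p w * g w + f z * q w); split=> //.
  by apply: ccontD; apply: ccontM => //; exact: ccont_cst.
by move=> w; rewrite (Hp w) (Hq w); ring.
Qed.

Lemma cdifftoV f z l : f z != 0 -> cdiffto f z l ->
  cdiffto (fun w => (f w)^-1) z (- l / f z ^+ 2).
Proof.
move=> fz0 Hf; have cf := cdiffto_ccont Hf.
move: Hf => /cdifftoP[p [cp <- Hp]].
apply: (@cdiffto_near (fun w => (f z)^-1 + (- p w / (f z * f w)) * (w - z))).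
  apply: cnear_imp (ccont_near_neq fz0 cf) => w fw0.
  have [->|wz] := eqVneq w z; first by rewrite subrr mulr0 addr0.
  have wz0 : w - z != 0 by rewrite subr_eq0.
  have -> : p w = (f w - f z) / (w - z) by rewrite (Hp w) addrAC subrr add0r mulfK.
  by field; rewrite wz0 fz0 fw0.
apply/cdifftoP; exists (fun w => - p w / (f z * f w)); split=> //.
- apply: ccontM; first exact: ccontN.
  apply: (@ccontV (fun w => f z * f w)); first by rewrite mulf_neq0.
  by apply: ccontM => //; exact: ccont_cst.
- by move=> w; rewrite subrr mulr0 addr0.
Qed.

Lemma cdiffto_comp f g z l m : cdiffto f z l -> cdiffto g (f z) m ->
  cdiffto (fun w => g (f w)) z (m * l).
Proof.
move=> Hf Hg; have cf := cdiffto_ccont Hf.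
move: Hf Hg => /cdifftoP[p [cp <- Hp]] /cdifftoP[q [cq <- Hq]]; apply/cdifftoP.
exists (fun w => q (f w) * p w); split=> //.
  by apply: ccontM => //; exact: ccont_comp.
by move=> w; rewrite (Hq (f w)) {2}(Hp w); ring.
Qed.

Lemma cdiff_cst c z : cdiff (fun=> c) z. Proof. exists 0; exact: cdiffto_cst. Qed.

Lemma cdiff_id z : cdiff id z. Proof. exists 1; exact: cdiffto_id. Qed.

Lemma cdiffD f g z : cdiff f z -> cdiff g z -> cdiff (fun w => f w + g w) z.
Proof. by move=> [l H] [m K]; eexists; exact: cdifftoD H K. Qed.

Lemma cdiffM f g z : cdiff f z -> cdiff g z -> cdiff (fun w => f w * g w) z.
Proof. by move=> [l H] [m K]; eexists; exact: cdifftoM H K. Qed.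

Lemma cdiffN f z : cdiff f z -> cdiff (fun w => - f w) z.
Proof.
move=> H; apply: (@cdiff_ext (fun w => (-1) * f w)); first by move=> w; rewrite mulN1r.
by apply: cdiffM => //; exact: cdiff_cst.
Qed.

Lemma cdiffB f g z : cdiff f z -> cdiff g z -> cdiff (fun w => f w - g w) z.
Proof. by move=> H K; apply: cdiffD => //; exact: cdiffN. Qed.

Lemma cdiffV f z : f z != 0 -> cdiff f z -> cdiff (fun w => (f w)^-1) z.
Proof. by move=> fz [l H]; eexists; exact: cdifftoV H. Qed.

Lemma cdiff_div f g z : g z != 0 -> cdiff f z -> cdiff g z ->
  cdiff (fun w => f w / g w) z.
Proof. by move=> gz H K; apply: cdiffM => //; exact: cdiffV. Qed.

Lemma cdiffX f z n : cdiff f z -> cdiff (fun w => f w ^+ n) z.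
Proof.
move=> H; elim: n => [|n IH]; first exact: cdiff_cst.
by apply: (@cdiff_ext (fun w => f w * f w ^+ n)) => [w|]; [rewrite exprS|exact: cdiffM].
Qed.

Lemma cdiff_comp f g z : cdiff f z -> cdiff g (f z) -> cdiff (fun w => g (f w)) z.
Proof. by move=> [l H] [m K]; eexists; exact: cdiffto_comp H K. Qed.

Lemma cdiff_sum (I : Type) (s : seq I) (F : I -> C -> C) z :
  (forall i, cdiff (F i) z) -> cdiff (fun w => \sum_(i <- s) F i w) z.
Proof.
move=> H; elim: s => [|i s IH].
  by apply: (@cdiff_ext (fun=> 0)) => [w|]; [rewrite big_nil|exact: cdiff_cst].
by apply: (@cdiff_ext (fun w => F i w + \sum_(i <- s) F i w)) => [w|];
  [rewrite big_cons|exact: cdiffD].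
Qed.

Lemma cdiff_prod (I : Type) (s : seq I) (F : I -> C -> C) z :
  (forall i, cdiff (F i) z) -> cdiff (fun w => \prod_(i <- s) F i w) z.
Proof.
move=> H; elim: s => [|i s IH].
  by apply: (@cdiff_ext (fun=> 1)) => [w|]; [rewrite big_nil|exact: cdiff_cst].
by apply: (@cdiff_ext (fun w => F i w * \prod_(i <- s) F i w)) => [w|];
  [rewrite big_cons|exact: cdiffM].
Qed.

Lemma cdiff_subr a z : cdiff (fun w => w - a) z.
Proof. by apply: cdiffB; [exact: cdiff_id|exact: cdiff_cst]. Qed.

Lemma cdiff_horner (p : {poly C}) z : cdiff (fun w => p.[w]) z.
Proof.
apply: (@cdiff_ext (fun w => \sum_(i <- index_enum 'I_(size p)) p`_i * w ^+ i)).
  by move=> w; rewrite horner_coef.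
apply: cdiff_sum => i; apply: cdiffM; first exact: cdiff_cst.
by apply: cdiffX; exact: cdiff_id.
Qed.

Lemma cdiffto_lip f z l : cdiffto f z l ->
  cnear z (fun w => cabs (f w - f z) <= (cabs l + 1) * cabs (w - z)).
Proof.
move=> H0; apply: cnear_imp (H0 _ ltr01) => w; rewrite mul1r => h.
have -> : f w - f z = (w - z) * l + (f w - f z - (w - z) * l) by ring.
by rewrite (le_trans (cabsD _ _))// cabsM (mulrDl (cabs l)) mul1r [cabs l * _]mulrC
  lerD2l.
Qed.

Lemma cdiff_lip f z : cdiff f z ->
  exists2 M, 0 <= M & cnear z (fun w => cabs (f w - f z) <= M * cabs (w - z)).
Proof. by move=> [l /cdiffto_lip H]; exists (cabs l + 1); rewrite ?addr_ge0 ?cabs_ge0.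
  Qed.

End ComplexDifferentiability.

(** * Goursat's lemma for real one-forms *)

Section Goursat.

Variable R : realType.
Implicit Types (F f g : R -> R) (P Q A B : R -> R -> R) (e d h k : R).

Lemma mvt_bound F (dF : R -> R) (a b M : R) : a <= b ->
  (forall x, a <= x <= b -> is_derive x 1 F (dF x)) ->
  (forall x, a <= x <= b -> `|dF x| <= M) -> `|F b - F a| <= M * (b - a).
Proof.
move=> ab dFx bd; have [] := @MVT_segment R F dF a b ab.
- by move=> x /itvP xab; apply: dFx; rewrite !xab.
- apply: derivable_within_continuous => x; rewrite in_itv => /dFx h.
  exact: ex_derive.
- move=> c; rewrite in_itv => /bd cM ->; rewrite normrM [`|b - a|]ger0_norm ?subr_ge0//.
  by rewrite ler_wpM2r// subr_ge0.
Qed.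

Definition primitive_on (a b : R) f F := forall x, a < x < b -> is_derive x 1 F (f x).

Lemma primitive_uniq (a b : R) f F F' (x y : R) : primitive_on a b f F ->
  primitive_on a b f F' ->
  a < x < b -> a < y < b -> x <= y -> F y - F x = F' y - F' x.
Proof.
move=> pF pF' /andP[ax xb] /andP[ay yb] xy; apply/eqP; rewrite -subr_eq0 -normr_le0.
have -> : F y - F x - (F' y - F' x) = (F \- F') y - (F \- F') x by rewrite /=; ring.
rewrite -(mul0r (y - x)); apply: (@mvt_bound _ (fun z => f z - f z)) =>
  // z /andP[xz zy].
  have /pF ? : a < z < b by rewrite (lt_le_trans ax)//= (le_lt_trans zy).
  have /pF' ? : a < z < b by rewrite (lt_le_trans ax)//= (le_lt_trans zy).
  exact: is_deriveB.
by rewrite subrr normr0.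
Qed.

Lemma primitive_exists f (a b : R) : (forall x, a <= x <= b -> {for x, continuous f}) ->
  exists F, primitive_on a b f F.
Proof.
move=> cf; have mf : lebesgue_measure.-integrable `[a, b] (EFin \o f).
  apply: continuous_compact_integrable; first exact: segment_compact.
  by apply: continuous_in_subspaceT => x; rewrite inE /= in_itv /= => /cf.
exists (fun y => \int[lebesgue_measure]_(t in `[a, y]) f t) => x /andP[ax xb].
have [] := @continuous_FTC1_closed R f a x b xb mf ax.
  by apply: cf; rewrite !ltW.
by move=> D E; apply: DeriveDef; [exact: D|rewrite -derive1E; exact: E].
Qed.

(** The integral of the form P dr + Q dt round the rectangle with corner (r, t)
and sides h and k, when A is a primitive of P in r and B a primitive of Q in t.
Through primitives, additivity under subdivision is a ring identity. *)
Definition rect_circulation A B (r t h k : R) : R :=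
  (A (r + h) t - A r t) + (B (r + h) (t + k) - B (r + h) t)
  - (A (r + h) (t + k) - A r (t + k)) - (B r (t + k) - B r t).

(** Total differentiability of a function of two real variables at (r, t), with
partial derivatives p and q. *)
Definition real_diff2 P (r t p q : R) := forall e, 0 < e -> exists2 d : R, 0 < d &
  forall r' t', `|r' - r| < d -> `|t' - t| < d ->
   `|P r' t' - P r t - p * (r' - r) - q * (t' - t)| <= e * (`|r' - r| + `|t' - t|).

Section Rectangles.

Variables (P Q A B : R -> R -> R) (al be ga de : R).
Hypothesis closedPQ : forall r t, al < r < be -> ga < t < de ->
  exists p1 p2 q2, real_diff2 P r t p1 p2 /\ real_diff2 Q r t p2 q2.
Hypothesis primA : forall t, ga < t < de -> primitive_on al be (P ^~ t) (A ^~ t).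
Hypothesis primB : forall r, al < r < be -> primitive_on ga de (Q r) (B r).

(** The first order part of the form at (r, t) is closed, and its circulation
round any rectangle is zero. What remains are four integrals over sides, of
functions bounded by e (h + k). *)
Lemma green_goursat_local r t e : al < r < be -> ga < t < de -> 0 < e ->
  exists2 d : R, 0 < d & forall r0 t0 h k, 0 <= h < d -> 0 <= k < d ->
   al < r0 -> r0 + h < be -> ga < t0 -> t0 + k < de ->
   r0 <= r <= r0 + h -> t0 <= t <= t0 + k ->
   `|rect_circulation A B r0 t0 h k| <= e * (h + k) ^+ 2.
Proof.
move=> rin tin e0; have e20 : 0 < e / 2 by rewrite divr_gt0.
have [p1 [p2 [q2 [dP dQ]]]] := closedPQ rin tin.
have [d1 d10 {}dP] := dP _ e20; have [d2 d20 {}dQ] := dQ _ e20.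
exists (Num.min d1 d2); first by rewrite lt_min d10.
move=> r0 t0 h k /andP[h0 hd] /andP[k0 kd] alr rbe gat tde /andP[r0r rr0]
  /andP[t0t tt0].
move: hd kd; rewrite !lt_min => /andP[hd1 hd2] /andP[kd1 kd2].
have eA : `|(A (r0 + h) t0 - A (r0 + h) (t0 + k) - p2 * (t0 - (t0 + k)) * (r0 + h))
          - (A r0 t0 - A r0 (t0 + k) - p2 * (t0 - (t0 + k)) * r0)| <= e * (h + k) * h.
  have -> : e * (h + k) * h = e * (h + k) * (r0 + h - r0) by ring.
  apply: (@mvt_bound (fun x => A x t0 - A x (t0 + k) - p2 * (t0 - (t0 + k)) * x)
    (fun x => P x t0 - P x (t0 + k) - p2 * (t0 - (t0 + k)))).
  - by rewrite lerDl.
  - move=> x /andP[xr xr1].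
    have xin : al < x < be by rewrite (lt_le_trans alr)//= (le_lt_trans xr1).
    have ? : is_derive x 1 (A ^~ t0) (P x t0).
      by apply: primA => //; rewrite gat/= (le_lt_trans t0t)//; case/andP: tin.
    have ? : is_derive x 1 (A ^~ (t0 + k)) (P x (t0 + k)).
      by apply: primA => //; rewrite tde andbT (lt_le_trans gat)// lerDl.
    have ? : is_derive x 1 (fun x => p2 * (t0 - (t0 + k)) * x) (p2 * (t0 - (t0 + k))).
      have := @is_deriveZ R R R id (p2 * (t0 - (t0 + k))) x 1 1 (is_derive_id _ _).
      by rewrite /GRing.scale/= mulr1.
    by apply: is_deriveB.
  - move=> x /andP[xr xr1].
    have X : `|x - r| <= h by rewrite ler_norml; apply/andP; split; lra.
    have kt0 : `|t0 - t| <= k by rewrite ler_norml; apply/andP; split; lra.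
    have kt1 : `|t0 + k - t| <= k by rewrite ler_norml; apply/andP; split; lra.
    have H1 := dP x t0 (le_lt_trans X hd1) (le_lt_trans kt0 kd1).
    have H2 := dP x (t0 + k) (le_lt_trans X hd1) (le_lt_trans kt1 kd1).
    have -> : P x t0 - P x (t0 + k) - p2 * (t0 - (t0 + k)) =
      (P x t0 - P r t - p1 * (x - r) - p2 * (t0 - t)) -
      (P x (t0 + k) - P r t - p1 * (x - r) - p2 * (t0 + k - t)) by ring.
    rewrite (le_trans (ler_normB _ _))// (le_trans (lerD H1 H2))//.
    have -> : e * (h + k) = e / 2 * (h + k) + e / 2 * (h + k) by field.
    by apply: lerD; rewrite ler_wpM2l ?(ltW e20)// lerD.
have eB : `|(B (r0 + h) (t0 + k) - B r0 (t0 + k) - p2 * h * (t0 + k))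
          - (B (r0 + h) t0 - B r0 t0 - p2 * h * t0)| <= e * (h + k) * k.
  have -> : e * (h + k) * k = e * (h + k) * (t0 + k - t0) by ring.
  apply: (@mvt_bound (fun x => B (r0 + h) x - B r0 x - p2 * h * x)
    (fun x => Q (r0 + h) x - Q r0 x - p2 * h)).
  - by rewrite lerDl.
  - move=> x /andP[xr xr1].
    have xin : ga < x < de by rewrite (lt_le_trans gat)//= (le_lt_trans xr1).
    have ? : is_derive x 1 (B r0) (Q r0 x).
      by apply: primB => //; rewrite alr/= (le_lt_trans r0r)//; case/andP: rin.
    have ? : is_derive x 1 (B (r0 + h)) (Q (r0 + h) x).
      by apply: primB => //; rewrite rbe andbT (lt_le_trans alr)// lerDl.
    have ? : is_derive x 1 (fun x => p2 * h * x) (p2 * h).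
      have := @is_deriveZ R R R id (p2 * h) x 1 1 (is_derive_id _ _).
      by rewrite /GRing.scale/= mulr1.
    by apply: is_deriveB.
  - move=> x /andP[xr xr1].
    have X : `|x - t| <= k by rewrite ler_norml; apply/andP; split; lra.
    have kt0 : `|r0 - r| <= h by rewrite ler_norml; apply/andP; split; lra.
    have kt1 : `|r0 + h - r| <= h by rewrite ler_norml; apply/andP; split; lra.
    have H1 := dQ (r0 + h) x (le_lt_trans kt1 hd2) (le_lt_trans X kd2).
    have H2 := dQ r0 x (le_lt_trans kt0 hd2) (le_lt_trans X kd2).
    have -> : Q (r0 + h) x - Q r0 x - p2 * h =
      (Q (r0 + h) x - Q r t - p2 * (r0 + h - r) - q2 * (x - t)) -
      (Q r0 x - Q r t - p2 * (r0 - r) - q2 * (x - t)) by ring.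
    rewrite (le_trans (ler_normB _ _))// (le_trans (lerD H1 H2))//.
    have -> : e * (h + k) = e / 2 * (h + k) + e / 2 * (h + k) by field.
    by apply: lerD; rewrite ler_wpM2l ?(ltW e20)// lerD.
have -> : e * (h + k) ^+ 2 = e * (h + k) * h + e * (h + k) * k by ring.
apply: le_trans (lerD eA eB); apply: le_trans (ler_normD _ _).
by rewrite le_eqVlt; apply/orP; left; apply/eqP; congr (`|_|);
  rewrite /rect_circulation; ring.
Qed.

Lemma rect_circulation_split r t h k :
  rect_circulation A B r t h k =
  rect_circulation A B r t (h / 2) (k / 2) + rect_circulation A B (r + h / 2) t (h / 2)
    (k / 2) +
  (rect_circulation A B r (t + k / 2) (h / 2) (k / 2) + rect_circulation A B
    (r + h / 2) (t + k / 2) (h / 2) (k / 2)).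
Proof.
have E1 : r + h / 2 + h / 2 = r + h by field.
have E2 : t + k / 2 + k / 2 = t + k by field.
by rewrite /rect_circulation E1 E2; ring.
Qed.

(** Goursat's bisection. If the circulation is c <> 0, one of the four quarters
has circulation at least c / 4 in absolute value, and so on; the rectangles
shrink to a point where this contradicts the bound e * (h + k)^2 / 4^n given by
[green_goursat_local]. *)
Lemma green_goursat r0 t0 h k : 0 <= h -> 0 <= k ->
  al < r0 -> r0 + h < be -> ga < t0 -> t0 + k < de -> rect_circulation A B r0 t0 h k
    = 0.
Proof.
move=> h0 k0 alr rbe gat tde; apply/eqP; apply: contraT; rewrite -normr_gt0.
set c := `|_| => c0.
pose hn n := h / 2 ^+ n; pose kn n := k / 2 ^+ n.
have hS n : hn n.+1 = hn n / 2 by rewrite /hn exprS invfM mulrCA mulrC.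
have kS n : kn n.+1 = kn n / 2 by rewrite /kn exprS invfM mulrCA mulrC.
have hn0 n : 0 <= hn n by rewrite divr_ge0// exprn_ge0.
have kn0 n : 0 <= kn n by rewrite divr_ge0// exprn_ge0.
pose bad (s : R * R) n := c / 4 ^+ n <= `|rect_circulation A B s.1 s.2 (hn n) (kn n)|.
have step (s : R * R) n : bad s n -> exists2 s', bad s' n.+1 &
   [/\ s.1 <= s'.1, s'.1 + hn n.+1 <= s.1 + hn n, s.2 <= s'.2 & s'.2 + kn n.+1
     <= s.2 + kn n].
  rewrite /bad hS kS => H; apply: contrapT => N.
  have Hq x y : s.1 <= x -> x + hn n / 2 <= s.1 + hn n -> s.2 <= y ->
      y + kn n / 2 <= s.2 + kn n -> `|rect_circulation A B x y (hn n / 2) (kn n / 2)|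
        < c / 4 ^+ n.+1.
    move=> x1 x2 y1 y2; rewrite ltNge; apply/negP => K; apply: N.
    by exists (x, y) => //=.
  have := hn0 n; have := kn0 n; set a := hn n in H Hq *; set b := kn n in H Hq * =>
    b0 a0.
  move: H; apply/negP; rewrite -ltNge rect_circulation_split.
  have -> : c / 4 ^+ n = c / 4 ^+ n.+1 + c / 4 ^+ n.+1 +
    (c / 4 ^+ n.+1 + c / 4 ^+ n.+1).
    have n40 : (4 : R) ^+ n != 0 by rewrite expf_neq0// pnatr_eq0.
    by rewrite exprS; field.
  rewrite (le_lt_trans (ler_normD _ _))// ltrD// (le_lt_trans (ler_normD _ _))// ltrD//;
   apply: Hq; lra.
pose nxt n s := xget s [set s' | bad s n -> bad s' n.+1 /\
   [/\ s.1 <= s'.1, s'.1 + hn n.+1 <= s.1 + hn n, s.2 <= s'.2 & s'.2 + kn n.+1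
     <= s.2 + kn n]].
(* S n is the lower left corner of the n-th rectangle. *)
pose fix S n := if n is m.+1 then nxt m (S m) else (r0, t0).
have badS n : bad (S n) n.
  elim: n => [|n IH]; first by rewrite /bad expr0 divr1 /hn /kn expr0 !divr1.
  rewrite /= /nxt; case: xgetP => [s' _ /(_ IH)[]//|].
  have [s' b1 b2] := step _ _ IH; by move=> /(_ s') []; split.
have nestS n : [/\ (S n).1 <= (S n.+1).1, (S n.+1).1 + hn n.+1 <= (S n).1 + hn n,
    (S n).2 <= (S n.+1).2 & (S n.+1).2 + kn n.+1 <= (S n).2 + kn n].
  rewrite /= /nxt; case: xgetP => [s' _ /(_ (badS n))[]//|].
  have [s' b1 b2] := step _ _ (badS n); by move=> /(_ s') []; split.
have lim (u w : nat -> R) : (forall n, u n <= u n.+1) ->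
  (forall n, u n.+1 + w n.+1 <= u n + w n) ->
   (forall n, 0 <= w n) -> exists x, forall n, u n <= x <= u n + w n.
  move=> u1 u2 w0.
  have um n m : (n <= m)%N -> u n <= u m.
    move=> /subnK <-; elim: (m - n)%N => // i IH; exact: le_trans IH (u1 _).
  have uw n m : (n <= m)%N -> u m + w m <= u n + w n.
    move=> /subnK <-; elim: (m - n)%N => // i IH; exact: le_trans (u2 _) IH.
  have ub n m : u m <= u n + w n.
    have [nm|/ltnW mn] := leqP n m.
      by apply: le_trans (uw _ _ nm); rewrite lerDl.
    by apply: le_trans (um _ _ mn) _; rewrite lerDl.
  exists (sup (range u)) => n; apply/andP; split.
    apply: sup_upper_bound; last by exists n.
    by split; [exists (u 0%N), 0%N|exists (u 0%N + w 0%N) => _ [m _ <-]].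
  apply: ge_sup; first by exists (u 0%N), 0%N.
  by move=> _ [m _ <-].
have [r Hr] := lim (fun n => (S n).1) hn (fun n => let: And4 a _ _ _ := nestS n in a)
   (fun n => let: And4 _ a _ _ := nestS n in a) hn0.
have [t Ht] := lim (fun n => (S n).2) kn (fun n => let: And4 _ _ a _ := nestS n in a)
   (fun n => let: And4 _ _ _ a := nestS n in a) kn0.
have Sr n : r0 <= (S n).1 /\ (S n).1 + hn n <= r0 + h.
  elim: n => [|n [i1 i2]]; first by rewrite /= /hn expr0 divr1.
  by have [n1 n2 _ _] := nestS n; split; [exact: le_trans n1|exact: le_trans i2].
have St n : t0 <= (S n).2 /\ (S n).2 + kn n <= t0 + k.
  elim: n => [|n [i1 i2]]; first by rewrite /= /kn expr0 divr1.
  by have [_ _ n1 n2] := nestS n; split; [exact: le_trans n1|exact: le_trans i2].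
have rin : al < r < be.
  have := Hr 0%N; rewrite /= /hn expr0 divr1 => /andP[a b].
  by rewrite (lt_le_trans alr)//= (le_lt_trans b).
have tin : ga < t < de.
  have := Ht 0%N; rewrite /= /kn expr0 divr1 => /andP[a b].
  by rewrite (lt_le_trans gat)//= (le_lt_trans b).
(* With this e the local bound is smaller than c / 4^n. *)
pose e : R := c / ((h + k) ^+ 2 + 1) / 2.
have D0 : 0 < (h + k) ^+ 2 + 1 by rewrite ltr_wpDl// sqr_ge0.
have e0 : 0 < e by rewrite !divr_gt0.
have [d d0 loc] := green_goursat_local rin tin e0.
have [n nd] : exists n, (h + k) / 2 ^+ n < d.
  have [->|hk] := eqVneq (h + k) 0; first by exists 0%N; rewrite mul0r.
  have hk0 : 0 < h + k by rewrite lt_def hk addr_ge0.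
  exists (Num.truncn ((h + k) / d)).+1; rewrite ltr_pdivrMr ?exprn_gt0//.
  rewrite mulrC -ltr_pdivrMr//; apply: lt_trans (truncnS_gt _) _.
  by rewrite -natrX ltr_nat ltn_expl.
have hd : hn n < d.
  by apply: le_lt_trans nd; rewrite ler_pM2r ?invr_gt0 ?exprn_gt0// lerDl.
have kd : kn n < d.
  by apply: le_lt_trans nd; rewrite ler_pM2r ?invr_gt0 ?exprn_gt0// lerDr.
have [Sr1 Sr2] := Sr n; have [St1 St2] := St n.
have := loc (S n).1 (S n).2 (hn n) (kn n).
rewrite hn0 hd kn0 kd; move=> /(_ isT isT (lt_le_trans alr Sr1) (le_lt_trans Sr2 rbe)).
move=> /(_ (lt_le_trans gat St1) (le_lt_trans St2 tde) (Hr n) (Ht n)) H.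
have := le_trans (badS n) H.
have -> : hn n + kn n = (h + k) / 2 ^+ n by rewrite -mulrDl.
have p20 : 0 < (2 : R) ^+ n by rewrite exprn_gt0.
have -> : (4 : R) ^+ n = 2 ^+ n ^+ 2 by rewrite -exprM mulnC exprM; congr (_ ^+ n);
  ring.
rewrite expr_div_n mulrA ler_pM2r ?invr_gt0 ?exprn_gt0//.
rewrite leNgt => /negP[].
have eE : e * ((h + k) ^+ 2 + 1) = c / 2 by rewrite /e; field; rewrite gt_eqF.
have -> : e * (h + k) ^+ 2 = c / 2 - e by rewrite -eE; ring.
by move: e0 c0; lra.
Qed.

End Rectangles.

End Goursat.

(** * Means over circles *)

Section CircleMeans.

Variable R : realType.
Local Notation C := R[i].
Implicit Types (f g : C -> C) (a z w : C) (e d : R) (phi chi : R -> C) (u v : R -> R).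

Definition two_pi : R := 2 * pi.
Lemma two_pi_gt0 : 0 < two_pi.
Proof. by rewrite /two_pi mulr_gt0// pi_gt0. Qed.

(** The primitive is taken on a neighbourhood of [0, 2 pi], so that it is
differentiable at both end points; any two choices give the same increment. *)
Definition period_int u : R :=
  let F := xget (fun=> 0) (primitive_on (-1) (two_pi + 1) u) in F two_pi - F 0.

Lemma period_intE u F : primitive_on (-1) (two_pi + 1) u F ->
  period_int u = F two_pi - F 0.
Proof.
move=> pF; rewrite /period_int; case: xgetP => [G _ pG|/(_ F)//].
by have := two_pi_gt0 => T00; apply: (primitive_uniq pG pF); lra.
Qed.

Definition rcont u := forall x, {for x, continuous u}.
Lemma period_primitive u : rcont u -> exists F, primitive_on (-1) (two_pi + 1) u F.
Proof. by move=> cu; apply: primitive_exists. Qed.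

Lemma period_intD u v : rcont u -> rcont v -> period_int (fun t => u t + v t)
  = period_int u + period_int v.
Proof.
move=> /period_primitive[F pF] /period_primitive[G pG];
  rewrite (period_intE pF) (period_intE pG).
rewrite (@period_intE _ (fun t => F t + G t)); first by ring.
by move=> x xi; apply: is_deriveD; [exact: pF|exact: pG].
Qed.

Lemma period_intZ (c : R) u : rcont u -> period_int (fun t => c * u t)
  = c * period_int u.
Proof.
move=> /period_primitive[F pF]; rewrite (period_intE pF).
rewrite (@period_intE _ (fun t => c * F t)); first by ring.
by move=> x xi; apply: (@is_deriveZ _ _ _ F c x 1); exact: pF.
Qed.

Lemma period_int_cst (c : R) : period_int (fun=> c) = c * two_pi.
Proof.
rewrite (@period_intE _ (fun t => c * t)); first by ring.
move=> x xi; have := @is_deriveZ R R R id c x 1 1 (is_derive_id _ _).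
by rewrite /GRing.scale/= mulr1.
Qed.

Lemma period_int_bound u M : rcont u -> (forall t, 0 <= t <= two_pi -> `|u t| <= M) ->
  `|period_int u| <= M * two_pi.
Proof.
move=> /period_primitive[F pF] uM; rewrite (period_intE pF) -[X in _ * X]subr0.
have T00 := two_pi_gt0; apply: (@mvt_bound _ F u); rewrite ?ltW// => x /andP[x0 xT].
by apply: pF; lra.
Qed.

Definition path_cont phi := forall t e, 0 < e -> exists2 d : R, 0 < d & forall s,
  `|s - t| < d -> cabs (phi s - phi t) < e.

Lemma rcont_eps u : (forall t e, 0 < e -> exists2 d : R, 0 < d & forall s,
  `|s - t| < d -> `|u s - u t| < e) -> rcont u.
Proof.
move=> H x; apply/cvgrPdist_lt => e /(H x)[d d0 {}H]; apply/nbhs_ballP;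
  exists d => // s.
by rewrite /ball/= distrC => /H; rewrite distrC.
Qed.

Lemma path_cont_Re phi : path_cont phi -> rcont (fun t => complex.Re (phi t)).
Proof.
move=> H; apply: rcont_eps => t e /(H t)[d d0 {}H]; exists d => // s /H.
apply: le_lt_trans; apply: le_trans (cabs_Re _).
by case: (phi s) (phi t) => [a b] [a' b'].
Qed.

Lemma path_cont_Im phi : path_cont phi -> rcont (fun t => complex.Im (phi t)).
Proof.
move=> H; apply: rcont_eps => t e /(H t)[d d0 {}H]; exists d => // s /H.
apply: le_lt_trans; apply: le_trans (cabs_Im _).
by case: (phi s) (phi t) => [a b] [a' b'].
Qed.

Lemma path_cont_comp f phi : (forall t, ccont f (phi t)) -> path_cont phi ->
  path_cont (fun t => f (phi t)).
Proof.
move=> cf cp t e /(cf t)[d d0 H]; have [d' d0' H'] := cp t _ d0.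
by exists d' => // s /H' /H.
Qed.

Lemma path_contD phi chi : path_cont phi -> path_cont chi ->
  path_cont (fun t => phi t + chi t).
Proof.
move=> cf cg t e e0; have h0 : 0 < e / 2 by rewrite divr_gt0.
have [d d0 H] := cf t _ h0; have [d' d0' H'] := cg t _ h0.
exists (Num.min d d'); first by rewrite lt_min d0.
move=> s; rewrite lt_min => /andP[/H ? /H' ?].
by rewrite opprD addrACA (le_lt_trans (cabsD _ _))// (splitr e) ltrD.
Qed.

Lemma path_contZ (c : C) phi : path_cont phi -> path_cont (fun t => c * phi t).
Proof.
move=> cf; apply: (@path_cont_comp (fun z => c * z)) => // t.
by apply: ccontM; [exact: ccont_cst|exact: ccont_id].
Qed.

Lemma path_cont_cst (c : C) : path_cont (fun=> c).
Proof. by move=> t e e0; exists 1 => // s _; rewrite subrr cabs0. Qed.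

Definition period_mean phi : C :=
  Complex (period_int (fun t => complex.Re (phi t)))
    (period_int (fun t => complex.Im (phi t))) / two_pi%:C%C.

Lemma two_piC_neq0 : two_pi%:C%C != 0 :> C.
Proof. by rewrite (inj_eq (@complexI R) _ 0) gt_eqF// two_pi_gt0. Qed.

Lemma period_meanD phi chi : path_cont phi -> path_cont chi ->
  period_mean (fun t => phi t + chi t) = period_mean phi + period_mean chi.
Proof.
move=> cp cc; rewrite /period_mean -mulrDl; congr (_ / _).
have -> : (fun t => complex.Re (phi t + chi t))
  = (fun t => complex.Re (phi t) + complex.Re (chi t)).
  by apply/funext => t; case: (phi t) (chi t) => [? ?] [].
have -> : (fun t => complex.Im (phi t + chi t))
  = (fun t => complex.Im (phi t) + complex.Im (chi t)).
  by apply/funext => t; case: (phi t) (chi t) => [? ?] [].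
by rewrite !period_intD//;
  [exact: path_cont_Im|exact: path_cont_Im|exact: path_cont_Re|exact: path_cont_Re].
Qed.

Lemma period_meanZ (c : C) phi : path_cont phi -> period_mean (fun t => c * phi t)
  = c * period_mean phi.
Proof.
move=> cp; rewrite /period_mean mulrA; congr (_ / _); case: c => x y.
have cR := path_cont_Re cp; have cI := path_cont_Im cp.
have Z (c : R) u : rcont u -> rcont (fun t => c * u t).
  by move=> cu t; apply: continuousM => //; exact: cst_continuous.
have -> : (fun t => complex.Re (Complex x y * phi t)) =
  (fun t => x * complex.Re (phi t) + (- y) * complex.Im (phi t)).
  by apply/funext => t; case: (phi t) => [? ?] /=; rewrite mulNr.
have -> : (fun t => complex.Im (Complex x y * phi t)) =
  (fun t => x * complex.Im (phi t) + y * complex.Re (phi t)).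
  by apply/funext => t; case: (phi t) => [? ?] /=.
rewrite !period_intD ?period_intZ//; try exact: Z.
by rewrite mulNr.
Qed.

Lemma period_mean_cst (c : C) : period_mean (fun=> c) = c.
Proof.
rewrite /period_mean !period_int_cst;
  have -> : Complex (complex.Re c * two_pi) (complex.Im c * two_pi) = c * two_pi%:C%C.
  by case: c => a b; simpc.
by rewrite mulfK// two_piC_neq0.
Qed.

Lemma period_mean_bound phi M : path_cont phi ->
  (forall t, 0 <= t <= two_pi -> cabs (phi t) <= M) ->
  cabs (period_mean phi) <= 2 * M.
Proof.
move=> cp pM; rewrite /period_mean cabsM cabsV cabs_real (gtr0_norm two_pi_gt0)
  ler_pdivrMr ?two_pi_gt0//.
apply: le_trans (cabs_ReIm _) _ => /=.
rewrite -mulrA mulrDl mul1r lerD//; apply: period_int_bound => //;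
  try exact: path_cont_Re; try exact: path_cont_Im.
  by move=> t /pM; apply: le_trans; exact: cabs_Re.
by move=> t /pM; apply: le_trans; exact: cabs_Im.
Qed.

Lemma period_meanB phi chi : path_cont phi -> path_cont chi ->
  period_mean (fun t => phi t - chi t) = period_mean phi - period_mean chi.
Proof.
move=> cp cc; have -> : (fun t => phi t - chi t) = (fun t => phi t + (-1) * chi t).
  by apply/funext => t; rewrite mulN1r.
by rewrite period_meanD ?period_meanZ ?mulN1r//; exact: path_contZ.
Qed.

Lemma path_cont_sum (n : nat) (F : nat -> R -> C) : (forall i, path_cont (F i)) ->
  path_cont (fun t => \sum_(i < n) F i t).
Proof.
move=> H; elim: n => [|n IH].
  have -> : (fun t => \sum_(i < 0) F i t) = (fun=> 0) by apply/funext => t;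
    rewrite big_ord0.
  exact: path_cont_cst.
have -> : (fun t => \sum_(i < n.+1) F i t) = (fun t => \sum_(i < n) F i t + F n t).
  by apply/funext => t; rewrite big_ord_recr.
exact: path_contD.
Qed.

Lemma period_mean_sum (n : nat) (F : nat -> R -> C) : (forall i, path_cont (F i)) ->
  period_mean (fun t => \sum_(i < n) F i t) = \sum_(i < n) period_mean (F i).
Proof.
move=> H; elim: n => [|n IH].
  rewrite big_ord0; have -> : (fun t => \sum_(i < 0) F i t) = (fun=> 0)
    by apply/funext => t; rewrite big_ord0.
  exact: period_mean_cst.
rewrite big_ord_recr/= -IH -period_meanD//; last exact: path_cont_sum.
by congr period_mean; apply/funext => t; rewrite big_ord_recr.
Qed.

Definition circle_pt a (r : R) (t : R) : C := a + r%:C%C * cexpi t.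

Lemma cabs_cexpi t : cabs (cexpi t) = 1 :> R.
Proof.
apply/eqP; rewrite -(@eqrXn2 _ 2%N) ?cabs_ge0// sqr_cabs /= expr1n.
by rewrite cos2Dsin2.
Qed.

Lemma cexpi_two_pi : cexpi two_pi = 1 :> C.
Proof.
have -> : two_pi = 0 + pi *+ 2 by rewrite /two_pi mulr_natl add0r.
by rewrite /cexpi cosD2pi sinD2pi cos0 sin0.
Qed.

Lemma path_cont_cexpi : path_cont (@cexpi R).
Proof.
move=> t e e0; have h0 : 0 < e / 2 by rewrite divr_gt0.
have /cvgrPdist_lt/(_ _ h0)/nbhs_ballP[d /= d0 H] := @continuous_cos R t.
have /cvgrPdist_lt/(_ _ h0)/nbhs_ballP[d' /= d0' H'] := @continuous_sin R t.
exists (Num.min d d'); first by rewrite lt_min d0.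
move=> s; rewrite lt_min => /andP[sd sd']; apply: le_lt_trans (cabs_ReIm _) _ => /=.
rewrite (splitr e) ltrD//.
  by rewrite distrC; apply: H; rewrite /ball/= distrC.
by rewrite distrC; apply: H'; rewrite /ball/= distrC.
Qed.

Lemma path_cont_circle a r : path_cont (circle_pt a r).
Proof. by apply: path_contD; [exact: path_cont_cst|exact/path_contZ/path_cont_cexpi].
  Qed.

Lemma circle_pt_dist a r t : 0 <= r -> cabs (circle_pt a r t - a) = r.
Proof. by move=> r0; rewrite /circle_pt addrAC subrr add0r cabsM cabs_cexpi mulr1
  cabs_real ger0_norm. Qed.

Definition circle_mean g a r := period_mean (fun t => g (circle_pt a r t)).

(** In the coordinate a + cexp w, circles of centre a are vertical segments,
and going once round a circle is a translation by 2 pi i. *)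
Definition cexp w : C := (expR (complex.Re w))%:C%C * cexpi (complex.Im w).

Lemma cexpiD s t : cexpi (s + t) = cexpi s * cexpi t :> C.
Proof. by rewrite /cexpi cosD sinD; simpc; rewrite [sin s * _ + _]addrC. Qed.

Lemma cexpD z w : cexp (z + w) = cexp z * cexp w.
Proof.
case: z w => a b [c d]; rewrite /cexp /= expRD cexpiD rmorphM/=.
by rewrite mulrACA.
Qed.

Lemma cexp_ln (r t : R) : 0 < r -> cexp (Complex (ln r) t) = r%:C%C * cexpi t.
Proof. by move=> r0; rewrite /cexp /= lnK. Qed.

Lemma cabs_cexp w : cabs (cexp w) = expR (complex.Re w).
Proof. by rewrite /cexp cabsM cabs_cexpi mulr1 cabs_real gtr0_norm// expR_gt0. Qed.

Lemma cdiffto_cexp0 : cdiffto cexp 0 1.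
Proof.
move=> e e0; have e60 : 0 < e / 6 by rewrite divr_gt0.
have [d1 d10 H1] := is_derive_eps (is_derive_expR 0) e60.
have [d2 d20 H2] := is_derive_eps (is_derive_cos (0 : R)) e60.
have [d3 d30 H3] := is_derive_eps (is_derive_sin (0 : R)) e60.
have : exists2 d : R, 0 < d & forall x : R, `|x| < d ->
  `|expR x - 1| <= e / 6 /\ `|expR x| <= 2.
  pose e' := Num.min (e / 6) 1.
  have e'0 : 0 < e' by rewrite lt_min e60 ltr01.
  have /cvgrPdist_lt/(_ _ e'0)/nbhs_ballP[d /= d0 H] := @continuous_expR R 0.
  exists d => // x xd; have : `|expR x - 1| < e'.
    by rewrite -expR0 distrC; apply: H; rewrite /ball/= sub0r normrN.
  rewrite lt_min => /andP[h1 h2]; split; first exact: ltW.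
  by rewrite ger0_norm ?expR_ge0//; move: h2; rewrite ltr_norml; lra.
move=> [d4 d40 H4].
exists (Num.min (Num.min d1 d2) (Num.min d3 d4)); first by rewrite !lt_min d10 d20 d30.
move=> w; rewrite subr0 !lt_min => /andP[/andP[w1 w2] /andP[w3 w4]].
have wR : `|complex.Re w| <= cabs w := cabs_Re w.
have wI : `|complex.Im w| <= cabs w := cabs_Im w.
case: w wR wI w1 w2 w3 w4 => x y /=; set m := cabs _ => xm ym w1 w2 w3 w4.
have := H1 x; rewrite subr0 => /(_ (le_lt_trans xm w1)); rewrite expR0 mul1r => {}H1.
have := H2 y; rewrite subr0 => /(_ (le_lt_trans ym w2));
  rewrite cos0 sin0 oppr0 mul0r subr0 => {}H2.
have := H3 y; rewrite subr0 => /(_ (le_lt_trans ym w3));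
  rewrite cos0 sin0 subr0 mul1r => {}H3.
have [H5 H6] := H4 x (le_lt_trans xm w4).
have -> : cexp (Complex x y) - cexp 0 - Complex x y * 1 =
  Complex (expR x * (cos y - 1) + (expR x - 1 - x))
    (expR x * (sin y - y) + (expR x - 1) * y).
  rewrite /cexp /= expR0 /cexpi cos0 sin0 /=; simpc.
  by congr (Complex _ _); ring.
have m0 : 0 <= m := cabs_ge0 _.
have b1 : `|expR x * (cos y - 1)| <= 2 * (e / 6 * m).
  by rewrite normrM ler_pM// (le_trans H2)// ler_wpM2l// ltW.
have b2 : `|expR x * (sin y - y)| <= 2 * (e / 6 * m).
  by rewrite normrM ler_pM// (le_trans H3)// ler_wpM2l// ltW.
have b3 : `|expR x - 1 - x| <= e / 6 * m by rewrite (le_trans H1)// ler_wpM2l// ltW.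
have b4 : `|(expR x - 1) * y| <= e / 6 * m by rewrite normrM ler_pM.
apply: le_trans (cabs_ReIm _) _ => /=.
apply: le_trans (lerD (ler_normD _ _) (ler_normD _ _)) _.
have -> : e * m = 6 * (e / 6 * m) by field.
by move: b1 b2 b3 b4; lra.
Qed.

Lemma cdiff_cexp w : cdiff cexp w.
Proof.
apply: (@cdiff_ext _ (fun z => cexp w * cexp (z - w))).
  by move=> z; rewrite -cexpD addrC subrK.
apply: cdiffM; first exact: cdiff_cst.
apply: (@cdiff_comp _ (fun z => z - w)); first exact: cdiff_subr.
by rewrite subrr; exists 1; exact: cdiffto_cexp0.
Qed.

Lemma real_diff2_cont P (r t p q : R) : real_diff2 P r t p q ->
  {for r, continuous (P ^~ t)} /\ {for t, continuous (P r)}.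
Proof.
move=> /(_ 1 ltr01)[d d0 H].
have K (u : R -> R) x c :
  (forall y, `|y - x| < d -> `|u y - u x - c * (y - x)| <= `|y - x|) ->
    {for x, continuous u}.
  move=> {}H; apply/cvgrPdist_lt => e e0; apply/nbhs_ballP.
  have c0 : 0 < `|c| + 1 by rewrite ltr_wpDl.
  exists (Num.min d (e / (`|c| + 1))) => /=; first by rewrite lt_min d0 divr_gt0.
  move=> y; rewrite /ball/= distrC lt_min => /andP[/H yd].
  rewrite ltr_pdivlMr// => ye; apply: le_lt_trans ye; rewrite -[u x - u y]opprB normrN.
  have -> : u y - u x = (u y - u x - c * (y - x)) + c * (y - x) by ring.
  rewrite (le_trans (ler_normD _ _))// normrM (mulrDr `|y - x|) mulr1 addrC.
  by rewrite lerD// mulrC.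
split.
  apply: (K _ _ p) => y yd; have := H y t yd;
    rewrite subrr normr0 mulr0 subr0 addr0 mul1r; exact.
apply: (K _ _ q) => y yd; have := H r y _ yd;
  rewrite subrr normr0 mulr0 subr0 add0r mul1r; exact.
Qed.

(** In Goursat's lemma the two sides on which t = 0 and t = 2 pi carry the same
integral, since P is periodic in t, and they cancel. *)
Lemma closed_periodic (P Q : R -> R -> R) (al be s1 s2 : R) :
  (forall r t, al <= r <= be -> exists p1 p2 q2,
    real_diff2 P r t p1 p2 /\ real_diff2 Q r t p2 q2) ->
  (forall r, P r 0 = P r two_pi) -> al < s1 -> s1 <= s2 -> s2 < be ->
  period_int (Q s1) = period_int (Q s2).
Proof.
move=> cl per as1 s12 s2b.
have exA t : exists A, primitive_on al be (P ^~ t) A.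
  apply: primitive_exists => r /(cl r t)[p1 [p2 [q2 [D _]]]].
  by have [] := real_diff2_cont D.
have [A pA] := choice exA.
have exB r : exists B, al < r < be -> primitive_on (-1) (two_pi + 1) (Q r) B.
  have [/andP[ar rb]|] := boolP (al < r < be); last by exists 0.
  have [B pB] : exists B, primitive_on (-1) (two_pi + 1) (Q r) B; last by exists B.
  apply: primitive_exists => t _.
  have [|p1 [p2 [q2 [_ D]]]] := cl r t; first by rewrite !ltW.
  by have [] := real_diff2_cont D.
have [B pB] := choice exB.
have TT := two_pi_gt0.
have := @green_goursat R P Q (fun r t => A t r) B al be (-1) (two_pi + 1) _ _ pB s1 0
  (s2 - s1) two_pi.
have E1 : s1 + (s2 - s1) = s2 by ring.
rewrite /rect_circulation E1 add0r => H.
have {H} : A 0 s2 - A 0 s1 + (B s2 two_pi - B s2 0) - (A two_pi s2 - A two_pi s1) -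
  (B s1 two_pi - B s1 0) = 0.
  apply: H => //; try lra.
    by move=> r t /andP[r1 r2] _; apply: cl; rewrite !ltW.
have Aeq : A 0 s2 - A 0 s1 = A two_pi s2 - A two_pi s1.
  apply: (primitive_uniq (pA 0) (f := P ^~ 0)) => //.
  - by have -> : P ^~ 0 = P ^~ two_pi by apply/funext => r; exact: per.
  - by rewrite as1 (le_lt_trans s12).
  - by rewrite s2b (lt_le_trans as1).
rewrite Aeq.
rewrite (period_intE (pB s1 _)) ?as1 ?(le_lt_trans s12)//.
rewrite (period_intE (pB s2 _)) ?s2b ?(lt_le_trans as1)//.
by lra.
Qed.

Definition annulus a (r1 r2 : R) z := r1 < cabs (z - a) < r2.

(** For h (s + i t) = f (a + cexp (s + i t)), the Cauchy-Riemann equations say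
that the form h ds + i h dt has closed real and imaginary parts.
[closed_periodic] applies to each of them between the abscissas ln r and ln r'.
*)
Lemma circle_mean_annulus f a (r1 r2 r r' : R) : 0 <= r1 ->
  (forall z, annulus a r1 r2 z -> cdiff f z) ->
  r1 < r -> r <= r' -> r' < r2 -> circle_mean f a r = circle_mean f a r'.
Proof.
move=> r10 df r1r rr' r'r2.
have r0 : 0 < r by exact: le_lt_trans r1r.
have r'0 : 0 < r' by exact: lt_le_trans rr'.
pose al := ln ((r1 + r) / 2); pose be := ln ((r' + r2) / 2).
have al0 : 0 < (r1 + r) / 2 by lra.
have be0 : 0 < (r' + r2) / 2 by lra.
pose h w := f (a + cexp w).
have dh s t : al <= s <= be -> cdiff h (Complex s t).
  move=> /andP[as_ sb]; apply: (@cdiff_comp _ (fun w => a + cexp w)).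
    by apply: cdiffD; [exact: cdiff_cst|exact: cdiff_cexp].
  apply: df; rewrite /annulus addrAC subrr add0r cabs_cexp/=; apply/andP; split.
    by apply: (@lt_le_trans _ _ ((r1 + r) / 2));
      [lra|rewrite -[X in X <= _]lnK// ler_expR].
  by apply: (@le_lt_trans _ _ ((r' + r2) / 2));
    [rewrite -[X in _ <= X]lnK// ler_expR|lra].
have hper s : h (Complex s 0) = h (Complex s two_pi).
  by rewrite /h /cexp /= cexpi_two_pi /cexpi cos0 sin0.
have hcirc x t : 0 < x -> h (Complex (ln x) t) = f (circle_pt a x t).
  by move=> x0; rewrite /h cexp_ln.
have D s t : al <= s <= be -> exists l : C, forall e, 0 < e -> exists2 d : R, 0 < d &
   forall s' t', `|s' - s| < d -> `|t' - t| < d ->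
    cabs (h (Complex s' t') - h (Complex s t) - Complex (s' - s) (t' - t) * l)
     <= e * (`|s' - s| + `|t' - t|).
  move=> /(dh s t)[l Hl]; exists l => e e0.
  have [d d0 H] := Hl _ e0; exists (d / 2); first by rewrite divr_gt0.
  move=> s' t' sd td.
  have E : Complex s' t' - Complex s t = Complex (s' - s) (t' - t) by simpc.
  have N := cabs_ReIm (Complex (s' - s) (t' - t)); rewrite /= in N.
  have := H (Complex s' t'); rewrite E => {}H; apply: le_trans (H _) _.
    by apply: le_lt_trans N _; lra.
  by rewrite ler_wpM2l// ltW.
have lnal x : r <= x -> al < ln x.
  move=> rx; have x0 := lt_le_trans r0 rx.
  by rewrite ltr_ln ?posrE//; apply: lt_le_trans rx; lra.
have lnbe x : 0 < x -> x <= r' -> ln x < be.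
  by move=> x0 rx; rewrite ltr_ln ?posrE//; apply: le_lt_trans rx _; lra.
have lnle : ln r <= ln r' by rewrite ler_ln.
have I1 : period_int (fun t => complex.Re (h (Complex (ln r) t)))
  = period_int (fun t => complex.Re (h (Complex (ln r') t))).
  apply: (@closed_periodic (fun s t => complex.Im (h (Complex s t)))
     (fun s t => complex.Re (h (Complex s t))) al be) => //; last 3 first.
  - by move=> s; rewrite hper.
  - exact: lnal.
  - exact: lnbe.
  move=> s t /(D s t)[[x y] H]; exists y, x, (- y); split=> e /H[d d0 {}H];
    exists d => // s' t' sd td;
   apply: le_trans (H _ _ sd td).
  - apply: le_trans (cabs_Im _); case: (h _) (h _) => [? ?] [? ?]; simpc => /=.
    rewrite le_eqVlt; apply/orP; left; apply/eqP; congr (`|_|); ring.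
  - apply: le_trans (cabs_Re _); case: (h _) (h _) => [? ?] [? ?]; simpc => /=.
    rewrite le_eqVlt; apply/orP; left; apply/eqP; congr (`|_|); ring.
have I2 : period_int (fun t => complex.Im (h (Complex (ln r) t)))
  = period_int (fun t => complex.Im (h (Complex (ln r') t))).
  have : period_int (fun t => - complex.Im (h (Complex (ln r) t)))
    = period_int (fun t => - complex.Im (h (Complex (ln r') t))).
    apply: (@closed_periodic (fun s t => complex.Re (h (Complex s t)))
       (fun s t => - complex.Im (h (Complex s t))) al be) => //; last 3 first.
    - by move=> s; rewrite hper.
    - exact: lnal.
    - exact: lnbe.
    move=> s t /(D s t)[[x y] H]; exists x, (- y), (- x); split=> e /H[d d0 {}H];
      exists d => // s' t' sd td;
     apply: le_trans (H _ _ sd td).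
    - apply: le_trans (cabs_Re _); case: (h _) (h _) => [? ?] [? ?]; simpc => /=.
      rewrite le_eqVlt; apply/orP; left; apply/eqP; congr (`|_|); ring.
    - apply: le_trans (cabs_Im _); case: (h _) (h _) => [? ?] [? ?]; simpc => /=.
      rewrite -normrN le_eqVlt; apply/orP; left; apply/eqP; congr (`|_|); ring.
  have cI x : al <= ln x <= be -> rcont (fun t => complex.Im (h (Complex (ln x) t))).
    move=> xab; apply: path_cont_Im => t e e0;
      have [d d0 H] := cdiff_ccont (dh _ t xab) e0.
    exists d => // s sd; apply: H.
    have -> : Complex (ln x) s - Complex (ln x) t = Complex 0 (s - t).
      by rewrite -[LHS]/(Complex (ln x - ln x) (s - t)) subrr.
    by apply: le_lt_trans (cabs_ReIm _) _; rewrite /= normr0 add0r.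
  have N u : (fun t => - u t) = (fun t => (-1) * u t) :> (R -> R) by apply/funext => t;
    rewrite mulN1r.
  rewrite !N !period_intZ; first by move/(mulfI (_ : -1 != 0)); apply;
    rewrite oppr_eq0 oner_eq0.
  - by apply: cI; rewrite !ltW ?lnal ?lnbe.
  - by apply: cI; rewrite !ltW ?lnal ?lnbe.
have E x : 0 < x -> circle_mean f a x
  = Complex (period_int (fun t => complex.Re (h (Complex (ln x) t))))
    (period_int (fun t => complex.Im (h (Complex (ln x) t)))) / two_pi%:C%C.
  move=> x0; rewrite /circle_mean /period_mean; congr (Complex _ _ / _);
    congr period_int.
    by apply/funext => t; rewrite hcirc.
  by apply/funext => t; rewrite hcirc.
by rewrite (E _ r0) (E _ r'0) I1 I2.
Qed.

End CircleMeans.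

(** * Cauchy's formula and Taylor expansion *)

Section Cauchy.

Variable R : realType.
Local Notation C := R[i].
Implicit Types (f g : C -> C) (a z w x : C) (e d r : R).

(** The form of compactness used for uniform estimates over a circle: here d
measures how good the estimate is, and decreasing it weakens Pr. *)
Lemma segment_unif (Pr : R -> R -> Prop) (a b : R) :
  (forall d d' t, d' <= d -> Pr d t -> Pr d' t) ->
  (forall t, a <= t <= b -> exists2 d : R, 0 < d & forall t', `|t' - t| < d ->
    Pr d t') ->
  exists2 d : R, 0 < d & forall t, a <= t <= b -> Pr d t.
Proof.
move=> mono loc.
have := (compact_near_coveringP _).1 (@segment_compact R a b) R (0^'+) Pr _ _.
move=> /(_ _ _)[|].
  move=> t; rewrite /= in_itv => /loc[d d0 H].
  exists ([set t' | `|t' - t| < d], [set s | 0 < s < d]) => /=.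
    split; first by apply/nbhs_ballP; exists d => // s; rewrite /ball/= distrC.
    exists d => //= s; rewrite /ball/= sub0r normrN => sd s0; rewrite s0/=.
    by rewrite (le_lt_trans (ler_norm _) sd).
  by move=> [t' s] /= [h1 /andP[_ h2]]; apply: mono (ltW h2) _; exact: H.
move=> d /= d0 H; exists (d / 2); first by rewrite divr_gt0.
have d20 : 0 < d / 2 by rewrite divr_gt0.
move=> t tab; apply: (H (d / 2)) => //=.
by rewrite sub0r normrN gtr0_norm// ltr_pdivrMr// ltr_pMr// ltr1n.
Qed.

Definition disc_at a r z := cabs (z - a) < r.
Definition cont_circle g a r := forall z, cabs (z - a) = r -> ccont g z.

Lemma path_cont_on_circle g a r : 0 <= r -> cont_circle g a r ->
  path_cont (fun t => g (circle_pt a r t)).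
Proof.
move=> r0 cg; apply: path_cont_comp; last exact: path_cont_circle.
by move=> t; apply: cg; rewrite circle_pt_dist.
Qed.

Lemma circle_bounded g a r : 0 <= r -> cont_circle g a r ->
  exists2 M : R, 0 <= M & forall t, 0 <= t <= two_pi R -> cabs (g (circle_pt a r t))
    <= M.
Proof.
move=> r0 cg; have cc := path_cont_on_circle r0 cg.
have [d d0 H] : exists2 d : R, 0 < d & forall t, 0 <= t <= two_pi R -> 0 < d ->
  cabs (g (circle_pt a r t)) <= d^-1.
  apply: segment_unif.
    move=> d d' t dd H d'0; have d0 := lt_le_trans d'0 dd.
    by apply: le_trans (H d0) _; rewrite lef_pV2.
  move=> t _; have [d d0 H] := cc t _ ltr01.
  pose m := cabs (g (circle_pt a r t)) + 1.
  have m0 : 0 < m by rewrite ltr_wpDl ?cabs_ge0.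
  exists (Num.min d m^-1); first by rewrite lt_min d0 invr_gt0.
  move=> t'; rewrite lt_min => /andP[/H h _] dm0.
  apply: (@le_trans _ _ m).
    rewrite -[g _](subrK (g (circle_pt a r t))) (le_trans (cabsD _ _))// addrC lerD2l.
    exact: ltW.
  by rewrite -[X in X <= _]invrK lef_pV2 ?posrE ?invr_gt0// ge_min lexx orbT.
by exists d^-1 => [|t /H/(_ d0)//]; rewrite invr_ge0 ltW.
Qed.

Lemma circle_mean_bound g a r M : 0 <= r -> cont_circle g a r ->
  (forall t, 0 <= t <= two_pi R -> cabs (g (circle_pt a r t)) <= M) ->
    cabs (circle_mean g a r) <= 2 * M.
Proof. by move=> r0 cg gM; apply: period_mean_bound => //; exact: path_cont_on_circle.
  Qed.

Lemma circle_pt_sub a r r' s t : circle_pt a r' s - circle_pt a r t =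
  (r' - r)%:C%C * cexpi s + r%:C%C * (cexpi s - cexpi t).
Proof. by rewrite /circle_pt rmorphB/=; ring. Qed.

Lemma circle_mean_cont g a r e : 0 <= r -> cont_circle g a r -> 0 < e ->
  exists2 d : R, 0 < d & forall r', 0 <= r' -> `|r' - r| < d -> cont_circle g a r' ->
    cabs (circle_mean g a r' - circle_mean g a r) <= e.
Proof.
move=> r0 cg e0; have e40 : 0 < e / 4 by rewrite divr_gt0.
have [d d0 H] : exists2 d : R, 0 < d & forall t, 0 <= t <= two_pi R -> forall r',
  `|r' - r| < d ->
   cabs (g (circle_pt a r' t) - g (circle_pt a r t)) <= e / 2.
  apply: segment_unif; first by move=> d d' t dd H r' /lt_le_trans h; exact: H (h _ dd).
  move=> t _; have cz : ccont g (circle_pt a r t) by apply: cg; rewrite circle_pt_dist.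
  have [d d0 H] := cz _ e40.
  have h0 : 0 < d / 2 / (r + 1) by rewrite !divr_gt0// ltr_wpDl.
  have [d' d'0 H'] := path_cont_cexpi t h0.
  exists (Num.min (d / 2) d'); first by rewrite lt_min d'0 divr_gt0.
  have K s r' : `|s - t| < d' -> `|r' - r| < d / 2 ->
    cabs (circle_pt a r' s - circle_pt a r t) < d.
    move=> /H' sd rd; rewrite circle_pt_sub (splitr d) (le_lt_trans (cabsD _ _))//
      ltr_leD//.
      by rewrite cabsM cabs_cexpi mulr1 cabs_real.
    rewrite cabsM cabs_real ger0_norm// mulrC.
    have r10 : 0 < r + 1 by rewrite ltr_wpDl.
    move/ltW: sd; rewrite ler_pdivlMr// => /(le_trans _); apply.
    by rewrite ler_wpM2l ?cabs_ge0// lerDl.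
  move=> s; rewrite lt_min => /andP[sd1 sd2] r'; rewrite lt_min => /andP[rd _].
  have h1 := H _ (K s r' sd2 rd).
  have h2 := H _ (K s r sd2 _); rewrite subrr normr0 divr_gt0// in h2.
  have := h2 isT => {}h2.
  have -> : g (circle_pt a r' s) - g (circle_pt a r s)
    = (g (circle_pt a r' s) - g (circle_pt a r t)) -
    (g (circle_pt a r s) - g (circle_pt a r t)) by ring.
  rewrite (le_trans (cabsD _ _))// cabsN; move: h1 h2; lra.
exists d => // r' r'0 rd cg'.
rewrite /circle_mean -period_meanB;
  [|exact: path_cont_on_circle|exact: path_cont_on_circle].
have -> : e = 2 * (e / 2) by field.
apply: period_mean_bound => [|t tT]; last exact: H.
have cc := path_cont_on_circle r0 cg; have cc' := path_cont_on_circle r'0 cg'.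
apply: path_contD => //;
  have -> : (fun t => - g (circle_pt a r t)) = (fun t => (-1) * g (circle_pt a r t))
  by apply/funext => t; rewrite mulN1r.
exact: path_contZ.
Qed.

Lemma circle_mean0 g a : circle_mean g a 0 = g a.
Proof.
rewrite /circle_mean; have -> : (fun t => g (circle_pt a 0 t)) = (fun=> g a);
  last exact: period_mean_cst.
by apply/funext => t; rewrite /circle_pt mul0r addr0.
Qed.

(** The mean over a circle does not depend on the radius as long as the radius
stays on one side of the distance from a to x. It is continuous in the radius,
at 0 and at that distance in particular, so it is constant. The exceptional
point x is there for the difference quotient of [cauchy_formula]. *)
Lemma circle_mean_center g a x rho r : 0 <= r < rho ->
  (forall z, disc_at a rho z -> ccont g z) ->
  (forall z, disc_at a rho z -> z != a -> z != x -> cdiff g z) ->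
  circle_mean g a r = g a.
Proof.
move=> /andP[r0 rrho] cg dg; set m := cabs (x - a).
have cc s : s < rho -> cont_circle g a s by move=> srho z zs; apply: cg;
  rewrite /disc_at zs.
have ann s t : 0 < s -> s <= t -> t < rho -> m < s \/ t < m ->
  circle_mean g a s = circle_mean g a t.
  move=> s0 st trho.
  have neq z : 0 < cabs (z - a) -> cabs (z - a) != m -> z != a /\ z != x.
    by rewrite cabs_gt0 subr_eq0 => -> zm; split=> //; apply: contraNneq zm => ->.
  case=> h.
    apply: (@circle_mean_annulus _ g a m rho) => //; first exact: cabs_ge0.
    move=> z /andP[z1 z2]; have [//||za zx] := neq z; last exact: dg.
      by apply: le_lt_trans z1; exact: cabs_ge0.
    by rewrite gt_eqF.
  apply: (@circle_mean_annulus _ g a 0 (Num.min m rho)) => //; last by rewrite lt_min h.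
  move=> z /andP[z1]; rewrite lt_min => /andP[z2 z3].
  by have [//||za zx] := neq z; [rewrite lt_eqF|exact: dg].
have lim s (c : C) : 0 <= s < rho ->
  (forall d, 0 < d -> exists2 s', `|s' - s| < d & 0 <= s' < rho /\ circle_mean g a s'
  = c) ->
    circle_mean g a s = c.
  move=> /andP[s0 srho] H; apply/eqP; rewrite -subr_eq0 -cabs_eq0; apply/eqP/le_anti.
  rewrite cabs_ge0 andbT; apply/ler_addgt0Pr => e e0; rewrite add0r.
  have [d d0 K] := circle_mean_cont s0 (cc _ srho) e0.
  have [s' sd [/andP[s'0 s'rho] <-]] := H _ d0.
  by rewrite cabs_distC; apply: K => //; exact: cc.
have m0 : 0 <= m by exact: cabs_ge0.
have rho0 : 0 < rho := le_lt_trans r0 rrho.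
have left0 s : 0 <= s < rho -> s < m \/ m = 0 -> circle_mean g a s = g a.
  move=> /andP[]; rewrite le_eqVlt => /predU1P[<- _ _|s0 srho sm];
    first exact: circle_mean0.
  rewrite -(circle_mean0 g a); apply/esym; apply: lim; first by rewrite lexx.
  move=> d d0; have h0 : 0 < Num.min s (d / 2) by rewrite lt_min s0 divr_gt0.
  exists (Num.min s (d / 2)).
    rewrite subr0 gtr0_norm//; apply: (@le_lt_trans _ _ (d / 2)).
      by rewrite ge_min lexx orbT.
    by rewrite ltr_pdivrMr// ltr_pMr// ltr1n.
  split; first by rewrite ltW//= (le_lt_trans _ srho)// ge_min lexx.
  apply: ann => //; first by rewrite ge_min lexx.
  by case: sm => [|->]; [right|left].
have [m00|mn0] := eqVneq m 0; first by apply: left0; [rewrite r0|right].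
have mpos : 0 < m by rewrite lt_def mn0.
have [rm|mr|rm] := ltrgtP r m; first by apply: left0; [rewrite r0|left].
- have mrho := lt_trans mr rrho.
  have E : circle_mean g a m = g a.
    apply: lim; first by rewrite m0.
    move=> d d0; pose s := Num.max 0 (m - d / 2).
    have sm : s < m by rewrite /s gt_max mpos ltrBlDr ltrDl divr_gt0.
    have s0 : 0 <= s by rewrite /s le_max lexx.
    exists s.
      rewrite distrC gtr0_norm ?subr_gt0// /s; apply: (@le_lt_trans _ _ (d / 2)).
        by rewrite lerBlDr -lerBlDl le_max lexx orbT.
      by rewrite ltr_pdivrMr// ltr_pMr// ltr1n.
    have srho := lt_trans sm mrho.
    by split; [rewrite s0|apply: left0; [rewrite s0|left]].
  rewrite -E; apply/esym; apply: lim; first by rewrite m0.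
  move=> d d0; exists (Num.min r (m + d / 2)).
    have h : m < Num.min r (m + d / 2) by rewrite lt_min mr ltrDl divr_gt0.
    rewrite gtr0_norm ?subr_gt0//; apply: (@le_lt_trans _ _ (d / 2)).
      by rewrite lerBlDl ge_min lexx orbT.
    by rewrite ltr_pdivrMr// ltr_pMr// ltr1n.
  have h : m < Num.min r (m + d / 2) by rewrite lt_min mr ltrDl divr_gt0.
  split; first by rewrite (le_trans m0 (ltW h))/= (le_lt_trans _ rrho)// ge_min lexx.
  apply: ann => //; [exact: lt_trans h|by rewrite ge_min lexx|by left].
- apply: lim; first by rewrite r0.
  move=> d d0; pose s := Num.max 0 (m - d / 2).
  have sm : s < m by rewrite /s gt_max mpos ltrBlDr ltrDl divr_gt0.
  have s0 : 0 <= s by rewrite /s le_max lexx.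
  exists s.
    rewrite rm distrC gtr0_norm ?subr_gt0// /s; apply: (@le_lt_trans _ _ (d / 2)).
      by rewrite lerBlDr -lerBlDl le_max lexx orbT.
    by rewrite ltr_pdivrMr// ltr_pMr// ltr1n.
  have srho : s < rho by apply: lt_trans rrho; rewrite rm.
  by split; [rewrite s0|apply: left0; [rewrite s0|left]].
Qed.

Definition cauchy_kernel a x z := (z - a) / (z - x).

Lemma cauchy_kernel_cdiff a x z : z != x -> cdiff (cauchy_kernel a x) z.
Proof. by move=> zx; apply: cdiff_div;
  [rewrite subr_eq0|exact: cdiff_subr|exact: cdiff_subr]. Qed.

Lemma far_neq a x z r : cabs (x - a) < r -> cabs (z - a) = r -> z != x.
Proof. by move=> xr zr; apply: contraTneq xr => <-; rewrite zr ltxx. Qed.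

Lemma cauchy_kernel_cont a x r : cabs (x - a) < r ->
  cont_circle (cauchy_kernel a x) a r.
Proof. by move=> xr z zr; apply/cdiff_ccont/cauchy_kernel_cdiff;
  exact: far_neq xr zr. Qed.

Lemma far_dist a x z r : cabs (z - a) = r -> r - cabs (x - a) <= cabs (z - x).
Proof. by move=> <-; have := cabsB_ge (z - a) (x - a); rewrite opprB addrA subrK. Qed.

(** The kernel is holomorphic outside the disc through x, so its mean does not
depend on the radius; the kernel tends to 1 at infinity. *)
Lemma circle_mean_kernel a x r : cabs (x - a) < r ->
  circle_mean (cauchy_kernel a x) a r = 1.
Proof.
move=> xr; have r0 : 0 < r := le_lt_trans (cabs_ge0 _) xr.
set m := cabs (x - a) in xr *; have m0 : 0 <= m := cabs_ge0 _.
apply/eqP; rewrite -subr_eq0 -cabs_eq0; apply/eqP/le_anti.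
rewrite cabs_ge0 andbT; apply/ler_addgt0Pr => e e0; rewrite add0r.
(* This radius makes m at most e / 2 * (r' - m). *)
pose r' := r + 2 * m / e.
have rr' : r <= r' by rewrite lerDl divr_ge0 ?(ltW e0)// mulr_ge0.
have r'0 : 0 < r' by exact: lt_le_trans rr'.
have -> : circle_mean (cauchy_kernel a x) a r = circle_mean (cauchy_kernel a x) a r'.
  apply: (@circle_mean_annulus _ _ a m (r' + 1)) => //; last by rewrite ltrDl.
  move=> z /andP[z1 _]; apply: cauchy_kernel_cdiff; apply: contraTneq z1 => ->.
  by rewrite ltxx.
have xr' : cabs (x - a) < r' by exact: lt_le_trans rr'.
have cc := path_cont_on_circle (ltW r'0) (cauchy_kernel_cont xr').
rewrite -[X in _ - X](period_mean_cst (1 : C)) /circle_mean -period_meanB//;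
  last exact: path_cont_cst.
have -> : e = 2 * (e / 2) by field.
apply: period_mean_bound => [|t tT]; first by apply: path_contD => //;
  exact: path_cont_cst.
set z := circle_pt a r' t; have zr' : cabs (z - a) = r' by rewrite circle_pt_dist// ltW.
have zx := far_neq xr' zr'.
have -> : cauchy_kernel a x z - 1 = (x - a) / (z - x) by rewrite /cauchy_kernel; field;
  rewrite subr_eq0.
rewrite cabsM cabsV ler_pdivrMr ?cabs_gt0 ?subr_eq0//.
have fd := far_dist x zr'.
rewrite -/m in fd *; apply: (@le_trans _ _ (e / 2 * (r' - m))); last first.
  by rewrite ler_wpM2l// ltW// divr_gt0.
have -> : e / 2 * (r' - m) = e / 2 * (r - m) + m by rewrite /r'; field; rewrite gt_eqF.
by rewrite lerDr mulr_ge0 ?subr_ge0 ?(ltW xr)// divr_ge0// ltW.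
Qed.

(** The function may fail to be differentiable at the centre: the expansion at
such a centre is what removes singularities. *)

Section Taylor.

Variables (f : C -> C) (a : C) (rho r : R).
Hypothesis rr : 0 < r < rho.
Hypothesis cf : forall z, disc_at a rho z -> ccont f z.
Hypothesis df : forall z, disc_at a rho z -> z != a -> cdiff f z.

Let r0 : 0 < r. Proof. by case/andP: rr. Qed.
Let circ_r t : cabs (circle_pt a r t - a) = r. Proof. by rewrite circle_pt_dist// ltW.
  Qed.
Let cfr : cont_circle f a r.
Proof. by move=> z zr; apply: cf; rewrite /disc_at zr; case/andP: rr. Qed.

(** The mean value property is applied to (f z - f x) / (z - x) * (z - a). This
function vanishes at the centre, and it extends continuously to x because f is
differentiable there. *)
Lemma cauchy_formula x : x != a -> cabs (x - a) < r ->
  f x = circle_mean (fun z => f z * cauchy_kernel a x z) a r.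
Proof.
move=> xa xr; have xrho : disc_at a rho x by apply: lt_trans xr _; case/andP: rr.
have [l /cdifftoP[phi [cphi phix phiE]]] := df xrho xa.
pose g z := phi z * (z - a).
have nz z : z != x -> z - x != 0 by rewrite subr_eq0.
have phiE' z : z != x -> (f z - f x) / (z - x) = phi z.
  by move=> /nz zx; rewrite phiE addrAC subrr add0r mulfK.
have gphi z : z != x -> cnear z (fun w => (f w - f x) / (w - x) * (w - a) = g w).
  by move=> zx; apply: cnear_imp (cnear_neq zx) => w wx; rewrite phiE'.
have : circle_mean g a r = g a.
  apply: (@circle_mean_center g a x rho) => [|z zd|z zd za zx].
  - by case/andP: rr => /ltW -> ->.
  - have [->|zx] := eqVneq z x.
      apply: ccontM => //; exact/cdiff_ccont/cdiff_subr.
    apply: ccont_near (gphi _ zx) _; apply: ccontM; last exact/cdiff_ccont/cdiff_subr.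
    apply: ccontM; first by apply: ccontD; [exact: cf|exact: ccont_cst].
    by apply: ccontV; [exact: nz|exact/cdiff_ccont/cdiff_subr].
  - apply: cdiff_near (gphi _ zx) _; apply: cdiffM; last exact: cdiff_subr.
    apply: cdiff_div; [exact: nz| |exact: cdiff_subr].
    by apply: cdiffB; [exact: df|exact: cdiff_cst].
rewrite {2}/g subrr mulr0.
have ck := cauchy_kernel_cont xr.
have -> : circle_mean g a r = circle_mean (fun z => f z * cauchy_kernel a x z) a r - f
  x * circle_mean (cauchy_kernel a x) a r.
  have cB : path_cont (fun t => cauchy_kernel a x (circle_pt a r t)) :=
    path_cont_on_circle (ltW r0) ck.
  have cA : path_cont (fun t =>
    f (circle_pt a r t) * cauchy_kernel a x (circle_pt a r t)).
    apply: (@path_cont_on_circle (fun z => f z * cauchy_kernel a x z) a r (ltW r0)) =>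
      z zr.
    by apply: ccontM; [exact: cfr|exact: ck].
  rewrite /circle_mean -(period_meanZ _ cB) -(period_meanB cA (path_contZ _ cB)).
  congr period_mean; apply/funext => t; set z := circle_pt a r t.
  have zx : z != x := far_neq xr (circ_r t).
  by rewrite /g -phiE'// /cauchy_kernel; field; exact: nz.
by rewrite circle_mean_kernel// mulr1 => /eqP; rewrite subr_eq0 => /eqP.
Qed.

Definition taylor_coef (j : nat) : C :=
  circle_mean (fun z => f z * ((z - a) ^+ j)^-1) a r.

Let cc_coef j : cont_circle (fun z => f z * ((z - a) ^+ j)^-1) a r.
Proof.
move=> z zr; have za : z - a != 0 by rewrite -cabs_gt0 zr.
apply: ccontM; first exact: cfr.
apply: (@ccontV _ (fun z => (z - a) ^+ j)); first exact: expf_neq0.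
by apply/cdiff_ccont/cdiffX/cdiff_subr.
Qed.

Lemma circle_mean_eq_center : circle_mean f a r = f a.
Proof.
apply: (@circle_mean_center f a a rho) => //.
  by case/andP: rr => /ltW -> ->.
by move=> z zd za _; exact: df.
Qed.

Lemma taylor_coef0 : taylor_coef 0 = f a.
Proof.
rewrite -circle_mean_eq_center /taylor_coef; congr circle_mean; apply/funext => z.
by rewrite expr0 invr1 mulr1.
Qed.

(** The kernel is a finite geometric series in (x - a) / (z - a), plus its own
product with the N-th power of this ratio. *)
Lemma taylor_bound M N x :
  (forall t, 0 <= t <= two_pi R -> cabs (f (circle_pt a r t)) <= M) ->
  cabs (x - a) < r ->
  cabs (f x - \sum_(j < N) taylor_coef j * (x - a) ^+ j) <=
   2 * M * (cabs (x - a) / r) ^+ N * (r / (r - cabs (x - a))).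
Proof.
move=> fM xr.
have M0 : 0 <= M by apply: le_trans (fM 0 _);
  rewrite ?cabs_ge0// lexx/= ltW// two_pi_gt0.
have [->|xa] := eqVneq x a.
  rewrite subrr cabs0 subr0 divff ?gt_eqF// mulr1 mul0r.
  case: N => [|N].
    rewrite big_ord0 subr0 expr0 mulr1 -circle_mean_eq_center.
    by apply: circle_mean_bound => //; exact: ltW.
  rewrite big_ord_recl expr0 mulr1 taylor_coef0 big1 ?addr0 ?subrr ?cabs0.
    by rewrite exprS mul0r mulr0.
  by move=> j _; rewrite lift0 exprS mul0r mulr0.
have ck := cauchy_kernel_cont xr.
pose rem z := f z * ((z - a) ^+ N)^-1 * cauchy_kernel a x z.
have crem : cont_circle rem a r.
  by move=> z zr; apply: ccontM; [exact: cc_coef|exact: ck].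
have -> : f x = \sum_(j < N) (x - a) ^+ j * taylor_coef j + (x - a) ^+ N * circle_mean
  rem a r.
  rewrite (cauchy_formula xa xr) /taylor_coef /circle_mean.
  pose F (j : nat) t := (x - a) ^+ j *
    (f (circle_pt a r t) * ((circle_pt a r t - a) ^+ j)^-1).
  have cG j : path_cont (fun t =>
    f (circle_pt a r t) * ((circle_pt a r t - a) ^+ j)^-1) :=
    path_cont_on_circle (ltW r0) (@cc_coef j).
  have cR : path_cont (fun t => rem (circle_pt a r t)) :=
    path_cont_on_circle (ltW r0) crem.
  have cF j : path_cont (F j) by exact: path_contZ.
  have -> : \sum_(j < N) (x - a) ^+ j * period_mean
    (fun t => f (circle_pt a r t) / (circle_pt a r t - a) ^+ j) =
      \sum_(j < N) period_mean (F j) by apply: eq_bigr => j _;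
        rewrite -(period_meanZ _ (cG j)).
  rewrite -(period_meanZ _ cR) -(period_mean_sum N cF) -period_meanD;
    [|exact: path_cont_sum|exact: path_contZ].
  congr period_mean; apply/funext => t; rewrite /F /rem; set z := circle_pt a r t.
  have za : z - a != 0 by rewrite -cabs_gt0 circ_r.
  have zx : z - x != 0 by rewrite subr_eq0; exact: far_neq xr (circ_r t).
  clearbody z; elim: N {rem crem cR} => [|N IH].
    by rewrite big_ord0 expr0 add0r mul1r expr0 invr1 mulr1.
  rewrite IH big_ord_recr/= -addrA; congr (_ + _).
  have zaN : (z - a) ^+ N != 0 by exact: expf_neq0.
  rewrite /cauchy_kernel !exprS; field.
  by rewrite zaN za zx.
rewrite addrAC; under eq_bigr do rewrite mulrC.
rewrite subrr add0r cabsM cabsX expr_div_n.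
have rm0 : 0 < r - cabs (x - a) by rewrite subr_gt0.
have K : cabs (circle_mean rem a r) <= 2 * (M * (r ^+ N)^-1 * (r / (r - cabs (x - a)))).
  apply: circle_mean_bound => //; first exact: ltW.
  move=> t tT; have zr := circ_r t; set z := circle_pt a r t in zr *.
  rewrite /rem /cauchy_kernel !cabsM !cabsV cabsX zr.
  have fd := far_dist x zr.
  have zx0 : 0 < cabs (z - x) by exact: lt_le_trans fd.
  rewrite ler_pM ?mulr_ge0 ?invr_ge0 ?exprn_ge0 ?cabs_ge0 ?(ltW r0)//.
    by rewrite ler_wpM2r ?invr_ge0 ?exprn_ge0 ?(ltW r0)//; exact: fM.
  by rewrite ler_wpM2l ?(ltW r0)// lef_pV2.
apply: le_trans (ler_wpM2l _ K) _; first by rewrite exprn_ge0 ?cabs_ge0.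
by rewrite le_eqVlt; apply/orP; left; apply/eqP; ring.
Qed.

End Taylor.

End Cauchy.

(** * Removable singularities, zeros and division *)

Section LocalTheory.

Variable R : realType.
Local Notation C := R[i].
Implicit Types (f g : C -> C) (a z w x : C) (e d r : R) (O : set C).

Lemma taylor_near f a : cnear a (fun w => w != a -> cdiff f w) -> ccont f a ->
  exists c : nat -> C, exists M : R, exists2 r : R, 0 < r & c 0%N = f a /\
   forall N x, cabs (x - a) < r / 2 ->
     cabs (f x - \sum_(j < N) c j * (x - a) ^+ j) <= M * (cabs (x - a) / r) ^+ N.
Proof.
move=> [rho rho0 df] cfa; pose r := rho / 2.
have r0 : 0 < r by rewrite divr_gt0.
have rr : 0 < r < rho by rewrite r0/= ltr_pdivrMr// ltr_pMr// ltr1n.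
have cf z : disc_at a rho z -> ccont f z.
  by have [->//|za zd] := eqVneq z a; apply/cdiff_ccont/df.
have [M M0 fM] : exists2 M, 0 <= M & forall t, 0 <= t <= two_pi R ->
  cabs (f (circle_pt a r t)) <= M.
  apply: circle_bounded; first exact: ltW.
  by move=> z zr; apply: cf; rewrite /disc_at zr; case/andP: rr.
exists (taylor_coef f a r), (2 * M * 2); exists r => //; split;
  first exact: taylor_coef0 rr cf df.
move=> N x xr; have x0 := cabs_ge0 (x - a).
have xr' : cabs (x - a) < r by lra.
apply: le_trans (taylor_bound rr cf df _ fM xr') _.
have -> : 2 * M * 2 * (cabs (x - a) / r) ^+ N = 2 * M * (cabs (x - a) / r) ^+ N * 2
  by ring.
have q0 : 0 <= (cabs (x - a) / r) ^+ N by rewrite exprn_ge0// divr_ge0// ltW.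
apply: ler_wpM2l; first exact: mulr_ge0 (mulr_ge0 (ler0n _ _) M0) q0.
by rewrite ler_pdivrMr ?subr_gt0//; lra.
Qed.

(** The Taylor bound with N = 2 is the differentiability of f at a. *)
Lemma removable f a : cnear a (fun w => w != a -> cdiff f w) -> ccont f a -> cdiff f a.
Proof.
move=> df cf; have [c [M [r r0 [c0 H]]]] := taylor_near df cf.
exists (c 1%N) => e e0.
have M0 : 0 <= M.
  have := H 0%N a; rewrite subrr cabs0 divr_gt0// => /(_ isT); rewrite expr0 mulr1.
  by apply: le_trans; exact: cabs_ge0.
have h0 : 0 < e * r ^+ 2 / (M + 1) by rewrite divr_gt0 ?mulr_gt0 ?exprn_gt0 ?ltr_wpDl.
exists (Num.min (r / 2) (e * r ^+ 2 / (M + 1))); first by rewrite lt_min divr_gt0.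
move=> w; rewrite lt_min => /andP[w1 w2]; have := H 2%N w w1.
rewrite !big_ord_recl big_ord0 /= expr0 expr1 addr0 mulr1 c0 [c _ * _]mulrC opprD addrA.
move=> /le_trans; apply.
have M10 : 0 < M + 1 by rewrite ltr_wpDl.
move: w2; rewrite ltr_pdivlMr// => w2.
have r20 : 0 < r ^+ 2 by rewrite exprn_gt0.
rewrite expr_div_n mulrA ler_pdivrMr// [cabs _ ^+ 2]expr2 mulrA [in leRHS]mulrAC.
rewrite ler_wpM2r ?cabs_ge0//; apply: le_trans (ltW w2).
by rewrite mulrC ler_wpM2l ?cabs_ge0// lerDl.
Qed.

(** The function (w - a) * f w is continuous at a, hence differentiable at a,
and its difference quotient at a is a continuous extension of f. *)
Lemma riemann f a M : cnear a (fun w => w != a -> cdiff f w /\ cabs (f w) <= M) ->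
  exists l, cdiff (fun w => if w == a then l else f w) a.
Proof.
move=> H; have M0 : 0 <= M.
  have [d d0 {}H] := H.
  have [] := H (a + (d / 2)%:C%C).
  - by rewrite addrAC subrr add0r cabs_real gtr0_norm ?divr_gt0// ltr_pdivrMr//
    ltr_pMr// ltr1n.
  - by rewrite -subr_eq0 addrAC subrr add0r (inj_eq (@complexI R) _ 0) gt_eqF//
    divr_gt0.
  - by move=> _; apply: le_trans; exact: cabs_ge0.
have : cdiff (fun w => (w - a) * f w) a.
  apply: removable.
    apply: cnear_imp H => w H wa; have [dw _] := H wa.
    by apply: cdiffM => //; exact: cdiff_subr.
  move=> e e0; have h0 : 0 < e / (M + 1) by rewrite divr_gt0// ltr_wpDl.
  apply: (cnear_imp2 _ H (cnear_ball a h0)) => w {}H wd.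
  rewrite subrr mul0r subr0; have [->|/H[_ fM]] := eqVneq w a;
    first by rewrite subrr mul0r cabs0.
  have M10 : 0 < M + 1 by rewrite ltr_wpDl.
  rewrite cabsM; move: wd; rewrite ltr_pdivlMr//; apply: le_lt_trans.
  by rewrite ler_wpM2l ?cabs_ge0// (le_trans fM)// lerDl.
move=> [l /cdifftoP[phi [cphi _ phiE]]].
have E w : (if w == a then phi a else f w) = phi w.
  have [->//|wa] := eqVneq w a.
  have wa0 : w - a != 0 by rewrite subr_eq0.
  by have := phiE w; rewrite subrr mul0r add0r mulrC => /(mulIf wa0).
exists (phi a); apply: removable.
  apply: cnear_imp (cnear_and H (cnear_cnear H)) => w [{}H _] wa; have [dw _] := H wa.
  by apply: cdiff_near dw; apply: cnear_imp (cnear_neq wa) => v va; rewrite (negPf va).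
by apply: ccont_near cphi; apply: cnear_all => w; rewrite E.
Qed.

Lemma riemann_seq O f (S : seq C) : (forall z, O z -> cnear z O) ->
  (forall z, O z -> z \notin S -> cdiff f z) ->
  (forall s, O s -> s \in S -> exists M,
    cnear s (fun w => w \notin S -> cabs (f w) <= M)) ->
  exists2 g, (forall z, O z -> cdiff g z) & forall z, z \notin S -> g z = f z.
Proof.
move=> opO; elim: S f => [|s S IH] f df bf.
  by exists f => // z Oz; exact: df.
have [Os|nOs] := pselect (O s); last first.
  have [||g dg gE] := IH f.
  - move=> z Oz zS; apply: df => //; rewrite inE negb_or zS andbT.
    by apply: contra_not_neq nOs => <-.
  - move=> y Oy yS; have [|M H] := bf y Oy; first by rewrite inE yS orbT.
    exists M; apply: (cnear_imp2 _ H (opO _ Oy)) => w {}H Ow wS; apply: H.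
    by rewrite inE negb_or wS andbT; apply: contra_not_neq nOs => <-.
  - by exists g => // z; rewrite inE negb_or => /andP[_ /gE].
have NS a : cnear a (fun w => w != a -> w \notin S).
  have : cnear a (fun w => w \notin [seq y <- S | y != a]).
    by apply: cnear_notin; rewrite mem_filter eqxx.
  by apply: cnear_imp => w; rewrite mem_filter negb_and negbK => /orP[->|].
have [M fM] := bf s Os (mem_head _ _).
have [l dl] : exists l, cdiff (fun w => if w == s then l else f w) s.
  apply: (@riemann _ _ M).
  apply: (cnear_imp2 _ fM (cnear_and (opO _ Os) (NS s))) => w {}fM [Ow wS] ws.
  have wS' : w \notin s :: S by rewrite inE negb_or ws wS.
  by split; [exact: df|exact: fM].
pose h w := if w == s then l else f w.
have hf w : w != s -> cnear w (fun v => f v = h v).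
  by move=> ws; apply: cnear_imp (cnear_neq ws) => v vs; rewrite /h (negPf vs).
have [||g dg gE] := IH h.
- move=> z Oz zS; have [->//|zs] := eqVneq z s.
  by apply: cdiff_near (hf _ zs) _; apply: df; rewrite // inE negb_or zs.
- move=> y Oy yS; have [->|ys] := eqVneq y s.
    exists (cabs (h s) + 1); apply: cnear_imp (ccont_bnd (cdiff_ccont dl)) => w; exact.
  have [|M' H] := bf y Oy; first by rewrite inE yS orbT.
  exists M'; apply: (cnear_imp2 _ H (cnear_and (hf _ ys) (cnear_neq ys))) =>
    w {}H [<- ws] wS.
  by apply: H; rewrite inE negb_or ws.
- exists g => // z; rewrite inE negb_or => /andP[zs /gE ->].
  by rewrite /h (negPf zs).
Qed.

(** Either all Taylor coefficients vanish, and then so does f by the remainder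
bound, or the first nonzero one dominates the rest of the expansion near a. *)
Lemma isolated_zeros f a : cnear a (cdiff f) ->
  cnear a (fun w => f w = 0) \/ cnear a (fun w => w != a -> f w != 0).
Proof.
move=> df; have [] := @taylor_near f a.
- by apply: cnear_imp df.
- by apply: cdiff_ccont; exact: cnear_self df.
move=> c [M [r r0 [_ H]]]; have r20 : 0 < r / 2 by rewrite divr_gt0.
have M0 : 0 <= M.
  have := H 0%N a; rewrite subrr cabs0 => /(_ r20); rewrite expr0 mulr1.
  by apply: le_trans; exact: cabs_ge0.
have [[j cj]|nc] := pselect (exists j, c j != 0); last first.
  have c0 j : c j = 0 by apply/eqP/negPn/negP => cj; apply: nc; exists j.
  left; exists (r / 2) => // w wr; apply/eqP; rewrite -cabs_eq0; apply/eqP/le_anti.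
  rewrite cabs_ge0 andbT; apply/ler_addgt0Pr => e e0; rewrite add0r.
  pose N := (Num.truncn (M / e)).+1.
  have := H N w wr; rewrite big1 => [|i _]; last by rewrite c0 mul0r.
  rewrite subr0 => /le_trans; apply.
  have q2 : cabs (w - a) / r <= 2^-1.
    by rewrite ler_pdivrMr// mulrC ltW.
  apply: (@le_trans _ _ (M * 2^-1 ^+ N)).
    by rewrite ler_wpM2l// lerXn2r ?nnegrE ?divr_ge0 ?cabs_ge0// ltW.
  rewrite exprVn ler_pdivrMr ?exprn_gt0// mulrC -ler_pdivrMr//.
  apply: le_trans (ltW (truncnS_gt _)) _.
  by rewrite -natrX ler_nat ltnW// ltn_expl.
right.
have ex : exists j, c j != 0 by exists j.
have := @ex_minnP (fun j => c j != 0) ex; case: ex_minnP => N cN minN _ {ex}.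
have cN0 : 0 < cabs (c N) by rewrite cabs_gt0.
have h0 : 0 < cabs (c N) * r ^+ N.+1 / (M + 1)
  by rewrite divr_gt0 ?mulr_gt0 ?exprn_gt0 ?ltr_wpDl.
exists (Num.min (r / 2) (cabs (c N) * r ^+ N.+1 / (M + 1)));
  first by rewrite lt_min r20.
move=> w; rewrite lt_min => /andP[w1 w2] wa; apply/negP => /eqP fw0.
have := H N.+1 w w1; rewrite fw0 sub0r cabsN big_ord_recr/= big1 ?add0r => [|i _];
  last first.
  have [->|ci] := eqVneq (c i) 0; first by rewrite mul0r.
  by have := minN _ ci; rewrite leqNgt ltn_ord.
have rN0 : 0 < r ^+ N.+1 by rewrite exprn_gt0.
have wa0 : 0 < cabs (w - a) by rewrite cabs_gt0 subr_eq0.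
rewrite cabsM cabsX expr_div_n mulrA ler_pdivlMr// [cabs _ ^+ N.+1]exprS mulrA mulrAC.
rewrite ler_pM2r ?exprn_gt0// leNgt => /negP[].
have M10 : 0 < M + 1 by rewrite ltr_wpDl.
by move: w2; rewrite ltr_pdivlMr//; apply: le_lt_trans;
  rewrite mulrC ler_wpM2l ?(ltW wa0)// lerDl.
Qed.

(** The set of points near which f vanishes is open; by [isolated_zeros] its
complement in O is open too. *)
Lemma identity_thm O f a : open O -> connected O -> (forall z, O z -> cdiff f z) ->
  O a -> cnear a (fun w => f w = 0) -> forall z, O z -> f z = 0.
Proof.
move=> /open_cnear opO cO df Oa fa.
pose A := O `&` [set z | cnear z (fun w => f w = 0)].
have AO : A = O.
  apply: cO.
  - by exists a.
  - exists [set z | cnear z (fun w => f w = 0)] => //.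
    by apply/open_cnear => z; exact: cnear_cnear.
  - exists (~` [set z | cnear z (fun w => w != z -> f w != 0)]).
      apply: open_closedC; apply/open_cnear => z [d d0 H].
      exists d => // w wz; have [->|wz0] := eqVneq w z; first by exists d.
      apply: cnear_imp2 (cnear_neq wz0) (cnear_disc wz) => v vz vd _; exact: H.
    rewrite /A; apply/seteqP; split => z [Oz H]; split => //.
      move=> K; have [d d0 {H K}K] := cnear_and H K.
      have [] := K (z + (d / 2)%:C%C).
        by rewrite addrAC subrr add0r cabs_real gtr0_norm ?divr_gt0// ltr_pdivrMr//
          ltr_pMr// ltr1n.
      move=> -> /(_ _)/negP; apply => //.
      by rewrite -subr_eq0 addrAC subrr add0r (inj_eq (@complexI R) _ 0) gt_eqF//
        divr_gt0.
    have dz : cnear z (cdiff f) by apply: cnear_imp (opO _ Oz).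
    by have [//|/H] := isolated_zeros dz.
by move=> z; rewrite -AO => -[_ /cnear_self].
Qed.

Lemma cauchy_est f a (r rho M : R) x : 0 < r < rho ->
  (forall z, disc_at a rho z -> cdiff f z) ->
  (forall t, 0 <= t <= two_pi R -> cabs (f (circle_pt a r t)) <= M) ->
    cabs (x - a) < r ->
  cabs (f x) <= 2 * M * (r / (r - cabs (x - a))).
Proof.
move=> rr df fM xr; have := @taylor_bound R f a rho r rr _ _ M 0%N x _ xr.
rewrite big_ord0 subr0 expr0 mulr1; apply=> //.
- by move=> z /df/cdiff_ccont.
- by move=> z /df.
Qed.

Lemma disc_connected : connected (@unit_disc R).
Proof.
have -> : @unit_disc R = \bigcup_(z in @unit_disc R)
  ((fun t : R => t%:C%C * z) @` `[0, 1]).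
  apply/seteqP; split => [z zd|_ [z zd [t /= t01 <-]]].
    by exists z => //; exists 1; rewrite /= ?in_itv/= ?lexx ?ler01// mul1r.
  rewrite /unit_disc /open_disc /= cabsM cabs_real; move: t01;
    rewrite in_itv/= => /andP[t0 t1].
  rewrite ger0_norm//; apply: le_lt_trans zd; rewrite -[X in _ <= X]mul1r.
  by rewrite ler_wpM2r ?cabs_ge0.
apply: bigcup_connected.
  by exists 0 => z zd; exists 0; rewrite /= ?mul0r// in_itv/= lexx ler01.
move=> z zd; apply: connected_continuous_connected; first exact: segment_connected.
apply: continuous_subspaceT => t A /nbhs_cnear[d d0 H].
apply/nbhs_ballP; exists (d / (cabs z + 1)) => /=.
  by rewrite divr_gt0// ltr_wpDl ?cabs_ge0.
have z10 : 0 < cabs z + 1 by rewrite ltr_wpDl ?cabs_ge0.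
move=> s; rewrite /ball/= distrC ltr_pdivlMr// => sd; apply: H.
rewrite -mulrBl -rmorphB/= cabsM cabs_real; apply: le_lt_trans sd.
by rewrite ler_wpM2l// lerDl.
Qed.

(** Divide f - f y by x - y for each y of the list in turn; every quotient is
again holomorphic, by [removable]. Repetitions in the list give contact of
higher order. *)
Lemma hermite_div O f (s : seq C) : (forall z, O z -> cnear z O) ->
  (forall z, O z -> cdiff f z) -> (forall y, y \in s -> O y) ->
  exists P : {poly C}, exists2 g, (forall z, O z -> cdiff g z) &
   forall x, f x = P.[x] + (\prod_(y <- s) (x - y)) * g x.
Proof.
move=> opO; elim: s f => [|y s IH] f df sO.
  by exists 0; exists f => // x; rewrite big_nil horner0 add0r mul1r.
have Oy : O y by apply: sO; rewrite mem_head.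
have [l /cdifftoP[phi [cphi _ phiE]]] := df _ Oy.
have dphi_neq z : O z -> z != y -> cdiff phi z.
  move=> Oz zy; apply: (@cdiff_near _ (fun w => (f w - f y) / (w - y))).
    apply: cnear_imp (cnear_neq zy) => w wy.
    by rewrite phiE addrAC subrr add0r mulfK// subr_eq0.
  apply: cdiff_div; rewrite ?subr_eq0//; last exact: cdiff_subr.
  by apply: cdiffB; [exact: df|exact: cdiff_cst].
have dphi z : O z -> cdiff phi z.
  move=> Oz; have [->|] := eqVneq z y; last exact: dphi_neq.
  by apply: removable => //; apply: cnear_imp (opO _ Oy) => w Ow; exact: dphi_neq.
have [|P [g dg gE]] := IH phi dphi; first by move=> x xs; apply: sO;
  rewrite inE xs orbT.
exists ((f y)%:P + ('X - y%:P) * P); exists g => // x.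
rewrite phiE gE big_cons !hornerE; ring.
Qed.

End LocalTheory.

(** * Holomorphic multifunctions *)

Section Multifunctions.

Variable R : realType.
Local Notation C := R[i].
Implicit Types (f : C -> C) (a z w x y : C) (e d r : R) (O U : set C) (s : seq C)
  (g : C -> seq C).

Definition root_prod s y := \prod_(x <- s) (y - x).

Lemma root_prod_poly s : exists2 p : {poly C}, size p = (size s).+1 & forall y,
  root_prod s y = p.[y].
Proof.
exists (\prod_(x <- s) ('X - x%:P)); first by rewrite size_prod_XsubC.
by move=> y; rewrite horner_prod /root_prod; apply: eq_bigr => x _; rewrite hornerXsubC.
Qed.

(** A monic polynomial is determined by its values at n + 1 fixed points,
linearly; this turns statements about each y separately into statements uniform
on bounded sets of y. *)
Lemma root_prod_lagrange n : exists L : 'I_n.+1 -> {poly C}, forall s, size s = n ->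
  forall y, root_prod s y = \sum_(k < n.+1) root_prod s k%:R * (L k).[y].
Proof.
pose X (k : nat) : C := k%:R.
have injX : injective X by move=> i j /eqP; rewrite eqr_nat => /eqP.
exists (fun k => tnth (lagrange n.+1 X) k) => s ss y.
have [p sp pE] := root_prod_poly s.
have /(lagrange_gen (ltn0Sn n) injX) E : (size p <= n.+1)%N by rewrite sp ss.
rewrite pE [in LHS]E horner_sum; apply: eq_bigr => k _.
by rewrite !hornerE -pE.
Qed.

Lemma root_prod_eq0 s y : (root_prod s y == 0) = (y \in s).
Proof.
rewrite /root_prod prodf_seq_eq0; apply/hasP/idP => [[x xs /=]|ys].
  by rewrite subr_eq0 => /eqP ->.
by exists y; rewrite //= subrr.
Qed.

Lemma poly_bounded (p : {poly C}) (B : R) : exists K : R, forall x, cabs x <= B ->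
  cabs p.[x] <= K.
Proof.
exists (\sum_(i < size p) cabs p`_i * B ^+ i) => x xB.
rewrite horner_coef; apply: le_trans (cabs_sum _ _) _.
apply: ler_sum => i _; rewrite cabsM cabsX ler_wpM2l ?cabs_ge0//.
by rewrite lerXn2r// nnegrE ?cabs_ge0// (le_trans (cabs_ge0 x)).
Qed.

Lemma cnear_bound_seq s (h : C -> C) :
  (forall y, y \in s -> exists M, cnear y (fun x => cabs (h x) <= M)) ->
  exists M, exists2 e : R, 0 < e & forall x y, y \in s -> cabs (x - y) < e ->
    cabs (h x) <= M.
Proof.
elim: s => [|y s IH] H; first by exists 0; exists 1.
have [|M [e e0 {}IH]] := IH; first by move=> x xs; apply: H; rewrite inE xs orbT.
have [|M' [e' e'0 H']] := H y; first by rewrite mem_head.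
exists (Num.max M M'); exists (Num.min e e'); first by rewrite lt_min e0.
move=> x z; rewrite inE lt_min le_max => /predU1P[->|zs] /andP[x1 x2].
  by rewrite H' ?orbT.
by rewrite (IH _ z).
Qed.

(** An n-tuple of complex numbers, up to order, that depends holomorphically on
z. The enumeration g z may jump: only the monic polynomial with these roots is
constrained, through its values. *)
Record multi_holo U n g : Prop := MultiHolo {
  multi_holo_size : forall z, U z -> size (g z) = n;
  multi_holo_diff : forall z y, U z -> cdiff (fun w => root_prod (g w) y) z;
  multi_holo_bnd : forall z, U z -> exists M,
    cnear z (fun w => U w -> forall x, x \in g w -> cabs x <= M) }.

Section Polynomials.

Variables (U : set C) (n : nat) (g : C -> seq C).
Hypothesis opU : forall z, U z -> cnear z U.
Hypothesis hg : multi_holo U n g.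

Lemma multi_holo_eval f z : U z -> cdiff f z ->
  cdiff (fun w => root_prod (g w) (f w)) z.
Proof.
move=> Uz df; have [L LE] := root_prod_lagrange n.
apply: (@cdiff_near _ (fun w => \sum_(k <- index_enum 'I_n.+1) root_prod (g w) k%:R *
  (L k).[f w])).
  by apply: cnear_imp (opU Uz) => w Uw; rewrite LE// (multi_holo_size hg).
apply: cdiff_sum => k; apply: cdiffM; first exact: multi_holo_diff hg _ _ Uz.
by apply: (@cdiff_comp _ f (horner (L k))) => //; exact: cdiff_horner.
Qed.

(** The roots of a polynomial are in general not Lipschitz in its coefficients,
but the value at them of the polynomial of the base point is. *)
Lemma multi_holo_lip z : U z -> exists2 M : R, 0 <= M & cnear z (fun w => U w ->
  forall x, x \in g w -> cabs (root_prod (g z) x) <= M * cabs (w - z)).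
Proof.
move=> Uz; have [L LE] := root_prod_lagrange n.
have [B HB] := multi_holo_bnd hg Uz.
have /choice[K KP] k : exists K : R, forall x, cabs x <= B -> cabs (L k).[x] <= K
  by exact: poly_bounded.
have /choice[M MP] (k : 'I_n.+1) : exists M : R,
  0 <= M /\ cnear z (fun w => cabs (root_prod (g w) k%:R - root_prod (g z) k%:R)
  <= M * cabs (w - z)).
  by have [M M0 H] := cdiff_lip (multi_holo_diff hg k%:R Uz); exists M.
exists (\sum_(k < n.+1) M k * `|K k|).
  by apply: sumr_ge0 => k _; rewrite mulr_ge0//; case: (MP k).
have : cnear z (fun w => forall k, k \in enum 'I_n.+1 ->
  cabs (root_prod (g w) k%:R - root_prod (g z) k%:R) <= M k * cabs (w - z)).
  by apply: cnear_seq => k _; case: (MP k).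
apply: cnear_imp2 HB => w wB wM Uw x xw.
have -> : root_prod (g z) x
  = - (\sum_(k < n.+1) (root_prod (g w) k%:R - root_prod (g z) k%:R) * (L k).[x]).
  under eq_bigr do rewrite mulrBl.
  rewrite sumrB -!LE ?(multi_holo_size hg)//.
  have /eqP -> : root_prod (g w) x == 0 by rewrite root_prod_eq0.
  by rewrite sub0r opprK.
rewrite cabsN mulr_suml; apply: le_trans (cabs_sum _ _) _; apply: ler_sum => k _.
rewrite cabsM mulrAC; apply: ler_pM; rewrite ?cabs_ge0//.
  by apply: wM; rewrite mem_enum.
by apply: le_trans (KP k x _) (ler_norm _); exact: wB.
Qed.

Lemma multi_holo_close z e : U z -> 0 < e -> cnear z (fun w => U w ->
  forall x, x \in g w -> exists2 y, y \in g z & cabs (x - y) < e).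
Proof.
move=> Uz e0; have [M M0 H] := multi_holo_lip Uz.
have h0 : 0 < e ^+ n / (M + 1) by rewrite divr_gt0 ?exprn_gt0 ?ltr_wpDl.
apply: (cnear_imp2 _ H (cnear_ball z h0)) => w {}H wz Uw x xw.
apply: contrapT => K; have := H Uw x xw; apply/negP; rewrite -ltNge.
have M10 : 0 < M + 1 by rewrite ltr_wpDl.
apply: (@lt_le_trans _ _ (e ^+ n)).
  by move: wz; rewrite ltr_pdivlMr//; apply: le_lt_trans;
    rewrite mulrC ler_wpM2l ?cabs_ge0// lerDl.
rewrite /root_prod cabs_prod -(multi_holo_size hg Uz).
have {}K y : y \in g z -> e <= cabs (x - y) by move=> yz; rewrite leNgt;
  apply/negP => xy; apply: K; exists y.
elim: (g z) K => [|y s IH] K; first by rewrite big_nil.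
rewrite big_cons /= exprS ler_pM ?exprn_ge0 ?(ltW e0)//; first by rewrite K// mem_head.
by apply: IH => v vs; apply: K; rewrite inE vs orbT.
Qed.

(** For fixed y, factor y - P x into linear factors in x: the product over the
tuple becomes a product of values of [root_prod] at the roots of y - P. *)
Lemma multi_holo_poly (P : {poly C}) : multi_holo U n (fun z => map (horner P) (g z)).
Proof.
split=> [z Uz|z y Uz|z Uz].
- by rewrite size_map (multi_holo_size hg).
(* c ^+ n is the product of the leading coefficients, and (-1)^n turns x - v
   into v - x in all n factors. *)
- have [r rE] := closed_field_poly_normal (y%:P - P).
  set c := lead_coef _ in rE.
  apply: (@cdiff_near _ (fun w =>
    c ^+ n * \prod_(v <- r) ((-1) ^+ n * root_prod (g w) v))).
    apply: cnear_imp (opU Uz) => w Uw;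
      rewrite /root_prod big_map -(multi_holo_size hg Uw).
    elim: (g w) => [|x s IH].
      by rewrite big_nil mul1r big1// => v _; rewrite big_nil mul1r.
    rewrite big_cons -IH /=.
    have -> : y - P.[x] = c * \prod_(v <- r) (x - v).
      have := congr1 (horner^~ x) rE; rewrite !hornerE => ->; congr (_ * _).
      by rewrite horner_prod; apply: eq_bigr => v _; rewrite hornerXsubC.
    rewrite exprS -!mulrA; congr (_ * _); rewrite mulrCA; congr (_ * _).
    rewrite -big_split /=; apply: eq_bigr => v _; rewrite big_cons exprS; ring.
  apply: cdiffM; first exact: cdiff_cst.
  apply: cdiff_prod => v; apply: cdiffM; first exact: cdiff_cst.
  exact: multi_holo_diff hg _ _ Uz.
- have [B HB] := multi_holo_bnd hg Uz; have [K HK] := poly_bounded P B.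
  exists K; apply: cnear_imp HB => w wB Uw x /mapP[v vw ->].
  by apply: HK; exact: wB.
Qed.

End Polynomials.

Lemma cdiff_quad (D : C -> C) z K : D z = 0 ->
  cnear z (fun w => cabs (D w) <= K * cabs (w - z) ^+ 2) -> cdiff D z.
Proof.
move=> Dz H; exists 0 => e e0.
have h0 : 0 < e / (`|K| + 1) by rewrite divr_gt0// ltr_wpDl.
apply: (cnear_imp2 _ H (cnear_ball z h0)) => w wK wz.
rewrite mulr0 subr0 Dz subr0; apply: le_trans wK _.
rewrite expr2 mulrA ler_wpM2r ?cabs_ge0//.
have K10 : 0 < `|K| + 1 by rewrite ltr_wpDl.
move: wz; rewrite ltr_pdivlMr// => /ltW; apply: le_trans.
by rewrite mulrC ler_wpM2l ?cabs_ge0// (le_trans (ler_norm K))// lerDl.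
Qed.

Lemma prod_dist (I : eqType) (s : seq I) (u v : I -> C) (B eta : R) : 1 <= B ->
  0 <= eta ->
  (forall i, i \in s -> [/\ cabs (u i) <= B, cabs (v i) <= B & cabs (u i - v i)
    <= eta]) ->
  cabs (\prod_(i <- s) u i - \prod_(i <- s) v i) <= (size s)%:R * B ^+ size s * eta.
Proof.
move=> B1 eta0; have B0 : 0 <= B by apply: le_trans B1.
elim: s => [|i s IH] H; first by rewrite !big_nil subrr cabs0 !mul0r.
have [ui vi uvi] := H i (mem_head _ _).
have {}H j : j \in s -> [/\ cabs (u j) <= B, cabs (v j) <= B & cabs (u j - v j) <= eta].
  by move=> js; apply: H; rewrite inE js orbT.
have Hv : cabs (\prod_(j <- s) v j) <= B ^+ size s.
  elim: s H {IH} => [|j s IH] H; first by rewrite big_nil cabs1.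
  have [_ vj _] := H j (mem_head _ _).
  rewrite big_cons cabsM /= exprS ler_pM ?cabs_ge0//.
  by apply: IH => l ls; apply: H; rewrite inE ls orbT.
rewrite !big_cons.
have -> : u i * \prod_(j <- s) u j - v i * \prod_(j <- s) v j =
  u i * (\prod_(j <- s) u j - \prod_(j <- s) v j) + (u i - v i) * \prod_(j <- s) v j
    by ring.
apply: le_trans (cabsD _ _) _; rewrite !cabsM /=.
have -> : (size s).+1%:R * B ^+ (size s).+1 * eta
  = B * ((size s)%:R * B ^+ size s * eta) + B ^+ (size s).+1 * eta.
  by rewrite -natr1 exprS; ring.
apply: lerD; first by rewrite ler_pM ?cabs_ge0//; exact: IH.
rewrite mulrC exprS; apply: le_trans (ler_pM (cabs_ge0 _) (cabs_ge0 _) Hv uvi) _.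
by rewrite ler_wpM2r// ler_peMl// exprn_ge0.
Qed.

Section Composition.

Variables (U O : set C) (n : nat) (g : C -> seq C) (f : C -> C).
Hypothesis opU : forall z, U z -> cnear z U.
Hypothesis opO : forall z, O z -> cnear z O.
Hypothesis hg : multi_holo U n g.
Hypothesis df : forall z, O z -> cdiff f z.
Hypothesis gO : forall z x, U z -> x \in g z -> O x.

Lemma multi_holo_comp_bnd z : U z -> exists M,
  cnear z (fun w => U w -> forall x, x \in g w -> cabs (f x) <= M).
Proof.
move=> Uz; have [|M [e e0 H]] := @cnear_bound_seq (g z) f.
  move=> y yz; exists (cabs (f y) + 1); apply/ccont_bnd/cdiff_ccont/df.
  exact: gO yz.
exists M; apply: cnear_imp (multi_holo_close hg Uz e0) => w wH Uw x /(wH Uw)[y yz xy].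
exact: H yz xy.
Qed.

(** Divide f by the square of p, the monic polynomial with roots g z. Near z
the entries x of g w satisfy p x = O(w - z), so replacing f by the remainder P
changes [root_prod] by O((w - z)^2) only, and P is handled by
[multi_holo_poly]. *)
Lemma multi_holo_comp : multi_holo U n (fun z => map f (g z)).
Proof.
split=> [z Uz|z y Uz|z Uz]; first by rewrite size_map (multi_holo_size hg).
- have [|P [h dh fE]] := @hermite_div _ O f (g z ++ g z) opO df.
    by move=> v; rewrite mem_cat orbb; exact: gO.
  have {}fE x : f x = P.[x] + root_prod (g z) x ^+ 2 * h x
    by rewrite fE big_cat/= -expr2.
  have [|K [e e0 hK]] := @cnear_bound_seq (g z) h.
    move=> v vz; exists (cabs (h v) + 1); apply/ccont_bnd/cdiff_ccont/dh.
    exact: gO vz.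
  have [M M0 HM] := multi_holo_lip hg Uz.
  have [B1 HB1] := multi_holo_comp_bnd Uz.
  have hP := multi_holo_poly opU hg P.
  have [B2 HB2] := multi_holo_bnd hP Uz.
  pose B := 1 + cabs y + `|B1| + `|B2|.
  have B1' : 1 <= B by rewrite /B -!addrA lerDl !addr_ge0 ?cabs_ge0.
  pose D w := root_prod (map f (g w)) y - root_prod (map (horner P) (g w)) y.
  apply: (@cdiff_ext _ (fun w => root_prod (map (horner P) (g w)) y + D w)).
    by move=> w; rewrite /D addrC subrK.
  apply: cdiffD; first exact: multi_holo_diff hP _ _ Uz.
  apply: (@cdiff_quad _ _ (n%:R * B ^+ n * (M ^+ 2 * `|K|))).
    rewrite /D /root_prod !big_map; apply/eqP; rewrite subr_eq0; apply/eqP.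
    rewrite !big_seq; apply: eq_bigr => x xz; rewrite fE.
    have /eqP -> : root_prod (g z) x == 0 by rewrite root_prod_eq0.
    by rewrite expr0n mul0r addr0.
  have := cnear_and (opU Uz)
    (cnear_and (multi_holo_close hg Uz e0) (cnear_and HM (cnear_and HB1 HB2))).
  apply: cnear_imp => w [Uw [Hc [{}HM [{}HB1 {}HB2]]]].
  rewrite /D /root_prod !big_map.
  have eta0 : 0 <= M ^+ 2 * `|K| * cabs (w - z) ^+ 2
    by rewrite !mulr_ge0 ?exprn_ge0 ?cabs_ge0.
  have := @prod_dist _ (g w) (fun x => y - f x) (fun x => y - P.[x]) B _ B1' eta0 _.
  rewrite (multi_holo_size hg Uw) => H; apply: le_trans (H _) _; last by rewrite !mulrA.
  move=> x xw {H}.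
  have b1 := HB1 Uw x xw; have b2 := HB2 Uw P.[x] (map_f _ xw).
  have [v vz xv] := Hc Uw x xw; have hx := hK x v vz xv.
  have b3 := HM Uw x xw.
  split.
  + apply: le_trans (cabsD _ _) _; rewrite cabsN /B.
    have := cabs_ge0 y; have := ler_norm B1; have : 0 <= `|B2| by []; move: b1; lra.
  + apply: le_trans (cabsD _ _) _; rewrite cabsN /B.
    have := cabs_ge0 y; have := ler_norm B2; have : 0 <= `|B1| by []; move: b2; lra.
  + rewrite fE; have -> : y - (P.[x] + root_prod (g z) x ^+ 2 * h x) - (y - P.[x])
    = - (root_prod (g z) x ^+ 2 * h x) by ring.
    rewrite cabsN cabsM cabsX [leRHS]mulrAC -exprMn ler_pM ?exprn_ge0 ?cabs_ge0//.
      by rewrite lerXn2r ?nnegrE ?cabs_ge0// mulr_ge0 ?cabs_ge0.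
    by rewrite (le_trans hx) ?ler_norm.
- have [M H] := multi_holo_comp_bnd Uz; exists M;
  apply: cnear_imp H => w H Uw x /mapP[v vw ->].
  exact: H.
Qed.

End Composition.

Lemma multi_holo_sub U V n g : (forall z, V z -> U z) -> multi_holo U n g ->
  multi_holo V n g.
Proof.
move=> VU hg; split => [z /VU Uz|z y /VU Uz|z /VU Uz].
- by rewrite (multi_holo_size hg Uz).
- exact: (multi_holo_diff hg y Uz).
- have [M H] := multi_holo_bnd hg Uz; exists M; apply: cnear_imp H => w H /VU; exact: H.
Qed.

Lemma multi_holo_scale U n g (c : C -> C) : (forall z, U z -> cnear z U) ->
  multi_holo U n g ->
  (forall z, U z -> cdiff c z) -> (forall z, U z -> c z != 0) ->
  multi_holo U n (fun z => map (fun x => x / c z) (g z)).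
Proof.
move=> opU hg dc c0; split=> [z Uz|z y Uz|z Uz];
  first by rewrite size_map (multi_holo_size hg).
- apply: (@cdiff_near _ (fun w => (c w)^-1 ^+ n * root_prod (g w) (c w * y))).
    apply: cnear_imp (opU _ Uz) => w Uw;
      rewrite /root_prod big_map -(multi_holo_size hg Uw).
    elim: (g w) => [|x s IH]; first by rewrite !big_nil mulr1.
    rewrite !big_cons -IH /= exprS; have cw := c0 _ Uw.
    have -> : y - x / c w = (c w)^-1 * (c w * y - x) by field.
    ring.
  apply: cdiffM; first by apply/cdiffX/cdiffV; [exact: c0|exact: dc].
  apply: (@multi_holo_eval U n g) => //; apply: cdiffM; [exact: dc|exact: cdiff_cst].
- have [M H] := multi_holo_bnd hg Uz.
  have ccV : ccont (fun w => (c w)^-1) z by apply: ccontV;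
    [exact: c0|apply/cdiff_ccont/dc].
  exists (`|M| * (cabs (c z)^-1 + 1)).
  apply: (cnear_imp2 _ H (ccont_bnd ccV)) => w {}H cw Uw x /mapP[v vw ->].
  rewrite cabsM ler_pM ?cabs_ge0// (le_trans _ (ler_norm _))//; exact: H.
Qed.

End Multifunctions.

(** * Schwarz lemma and rigidity for multifunctions *)

Section Schwarz.

Variable R : realType.
Local Notation C := R[i].
Implicit Types (f : C -> C) (a z w x y : C) (e d r : R) (O U : set C) (S s : seq C)
  (g : C -> seq C).

Definition setD_seq O S : set C := [set z | O z /\ z \notin S].

Lemma setD_seq_open O S : (forall z, O z -> cnear z O) -> forall z, setD_seq O S z ->
  cnear z (setD_seq O S).
Proof. by move=> opO z [/opO Oz /cnear_notin zS]; exact: cnear_and. Qed.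

Lemma root_prod_bound s y B : 0 <= B -> (forall x, x \in s -> cabs x <= B) ->
  cabs (root_prod s y) <= (cabs y + B) ^+ size s.
Proof.
move=> B0 sB; rewrite /root_prod cabs_prod; elim: s sB => [|x s IH] sB;
  first by rewrite big_nil.
rewrite big_cons /= exprS ler_pM ?cabs_ge0 ?prodr_ge0//.
- by move=> z _; exact: cabs_ge0.
- by rewrite (le_trans (cabsD _ _))// cabsN lerD2l sB// mem_head.
- by apply: IH => z zs; apply: sB; rewrite inE zs orbT.
Qed.

Lemma expr_small (tau K : R) : 0 <= tau < 1 -> exists m, K * tau ^+ m < 1.
Proof.
move=> /andP[t0 t1]; have [K0|K0] := leP K 0.
  by exists 0%N; rewrite expr0 mulr1 (le_lt_trans K0).
have [m _ H] : \forall n \near \oo, `|0 - tau ^+ n| < K^-1.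
  have /cvg_expr : `|tau| < 1 by rewrite ger0_norm.
  by move=> /cvgrPdist_lt; apply; rewrite invr_gt0.
exists m; have := H m (leqnn _); rewrite sub0r normrN ger0_norm ?exprn_ge0//.
by rewrite -[X in _ < X -> _]div1r ltr_pdivlMr// mulrC.
Qed.

(** On the circle, E, the product of the 1 - x^m, is within n 2^n tau^m of 1.
By Cauchy's estimate it is close to 1 at z1 as well for large m, whereas it
would vanish at z1 if 1 were an entry of g z1. *)
Lemma multi_max O S n g a (rho r tau : R) z1 : (forall z, O z -> cnear z O) ->
  0 < r < rho -> (forall z, disc_at a rho z -> O z) ->
  multi_holo (setD_seq O S) n g ->
  (forall s : C, O s -> s \in S -> exists M,
    cnear s (fun z => setD_seq O S z -> forall x, x \in g z -> cabs x <= M)) ->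
  0 <= tau < 1 ->
  (forall t, 0 <= t <= two_pi R -> circle_pt a r t \notin S /\ forall x,
    x \in g (circle_pt a r t) -> cabs x <= tau) ->
  setD_seq O S z1 -> cabs (z1 - a) < r -> 1 \notin g z1.
Proof.
move=> opO rr dO hg bg tau01 gtau Uz1 z1r; apply/negP => g1.
have opU := setD_seq_open (S := S) opO.
have t0 : 0 <= tau by case/andP: tau01.
pose K : R := 2 * (n%:R * 2 ^+ n) * (r / (r - cabs (z1 - a))).
have [m] := expr_small K tau01; apply/negP; rewrite -leNgt.
pose E z := root_prod (map (horner 'X^m) (g z)) 1.
have hE := multi_holo_poly opU hg 'X^m.
have [|| F dF FE] := @riemann_seq R O E S opO.
- by move=> z Oz zS; apply: (multi_holo_diff hE 1).
- move=> s Os sS; have [M HM] := bg s Os sS.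
  exists ((1 + `|M| ^+ m) ^+ n); apply: (cnear_imp2 _ HM (opO _ Os)) => z {}HM Oz zS.
  have Uz : setD_seq O S z by [].
  rewrite /E -(multi_holo_size hg Uz) -(size_map (horner 'X^m)) -cabs1;
    apply: root_prod_bound.
    by rewrite exprn_ge0.
  move=> x /mapP[v vz ->]; rewrite hornerXn cabsX lerXn2r ?nnegrE ?cabs_ge0//.
  by rewrite (le_trans _ (ler_norm _))// HM.
have : cabs (F z1 - 1) <= 2 * (n%:R * 2 ^+ n * tau ^+ m) * (r / (r - cabs (z1 - a))).
  apply: (@cauchy_est _ (fun z => F z - 1) a r rho) => //.
    by move=> z /dO Oz; apply: cdiffB; [exact: dF|exact: cdiff_cst].
  move=> t /gtau[zS xtau]; rewrite FE// /E /root_prod big_map;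
    set z := circle_pt a r t in zS xtau *.
  have Oz : O z.
    by apply: dO; rewrite /disc_at circle_pt_dist; case/andP: rr => // r0 _; exact: ltW.
  have tm0 : 0 <= tau ^+ m by rewrite exprn_ge0.
  have B2 : (1 : R) <= 2 by rewrite ler1n.
  have := @prod_dist R _ (g z) (fun x => 1 - 'X^m.[x]) (fun=> 1) 2 (tau ^+ m) B2 tm0.
  rewrite (multi_holo_size hg (conj Oz zS)) [X in _ - X]big1//; apply.
  move=> x xz; have xm : cabs ('X^m.[x] : C) <= tau ^+ m.
    by rewrite hornerXn cabsX lerXn2r ?nnegrE ?cabs_ge0// xtau.
  have tm1 : tau ^+ m <= 1 by rewrite exprn_ile1//; case/andP: tau01 => _ /ltW.
  split.
  - by rewrite (le_trans (cabsD _ _))// cabsN cabs1 -[2]/(1 + 1) lerD2l (le_trans xm).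
  - by rewrite cabs1.
  - by rewrite addrAC subrr add0r cabsN.
have -> : F z1 = 0.
  rewrite FE; last by case: Uz1.
  by apply/eqP; rewrite root_prod_eq0; apply/mapP; exists 1; rewrite // hornerXn expr1n.
rewrite sub0r cabsN cabs1 => /le_trans; apply; rewrite /K.
by rewrite le_eqVlt; apply/orP; left; apply/eqP; ring.
Qed.

Lemma disc_aut_den a z : cabs a < 1 -> cabs z < 1 -> 1 - conjc a * z != 0.
Proof.
move=> a1 z1; rewrite subr_eq0; apply/eqP => /(congr1 (@cabs R)).
rewrite cabs1 cabsM cabs_conj => E.
have : cabs a * cabs z < 1 by rewrite mulr_ilt1 ?cabs_ge0.
by rewrite -E ltxx.
Qed.

(** The identity behind both the invariance of the disc and the behaviour at
the boundary. *)
Lemma disc_aut_id a z : cabs (1 - conjc a * z) ^+ 2 - cabs (z - a) ^+ 2 =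
  (1 - cabs a ^+ 2) * (1 - cabs z ^+ 2).
Proof. by rewrite !sqr_cabs; case: a z => [a b] [x y]; simpc => /=; ring. Qed.

Lemma disc_aut_lt1 a z : cabs a < 1 -> cabs z < 1 -> cabs (disc_aut a z) < 1.
Proof.
move=> a1 z1; have d0 := disc_aut_den a1 z1.
rewrite /disc_aut cabsM cabsV ltr_pdivrMr ?cabs_gt0// mul1r.
rewrite -(@ltr_pXn2r _ 2%N) ?nnegrE ?cabs_ge0// -subr_gt0 disc_aut_id.
by rewrite mulr_gt0// subr_gt0 expr_lt1// ?cabs_ge0.
Qed.

Lemma disc_aut_cdiff a z : cabs a < 1 -> cabs z < 1 -> cdiff (disc_aut a) z.
Proof.
move=> a1 z1; apply: cdiff_div; first exact: disc_aut_den.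
  exact: cdiff_subr.
apply: cdiffB; first exact: cdiff_cst.
by apply: cdiffM; [exact: cdiff_cst|exact: cdiff_id].
Qed.

Lemma disc_aut_eq0 a z : cabs a < 1 -> cabs z < 1 -> (disc_aut a z == 0) = (z == a).
Proof.
by move=> a1 z1; rewrite /disc_aut mulf_eq0 invr_eq0 (negPf (disc_aut_den a1 z1)) orbF
  subr_eq0.
Qed.

Lemma disc_aut_ge a z : cabs a < 1 -> cabs z < 1 ->
  cabs (z - a) / 2 <= cabs (disc_aut a z).
Proof.
move=> a1 z1; have d0 := disc_aut_den a1 z1.
rewrite /disc_aut cabsM cabsV ler_wpM2l ?cabs_ge0// lef_pV2 ?posrE ?cabs_gt0//.
rewrite (le_trans (cabsD _ _))// cabsN cabs1 cabsM cabs_conj -[2]/(1 + 1) lerD2l.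
by rewrite mulr_ile1 ?cabs_ge0// ltW.
Qed.

Lemma disc_aut_bd a z e : cabs a < 1 -> 0 < e -> 1 - e * (1 - cabs a) ^+ 2
  < cabs z ^+ 2 -> cabs z < 1 ->
  1 - e < cabs (disc_aut a z) ^+ 2.
Proof.
move=> a1 e0 ze z1; have d0 := disc_aut_den a1 z1.
have dd : (1 - cabs a) ^+ 2 <= cabs (1 - conjc a * z) ^+ 2.
  rewrite lerXn2r ?nnegrE ?subr_ge0 ?cabs_ge0// ?(ltW a1)//.
  have := cabsB_ge 1 (conjc a * z); rewrite cabs1 cabsM cabs_conj; apply: le_trans.
  by rewrite lerD2l lerN2 ler_piMr ?cabs_ge0// ltW.
rewrite /disc_aut cabsM cabsV expr_div_n ltr_pdivlMr ?exprn_gt0 ?cabs_gt0//.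
have := disc_aut_id a z; have := sqr_ge0 (cabs a).
have : cabs z ^+ 2 < 1 by rewrite expr_lt1// cabs_ge0.
have : cabs a ^+ 2 < 1 by rewrite expr_lt1// cabs_ge0.
move: dd ze; move: (cabs (1 - _) ^+ 2) (cabs (z - a) ^+ 2) (cabs z ^+ 2) (cabs a ^+ 2)
  ((1 - cabs a) ^+ 2) => A B Z A2 D.
by move=> dd ze a21 z21 a20 E; nra.
Qed.

Local Notation D := (@unit_disc R).

Lemma unit_disc_open z : D z -> cnear z D.
Proof. by move=> zD; have := @cnear_disc R 0 z 1; rewrite subr0 => /(_ zD);
  apply: cnear_imp => w; rewrite subr0. Qed.

Lemma avoid_circle S r0 : r0 < 1 -> exists2 r1 : R, r0 < r1 < 1 & forall r,
  r1 <= r < 1 -> forall z, cabs z = r -> z \notin S.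
Proof.
move=> r01; elim: S => [|s S [r1 /andP[h1 h2] H]].
  by exists ((r0 + 1) / 2) => //; rewrite midf_lt//= ?midf_lt.
have [s1|s1] := leP 1 (cabs s).
  exists r1; rewrite ?h1// => r rr z zr; rewrite inE negb_or (H _ rr)// andbT.
  by apply: contraTneq s1 => <-; rewrite zr -ltNge; case/andP: rr.
exists (Num.max r1 ((cabs s + 1) / 2)).
  by rewrite lt_max h1/= gt_max h2 midf_lt.
move=> r /andP[]; rewrite ge_max => /andP[rr1 rs] r_1 z zr.
rewrite inE negb_or (H r)// ?rr1// andbT.
apply: contraTneq rs => <-;
  rewrite -ltNge zr ltr_pdivlMr// mulrC mulr_natl mulr2n ltrD2l//.
Qed.

(** If an entry x1 at z1 violates the bound, put y = x1 / psi z1, with psi the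
automorphism vanishing at z0, so that y has modulus greater than 1. The
multifunction with entries x / (psi z * y) takes the value 1 at z1, while its
entries have modulus less than 1 on circles close to the unit circle, where psi
has modulus close to 1; this contradicts [multi_max]. *)
Theorem multi_schwarz S n g z0 K : D z0 -> multi_holo (setD_seq D S) n g ->
  (forall z x, setD_seq D S z -> x \in g z -> cabs x <= 1) ->
  cnear z0 (fun z => setD_seq D S z -> forall x, x \in g z ->
    cabs x <= K * cabs (z - z0)) ->
  forall z x, setD_seq D S z -> x \in g z -> cabs x <= cabs (disc_aut z0 z).
Proof.
move=> Dz0 hg g1 gK z1 x1 Uz1 x1g; have [z10|z10] := eqVneq z1 z0.
  have H := cnear_self gK; rewrite z10 in Uz1 x1g *.
  by have := H Uz1 _ x1g; rewrite subrr cabs0 mulr0 => /le_trans; apply;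
    exact: cabs_ge0.
rewrite leNgt; apply/negP => x1big.
have Dz1 : cabs z1 < 1 by case: Uz1.
have p1 : disc_aut z0 z1 != 0 by rewrite disc_aut_eq0.
pose y := x1 / disc_aut z0 z1.
have y1 : 1 < cabs y.
  by rewrite /y cabsM cabsV ltr_pdivlMr ?cabs_gt0// mul1r.
have y0 : y != 0 by rewrite -cabs_gt0 (lt_trans _ y1).
pose c z := disc_aut z0 z * y.
have opD := unit_disc_open.
have U'U z : setD_seq D (z0 :: S) z -> setD_seq D S z.
  by move=> [Dz]; rewrite inE negb_or => /andP[_].
have hv : multi_holo (setD_seq D (z0 :: S)) n (fun z => map (fun x => x / c z) (g z)).
  apply: multi_holo_scale; first exact: setD_seq_open.
  - exact: multi_holo_sub hg.
  - move=> z [Dz _]; apply: cdiffM; [exact: disc_aut_cdiff|exact: cdiff_cst].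
  - move=> z [Dz]; rewrite inE negb_or => /andP[zz0 _].
    by rewrite mulf_neq0// disc_aut_eq0.
have cz z : D z -> cabs (z - z0) / 2 <= cabs (c z).
  move=> Dz; rewrite /c cabsM; apply: le_trans (disc_aut_ge Dz0 Dz) _.
  by rewrite ler_peMr ?cabs_ge0// ltW.
(* 1 - e lies strictly between |y|^-2 and 1; the circle of radius r is taken so
   close to the unit circle that |psi|^2 exceeds 1 - e on it. *)
pose e := (1 - (cabs y)^-1 ^+ 2) / 2.
have iy1 : (cabs y)^-1 ^+ 2 < 1 by rewrite expr_lt1 ?invr_ge0 ?cabs_ge0// invf_lt1//
  (lt_trans _ y1).
have e0 : 0 < e by rewrite divr_gt0// subr_gt0.
have e1 : 0 < 1 - e.
  have : 0 <= (cabs y)^-1 ^+ 2 by rewrite exprn_ge0// invr_ge0 cabs_ge0.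
  by rewrite /e; lra.
have dd0 : 0 < (1 - cabs z0) ^+ 2 by rewrite exprn_gt0// subr_gt0.
pose b := Num.max (cabs z1) (1 - e * (1 - cabs z0) ^+ 2 / 2).
have b1 : b < 1.
  by rewrite gt_max Dz1/= ltrBlDr ltrDl divr_gt0// mulr_gt0.
have [r /andP[br r1] rS] := avoid_circle (z0 :: S) b1.
have z1r : cabs z1 < r by apply: le_lt_trans br; rewrite le_max lexx.
have r0 : 0 < r by apply: le_lt_trans z1r; exact: cabs_ge0.
have bdr z : cabs z = r -> 1 - e < cabs (disc_aut z0 z) ^+ 2.
  move=> zr; apply: disc_aut_bd => //; last by rewrite zr.
  have h : 1 - e * (1 - cabs z0) ^+ 2 / 2 < r by apply: le_lt_trans br;
    rewrite le_max lexx orbT.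
  have h0 : 0 < e * (1 - cabs z0) ^+ 2 by rewrite mulr_gt0.
  by rewrite zr; move: (e * _) h h0 => u h h0; nra.
pose tau2 := (cabs y)^-1 ^+ 2 / (1 - e).
have tau20 : 0 <= tau2 by rewrite divr_ge0 ?exprn_ge0 ?invr_ge0 ?cabs_ge0// ltW.
have tau21 : tau2 < 1.
  by rewrite /tau2 ltr_pdivrMr// mul1r /e; move: iy1; lra.
suff : 1 \notin map (fun x => x / c z1) (g z1).
  case/negP; apply/mapP; exists x1 => //.
  have -> : c z1 = x1 by rewrite /c /y mulrC divfK.
  by rewrite divff// -cabs_gt0; apply: le_lt_trans x1big; exact: cabs_ge0.
apply: (@multi_max D (z0 :: S) n (fun z => map (fun x => x / c z) (g z)) 0 1 r
  (Num.sqrt tau2) z1) => //.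
- by rewrite r0 r1.
- by move=> z; rewrite /disc_at subr0.
- move=> s Ds _; have [->|sz0] := eqVneq s z0.
    exists (2 * `|K|); apply: (cnear_imp2 _ gK (opD _ Dz0)) =>
      z {}gK Dz U'z x /mapP[v vz ->].
    have zz0 : 0 < cabs (z - z0).
      by case: U'z => _; rewrite inE negb_or cabs_gt0 subr_eq0 => /andP[].
    have cz0 : 0 < cabs (c z) by apply: lt_le_trans (cz _ Dz); rewrite divr_gt0.
    rewrite cabsM cabsV ler_pdivrMr//; apply: le_trans (gK (U'U _ U'z) _ vz) _.
    apply: (@le_trans _ _ (`|K| * cabs (z - z0)));
      first by rewrite ler_wpM2r ?cabs_ge0// ler_norm.
    have -> : `|K| * cabs (z - z0) = 2 * `|K| * (cabs (z - z0) / 2) by field.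
    by rewrite ler_wpM2l ?cz// mulr_ge0.
  have h0 : 0 < cabs (s - z0) / 2 by rewrite divr_gt0// cabs_gt0 subr_eq0.
  exists (cabs (s - z0) / 4)^-1.
  apply: (cnear_imp2 _ (cnear_ball s h0) (opD _ Ds)) => z zs Dz U'z x /mapP[v vz ->].
  have zz0 : cabs (s - z0) / 2 <= cabs (z - z0).
    by have := cabs_tri s z z0; rewrite [cabs (s - z)]cabs_distC; move: zs; lra.
  have cz' : cabs (s - z0) / 4 <= cabs (c z) by apply: le_trans (cz _ Dz); move: zz0;
    lra.
  have h4 : 0 < cabs (s - z0) / 4 by move: h0; lra.
  rewrite cabsM cabsV -[X in _ <= X]mul1r ler_pM ?cabs_ge0 ?invr_ge0 ?cabs_ge0//.
    by apply: g1 vz; exact: U'U.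
  by rewrite lef_pV2 ?posrE// (lt_le_trans h4).
- by rewrite sqrtr_ge0/= -sqrtr1 ltr_sqrt.
- move=> t _; set z := circle_pt 0 r t.
  have zr : cabs z = r by rewrite -[z]subr0 circle_pt_dist// ltW.
  have zS : z \notin z0 :: S by apply: (rS r); rewrite ?lexx.
  split => // x /mapP[v vz ->].
  have Dz : D z by rewrite /unit_disc /open_disc /= zr.
  have v1 : cabs v <= 1 by apply: g1 vz; exact: U'U.
  rewrite -(@ler_pXn2r _ 2%N) ?nnegrE ?cabs_ge0 ?sqrtr_ge0// sqr_sqrtr//.
  rewrite cabsM cabsV exprMn exprVn /c cabsM exprMn invfM.
  have bz := bdr _ zr.
  have v2 : cabs v ^+ 2 <= 1 by rewrite exprn_ile1 ?cabs_ge0.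
  rewrite /tau2 exprVn [leRHS]mulrC -[leRHS]mul1r ler_pM ?mulr_ge0 ?invr_ge0 ?exprn_ge0
    ?cabs_ge0//.
  rewrite ler_wpM2r ?invr_ge0 ?exprn_ge0 ?cabs_ge0// lef_pV2 ?posrE ?ltW//.
  exact: lt_trans bz.
- split; first by case: Uz1.
  by rewrite inE negb_or z10; case: Uz1.
- by rewrite subr0.
Qed.

(** The function q, the product of the c - x, is holomorphic and vanishes at
z1. If it does not vanish identically, then some small circle around z1 carries
no zero of q. The polynomial (1 + conj c X) / 2 is equal to 1 at c and has
modulus less than 1 elsewhere on the closed disc, so the multifunction it
induces contradicts [multi_max]. *)
Theorem multi_rigid S n g z1 c : multi_holo (setD_seq D S) n g ->
  (forall z x, setD_seq D S z -> x \in g z -> cabs x <= 1) -> cabs c = 1 ->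
  setD_seq D S z1 -> c \in g z1 -> forall z, setD_seq D S z -> c \in g z.
Proof.
move=> hg g1 c1 Uz1 cz1 z Uz.
have opD := unit_disc_open; have opU := setD_seq_open (S := S) opD.
have qb w : setD_seq D S w -> cabs (root_prod (g w) c) <= 2 ^+ n.
  move=> Uw; rewrite -(multi_holo_size hg Uw); have -> : 2 = cabs c + 1 :> R
    by rewrite c1.
  by apply: root_prod_bound => // x xw; exact: g1 xw.
have [|| q dq qE] := @riemann_seq R D (fun w => root_prod (g w) c) S opD.
- by move=> w Dw wS; apply: (multi_holo_diff hg c).
- by move=> s Ds sS; exists (2 ^+ n); apply: cnear_imp (opD _ Ds) => w Dw wS; exact: qb.
have q1 : q z1 = 0 by rewrite qE; [apply/eqP; rewrite root_prod_eq0|case: Uz1].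
have Dz1 : D z1 by case: Uz1.
have : cnear z1 (cdiff q) by apply: cnear_imp (opD _ Dz1).
move=> /isolated_zeros[q0|qn0].
  rewrite -root_prod_eq0 -qE; last by case: Uz.
  apply/eqP; apply: (@identity_thm _ D q z1) => //; last by case: Uz.
    by apply/open_cnear; exact: unit_disc_open.
  exact: disc_connected.
have [d d0 Hd] := cnear_and qn0 (opU _ Uz1).
pose r := d / 2; have r0 : 0 < r by rewrite divr_gt0.
have rd : r < d by rewrite ltr_pdivrMr// ltr_pMr// ltr1n.
have cr w : cabs (w - z1) = r -> q w != 0 /\ setD_seq D S w.
  move=> wr; have [|qw Uw] := Hd w; first by rewrite wr.
  by split=> //; apply: qw; rewrite -subr_eq0 -cabs_gt0 wr.
have [M0 M00 HM0] : exists2 M : R, 0 <= M & forall t, 0 <= t <= two_pi R ->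
  cabs (q (circle_pt z1 r t))^-1 <= M.
  apply: (@circle_bounded _ (fun w => (q w)^-1) z1 r); first exact: ltW.
  move=> w /cr[qw [Dw _]]; apply: ccontV => //; exact/cdiff_ccont/dq.
(* On the circle |q| is at least 1 / (M0 + 1), and each factor c - x of q has
   modulus at most 2, so every factor has modulus at least eta. *)
pose eta := ((M0 + 1) * 2 ^+ n)^-1.
have eta0 : 0 < eta by rewrite invr_gt0 mulr_gt0 ?exprn_gt0// ltr_wpDl.
have far t x : 0 <= t <= two_pi R -> x \in g (circle_pt z1 r t) ->
  cabs x <= 1 /\ eta <= cabs (c - x).
  move=> /HM0/=; set w := circle_pt z1 r t => wM xw.
  have [qw0 Uw] : q w != 0 /\ setD_seq D S w by apply: cr; rewrite circle_pt_dist// ltW.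
  split; first exact: g1 xw.
  have : cabs (root_prod (g w) c) <= cabs (c - x) * 2 ^+ n.
    rewrite /root_prod (big_rem x)//= cabsM ler_wpM2l ?cabs_ge0//.
    apply: (@le_trans _ _ (2 ^+ size (rem x (g w)))).
      have -> : 2 = cabs c + 1 :> R by rewrite c1.
      by apply: root_prod_bound => // v /mem_rem vw; exact: g1 vw.
    by rewrite size_rem// (multi_holo_size hg Uw) ler_weXn2l ?ler1n// leq_pred.
  rewrite -qE; last by case: Uw.
  have : (M0 + 1)^-1 <= cabs (q w).
    rewrite -[cabs (q w)]invrK lef_pV2 ?posrE ?invr_gt0 ?cabs_gt0 ?ltr_wpDl//.
    by rewrite -cabsV (le_trans wM)// lerDl.
  move=> h1 h2; have := le_trans h1 h2; rewrite /eta invfM -ler_pdivrMr ?exprn_gt0//.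
pose P : {poly C} := (2^-1)%:P * (1 + (conjc c)%:P * 'X).
have cc : conjc c * c = 1 by rewrite mulrC mul_conjc c1 expr1n.
suff : 1 \notin map (horner P) (g z1).
  case/negP; apply/mapP; exists c => //; rewrite !hornerE cc.
  by field.
pose tau2 := 1 - eta ^+ 2 / 4.
have eta1 : eta <= 1.
  rewrite /eta invf_le1 ?mulr_gt0 ?exprn_gt0 ?ltr_wpDl// -[leLHS]mul1r ler_pM ?ler01//.
    by rewrite lerDr.
  by rewrite -natrX ler1n expn_gt0.
have tau20 : 0 <= tau2.
  rewrite /tau2; have : eta ^+ 2 <= 1 by rewrite exprn_ile1// ltW.
  by lra.
have tau21 : tau2 < 1 by rewrite /tau2 ltrBlDr ltrDl divr_gt0// exprn_gt0.
have hsub : forall w, setD_seq (fun w => cabs (w - z1) < d) [::] w -> setD_seq D S w.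
  by move=> w [/Hd[]].
apply: (@multi_max (fun w => cabs (w - z1) < d) [::] n (fun z => map (horner P) (g z))
  z1 d r (Num.sqrt tau2) z1) => //.
- by move=> w; exact: cnear_disc.
- by rewrite r0.
- apply: multi_holo_poly; last exact: multi_holo_sub hg.
  by apply: setD_seq_open => w; exact: cnear_disc.
- by rewrite sqrtr_ge0/= -sqrtr1 ltr_sqrt.
- move=> t tT; split => // x /mapP[v vz ->].
  have [v1 ve] := far t v tT vz.
  rewrite -(@ler_pXn2r _ 2%N) ?nnegrE ?cabs_ge0 ?sqrtr_ge0// sqr_sqrtr//.
  have -> : P.[v] = (2^-1)%:C%C * (1 + conjc c * v).
    by rewrite !hornerE; congr (_ * _); rewrite fmorphV rmorphMn rmorph1.
  rewrite cabsM exprMn cabs_real ger0_norm ?invr_ge0//.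
  have E1 : cabs (c - v) = cabs (1 - conjc c * v).
    by rewrite -cc -mulrBr cabsM cabs_conj c1 mul1r.
  (* Parallelogram identity for 1 and conj c * v. *)
  have E2 : cabs (1 + conjc c * v) ^+ 2 = 2 + 2 * cabs v ^+ 2 - cabs (c - v) ^+ 2.
    rewrite E1; have -> : cabs v = cabs (conjc c * v)
      by rewrite cabsM cabs_conj c1 mul1r.
    by rewrite !sqr_cabs; case: (conjc c * v) => a b; simpc => /=; ring.
  rewrite E2 /tau2 exprVn.
  have : eta ^+ 2 <= cabs (c - v) ^+ 2 by rewrite lerXn2r ?nnegrE ?cabs_ge0// ltW.
  have : cabs v ^+ 2 <= 1 by rewrite exprn_ile1 ?cabs_ge0.
  have -> : (2 ^+ 2 : R)^-1 = 4^-1 by congr (_^-1); ring.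
  by lra.
- by split => //; rewrite subrr cabs0.
- by rewrite subrr cabs0.
Qed.

End Schwarz.

(** * Eigenvalues of holomorphic matrix functions *)

Section MatrixEigenvalues.

Variables (R : realType) (n : nat).
Local Notation C := R[i].
Implicit Types (f : C -> C) (a z w x y : C) (A B : 'M[C]_n.+1) (P : {poly C}).

Lemma mx_entry_lt A (e : C) i j : `|A| < e -> `|A i j| < e.
Proof.
move=> Ae; have : ball (0 : 'M[C]_n.+1) e A
  by rewrite mx_norm_ball /ball_/= sub0r normrN.
by move=> -[_ /(_ i j)]; rewrite mxE /ball/= sub0r normrN.
Qed.

Lemma derivable_entry (F : C -> 'M[C]_n.+1) z i j : derivable F z 1 ->
  cdiff (fun w => F w i j) z.
Proof.
have -> : derivable F z 1 = @derivable C C^o 'M[C]_n.+1 F z 1 by [].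
move=> /derivable_epsP[l H]; exists (l i j) => e e0.
have e20 : 0 < ((e / 2)%:C%C : C) by rewrite ltcR divr_gt0.
have [_ /gt0_cplx[d d0 ->] {}H] := H _ e20; exists d => // w wd.
have [->|wz] := eqVneq w z; first by rewrite !subrr mul0r subrr cabs0 mulr0.
have := H w; rewrite cabsE ltcR => /(_ wd) K.
have wz0 : 0 < cabs (w - z) by rewrite cabs_gt0 subr_eq0.
have : `|F w - F z - (w - z) *: l| < ((e * cabs (w - z))%:C%C : C).
  apply: le_lt_trans K _; rewrite -rmorphM/= ltcR ltr_pM2r//.
  by rewrite ltr_pdivrMr// ltr_pMr// ltr1n.
by move=> /(mx_entry_lt i j); rewrite !mxE cabsE ltcR => /ltW.
Qed.

Definition eigenvalues A : seq C := sval (closed_field_poly_normal (char_poly A)).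

Lemma eigenvaluesE A : char_poly A = \prod_(x <- eigenvalues A) ('X - x%:P).
Proof.
rewrite /eigenvalues; case: closed_field_poly_normal => r /= E.
by rewrite E (monicP (char_poly_monic A)) scale1r.
Qed.

Lemma size_eigenvalues A : size (eigenvalues A) = n.+1.
Proof. by have := size_char_poly A; rewrite eigenvaluesE size_prod_XsubC => -[]. Qed.

Lemma mem_eigenvalues A x : (x \in eigenvalues A) = eigenvalue A x.
Proof. by rewrite eigenvalue_root_char eigenvaluesE root_prod_XsubC. Qed.

Lemma root_prod_eigenvalues A y : root_prod (eigenvalues A) y = (char_poly A).[y].
Proof. by rewrite eigenvaluesE horner_prod; apply: eq_bigr => x _;
  rewrite hornerXsubC. Qed.

Lemma char_poly_hornerE A y : (char_poly A).[y] =
  \sum_(s : {perm 'I_n.+1}) (-1) ^+ s * \prod_i (y *+ (i == s i) - A i (s i)).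
Proof.
rewrite /char_poly /determinant horner_sum; apply: eq_bigr => s _.
rewrite hornerM -polyC1 -polyCN -polyC_exp hornerC horner_prod; congr (_ * _).
apply: eq_bigr => i _; rewrite /char_poly_mx !mxE hornerD hornerN hornerC.
by rewrite hornerMn hornerX.
Qed.

Lemma cdiff_char (F : C -> 'M[C]_n.+1) z y : (forall i j, cdiff (fun w => F w i j) z) ->
  cdiff (fun w => root_prod (eigenvalues (F w)) y) z.
Proof.
move=> dF; apply: (@cdiff_ext _ (fun w => \sum_(s <- index_enum {perm 'I_n.+1})
   (-1) ^+ s * \prod_(i <- index_enum 'I_n.+1) (y *+ (i == s i) - F w i (s i)))).
  by move=> w; rewrite root_prod_eigenvalues char_poly_hornerE.
apply: cdiff_sum => s; apply: cdiffM; first exact: cdiff_cst.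
apply: cdiff_prod => i; apply: cdiffB; [exact: cdiff_cst|exact: dF].
Qed.

(** Compare the sums of the moduli of the coordinates on both sides of v A = x
v. *)
Lemma eigen_bound A x : eigenvalue A x ->
  cabs x <= \sum_(i <- index_enum 'I_n.+1) \sum_(j <- index_enum 'I_n.+1) cabs (A i j).
Proof.
move=> /eigenvalueP[v vA v0].
pose N := \sum_(j <- index_enum 'I_n.+1) cabs (v 0 j).
have N0 : 0 < N.
  rewrite lt_def sumr_ge0 ?andbT => [|j _]; last exact: cabs_ge0.
  apply: contraNneq v0 => /eqP; rewrite psumr_eq0 => [|j _]; last exact: cabs_ge0.
  move=> /allP H; apply/eqP/rowP => j; rewrite mxE.
  by have := H j (mem_index_enum j); rewrite cabs_eq0 => /eqP.
rewrite -(ler_pM2r N0) {1}/N mulr_sumr.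
have step (j : 'I_n.+1) : cabs x * cabs (v 0 j) <= \sum_(i <- index_enum 'I_n.+1) cabs
  (v 0 i) * cabs (A i j).
  have /rowP/(_ j) := vA; rewrite !mxE => E.
  rewrite -cabsM -E; apply: le_trans (cabs_sum _ _) _.
  by apply: ler_sum => i _; rewrite cabsM.
apply: le_trans (ler_sum _ (fun j _ => step j)) _.
rewrite exchange_big mulr_suml; apply: ler_sum => i _.
rewrite -mulr_sumr mulrC ler_wpM2l//; first by apply: sumr_ge0 => j _; exact: cabs_ge0.
by rewrite /N (bigD1_seq i) ?mem_index_enum ?index_enum_uniq//= lerDl sumr_ge0// =>
  j _; exact: cabs_ge0.
Qed.

Lemma horner_mx_eigen A P x (v : 'rV_n.+1) : v *m A = x *: v ->
  v *m horner_mx A P = P.[x] *: v.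
Proof.
move=> vA; elim/poly_ind: P => [|P c IH].
  by rewrite rmorph0 mulmx0 horner0 scale0r.
rewrite rmorphD rmorphM /= horner_mx_X horner_mx_C mulmxDr mulmxA IH -scalemxAl vA.
by rewrite !hornerE scalerDl scalerA mul_mx_scalar.
Qed.

Lemma eigen_horner A P x : eigenvalue A x -> eigenvalue (horner_mx A P) P.[x].
Proof. by move=> /eigenvalueP[v vA v0]; apply/eigenvalueP; exists v => //;
  exact: horner_mx_eigen. Qed.

Lemma cdiff_horner_mx (F : C -> 'M[C]_n.+1) z P :
  (forall i j, cdiff (fun w => F w i j) z) ->
  forall i j, cdiff (fun w => horner_mx (F w) P i j) z.
Proof.
move=> dF; elim/poly_ind: P => [|P c IH] i j.
  by apply: (@cdiff_ext _ (fun=> 0)) => [w|]; [rewrite rmorph0 mxE|exact: cdiff_cst].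
apply: (@cdiff_ext _ (fun w => \sum_(k <- index_enum 'I_n.+1) horner_mx (F w) P i k * F
  w k j + c *+ (i == j))).
  by move=> w; rewrite rmorphD rmorphM /= horner_mx_X horner_mx_C !mxE.
by apply: cdiffD; [apply: cdiff_sum => k; exact: cdiffM|exact: cdiff_cst].
Qed.

(** The matrix P (F w) has differentiable entries which vanish at z0, and P x
is one of its eigenvalues when x is an eigenvalue of F w. *)
Lemma minpoly_lip (F : C -> 'M[C]_n.+1) z0 :
  (forall i j, cdiff (fun w => F w i j) z0) ->
  exists2 K : R, 0 <= K & cnear z0 (fun w => forall x, x \in eigenvalues (F w) ->
     cabs (mxminpoly (F z0)).[x] <= K * cabs (w - z0)).
Proof.
move=> dF; set P := mxminpoly _.
have dP := cdiff_horner_mx P dF.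
have P0 i j : horner_mx (F z0) P i j = 0 by rewrite mx_root_minpoly mxE.
have /choice[K KP] (ij : 'I_n.+1 * 'I_n.+1) : exists K : R, 0 <= K /\
    cnear z0 (fun w => cabs (horner_mx (F w) P ij.1 ij.2) <= K * cabs (w - z0)).
  have [K K0 H] := cdiff_lip (dP ij.1 ij.2); exists K; split=> //.
  by apply: cnear_imp H => w; rewrite P0 subr0.
exists (\sum_(i <- index_enum 'I_n.+1) \sum_(j <- index_enum 'I_n.+1) K (i, j)).
  by apply: sumr_ge0 => i _; apply: sumr_ge0 => j _; case: (KP (i, j)).
have : cnear z0 (fun w => forall ij, ij \in enum {: 'I_n.+1 * 'I_n.+1} ->
  cabs (horner_mx (F w) P ij.1 ij.2) <= K ij * cabs (w - z0)).
  by apply: cnear_seq => ij _; case: (KP ij).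
apply: cnear_imp => w H x; rewrite mem_eigenvalues =>
  /eigen_horner-/(_ P)/eigen_bound/le_trans; apply.
rewrite mulr_suml; apply: ler_sum => i _; rewrite mulr_suml; apply: ler_sum => j _.
by apply: (H (i, j)); rewrite mem_enum.
Qed.

Lemma eigenvalues_multi_holo (F : C -> 'M[C]_n.+1) (U : set C) :
  (forall z, U z -> forall i j, cdiff (fun w => F w i j) z) ->
    multi_holo U n.+1 (fun z => eigenvalues (F z)).
Proof.
move=> dF; split=> [z Uz|z y Uz|z Uz]; first exact: size_eigenvalues.
  exact: cdiff_char (dF _ Uz).
have : cnear z (fun w => forall ij, ij \in enum {: 'I_n.+1 * 'I_n.+1} ->
  cabs (F w ij.1 ij.2) <= cabs (F z ij.1 ij.2) + 1).
  apply: cnear_seq => -[i j] _ /=.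
  by apply: (@ccont_bnd _ (fun w => F w i j)); exact: cdiff_ccont (dF _ Uz i j).
exists (\sum_(i <- index_enum 'I_n.+1) \sum_(j <- index_enum 'I_n.+1)
  (cabs (F z i j) + 1)).
apply: cnear_imp H => w H _ x; rewrite mem_eigenvalues => /eigen_bound/le_trans; apply.
apply: ler_sum => i _; apply: ler_sum => j _.
by apply: (H (i, j)); rewrite mem_enum.
Qed.

Lemma spectrumE A : spectrum A = [set` eigenvalues A].
Proof. by apply/seteqP; split => x /=; rewrite mem_eigenvalues. Qed.

Lemma min_mult_gt0 A a : eigenvalue A a -> (0 < min_mult A a)%N.
Proof.
rewrite eigenvalue_root_min => ra; rewrite /min_mult -XsubC_dvd ?dvdp_XsubCl//.
exact: monic_neq0 (mxminpoly_monic A).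
Qed.

Lemma eigenvalues_nonempty A : exists x, x \in eigenvalues A.
Proof. by case E: (eigenvalues A) (size_eigenvalues A) => [//|x s] _; exists x;
  rewrite mem_head. Qed.

(** If mu is not the image of an eigenvalue, then P - mu is coprime to the
minimal polynomial of A, and a Bezout relation makes P(A) - mu invertible. *)
Lemma spectrum_horner A P : spectrum (horner_mx A P) = (fun a => P.[a]) @` spectrum A.
Proof.
apply/seteqP; split => [mu /= Hmu|_ [a aA <-]]; last exact: eigen_horner.
apply: contrapT => N.
have cop : coprimep (mxminpoly A) (P - mu%:P).
  apply: contrapT => /negP nc.
  have /closed_rootP[a] : size (gcdp (mxminpoly A) (P - mu%:P)) != 1%N by [].
  rewrite root_gcd => /andP[ra rb]; apply: N.
  exists a; first by rewrite /spectrum /= eigenvalue_root_min.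
  by move: rb; rewrite /root !hornerE subr_eq0 => /eqP.
have /Bezout_eq1_coprimepP[[u v] /= E] := cop.
have /eigenvalueP[x xA /eqP] := Hmu; apply.
have := congr1 (fun Q => x *m horner_mx A Q) E.
rewrite rmorphD !rmorphM /= mx_root_minpoly mulr0 add0r rmorph1 mulmx1 => <-.
rewrite -[_ * _](rmorphM (horner_mx A)) mulrC rmorphM/= rmorphB/= horner_mx_C.
rewrite [X in x *m X](_ : _ = (horner_mx A P - mu%:M) *m horner_mx A v)//.
by rewrite mulmxA mulmxBr xA mul_mx_scalar subrr mul0mx.
Qed.

Lemma deriv_XsubC_exp a (G : {poly C}) i :
  (('X - a%:P) ^+ i.+1 * G)^`() = ('X - a%:P) ^+ i * (G *+ i.+1 + ('X - a%:P) * G^`()).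
Proof.
rewrite derivM deriv_exp derivXsubC mul1r exprS /= -[_ *+ _]mulr_natr
  -[G *+ _]mulr_natr.
by ring.
Qed.

Lemma derivn_XsubC_eq a (G : {poly C}) i : (derivn i (('X - a%:P) ^+ i * G)).[a]
  = i`!%:R * G.[a].
Proof.
elim: i G => [|i IH] G; first by rewrite expr0 mul1r derivn0 mul1r.
rewrite derivSn deriv_XsubC_exp IH !hornerE subrr mul0r addr0.
by rewrite factS natrM hornerMn -mulr_natl; ring.
Qed.

Lemma derivn_XsubC_lt a (G : {poly C}) i j : (j < i)%N ->
  (derivn j (('X - a%:P) ^+ i * G)).[a] = 0.
Proof.
elim: j i G => [|j IH] [|i] G // ji.
  by rewrite derivn0 exprS !hornerE subrr !mul0r.
by rewrite derivSn deriv_XsubC_exp IH.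
Qed.

(** The derivatives at a new point a are prescribed one at a time. Adding a
multiple of (X - a)^k Q, where Q vanishes to the required order at the earlier
points, changes the k-th derivative at a and none of those already prescribed.
*)
Lemma hermite_interp (s : seq C) (m : C -> nat) (v : C -> nat -> C) : uniq s ->
  exists P : {poly C}, forall a, a \in s -> forall i, (i < m a)%N ->
    (derivn i P).[a] = v a i.
Proof.
elim: s => [|a s IH]; first by exists 0.
move=> /= /andP[nas us]; have [P0 P0E] := IH us.
suff [P [PE Pa]] : exists P : {poly C},
  (forall b, b \in s -> forall i, (i < m b)%N -> (derivn i P).[b] = v b i) /\
    forall i, (i < m a)%N -> (derivn i P).[a] = v a i.
  by exists P => b; rewrite inE => /predU1P[->|/PE].
elim: (m a) => [|k [P [PE Pa]]]; first by exists P0.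
pose Q := \prod_(b <- s) ('X - b%:P) ^+ m b.
have Qa : Q.[a] != 0.
  rewrite horner_prod prodf_seq_neq0; apply/allP => b bs /=.
  rewrite hornerE expf_neq0// hornerXsubC subr_eq0; apply: contraNneq nas => ->;
    exact: bs.
pose c := (v a k - (derivn k P).[a]) / (k`!%:R * Q.[a]).
have kf : (k`!%:R : C) != 0 by rewrite pnatr_eq0 -lt0n fact_gt0.
exists (P + ('X - a%:P) ^+ k * (c%:P * Q)); split=> [b bs i im|i].
  rewrite derivnD hornerD PE// /Q (big_rem b)//=.
  set G := \prod_(_ <- _) _.
  have -> : ('X - a%:P) ^+ k * (c%:P * (('X - b%:P) ^+ m b * G)) =
    ('X - b%:P) ^+ m b * (('X - a%:P) ^+ k * (c%:P * G)) by ring.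
  by rewrite derivn_XsubC_lt// addr0.
rewrite ltnS leq_eqVlt derivnD hornerD => /predU1P[->|ik].
  rewrite derivn_XsubC_eq hornerM hornerC /c; move: Q.[a] Qa (k`!%:R : C) kf =>
    q q0 l l0.
  by field; rewrite q0 l0.
by rewrite derivn_XsubC_lt// addr0 Pa.
Qed.

Lemma fun_calc_spectrum f A : spectrum (fun_calc f A) = f @` spectrum A.
Proof.
have [P0 H0] := @hermite_interp (undup (eigenvalues A)) (min_mult A)
  (fun a i => derive1n i f a) (undup_uniq _).
rewrite /fun_calc; case: xgetP => [P _ PE|/(_ P0)[]]; last first.
  by move=> a aA i im; apply: H0; rewrite // mem_undup mem_eigenvalues.
rewrite spectrum_horner; apply/seteqP; split => _ [a aA <-]; exists a => //;
  have := PE a aA 0%N (min_mult_gt0 aA); by rewrite derivn0.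
Qed.

End MatrixEigenvalues.

(** * Growth of a function and order of its derivative *)

Section Growth.

Variable R : realType.
Local Notation C := R[i].
Implicit Types (f g B : C -> C) (a z w x y : C) (e d r : R) (O U : set C).

Lemma eps_is_derive (F : R -> R) (z l : R) :
  (forall e : R, 0 < e -> exists2 d : R, 0 < d &
     forall w : R, `|w - z| < d -> `|F w - F z - l * (w - z)| <= e * `|w - z|) ->
       is_derive z 1 F l.
Proof.
move=> H.
have K : (h^-1 *: (F (h *: (1 : R^o) + z) - F z)) @[h --> (0 : R)^'] --> (l : R^o).
  apply/(@diffquot_epsP R R^o F z l) => e /H[d d0 {}H].
  by exists d => // w /H; rewrite /GRing.scale/= [(w - z) * l]mulrC.
apply: DeriveDef; first by apply/cvg_ex; exists l; exact: K.
by apply: (@cvg_lim R^o); [exact: norm_hausdorff|exact: K].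
Qed.

(** The factor 2 comes from treating the real and the imaginary part
separately. *)
Lemma mvt_cplx f (df : C -> C) a w K :
  (forall v, cabs (v - a) <= cabs (w - a) -> cdiffto f v (df v)) ->
  (forall v, cabs (v - a) <= cabs (w - a) -> cabs (df v) <= K) ->
  cabs (f w - f a) <= 2 * K * cabs (w - a).
Proof.
move=> fd dK; pose p (t : R) := a + t%:C%C * (w - a).
have pd t : 0 <= t <= 1 -> cabs (p t - a) <= cabs (w - a).
  move=> /andP[t0 t1]; rewrite /p addrAC subrr add0r cabsM cabs_real ger0_norm//.
  by rewrite ler_piMl ?cabs_ge0.
pose l t := df (p t) * (w - a).
have lK t : 0 <= t <= 1 -> cabs (l t) <= K * cabs (w - a).
  by move=> t01; rewrite cabsM ler_wpM2r ?cabs_ge0// dK// pd.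
have D t : 0 <= t <= 1 -> forall e : R, 0 < e -> exists2 d : R, 0 < d &
     forall s, `|s - t| < d -> cabs (f (p s) - f (p t) - (s - t)%:C%C * l t)
       <= e * `|s - t|.
  move=> t01 e e0; have m0 : 0 < cabs (w - a) + 1 by rewrite ltr_wpDl ?cabs_ge0.
  have h0 : 0 < e / (cabs (w - a) + 1) by rewrite divr_gt0.
  have [d d0 H] := fd _ (pd _ t01) _ h0.
  exists (d / (cabs (w - a) + 1)); first by rewrite divr_gt0.
  move=> s; rewrite ltr_pdivlMr// => sd.
  have E : p s - p t = (s - t)%:C%C * (w - a) by rewrite /p rmorphB/=; ring.
  have N : cabs (p s - p t) = `|s - t| * cabs (w - a) by rewrite E cabsM cabs_real.
  have := H (p s); rewrite {1}N; rewrite (le_lt_trans _ sd);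
    last by rewrite ler_wpM2l// lerDl.
  move=> /(_ isT); have -> : (s - t)%:C%C * l t = (p s - p t) * df (p t)
    by rewrite E /l; ring.
  move=> /le_trans; apply; rewrite N.
  rewrite [`|s - t| * _]mulrC mulrA ler_wpM2r//.
  rewrite -[leRHS](divfK (lt0r_neq0 m0)) ler_wpM2l ?(ltW h0)// lerDl//.
have H1 : `|complex.Re (f (p 1)) - complex.Re (f (p 0))| <= K * cabs (w - a) * (1 - 0).
  apply: (@mvt_bound _ (fun t => complex.Re (f (p t))) (fun t => complex.Re (l t))) =>
    // t t01.
    apply: eps_is_derive => e /(D t t01)[d d0 {}D]; exists d => // s /D;
      apply: le_trans.
    apply: le_trans (cabs_Re _); case: (f (p s)) (f (p t)) (l t) => [? ?] [? ?] [? ?];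
      simpc => /=.
    by rewrite le_eqVlt; apply/orP; left; apply/eqP; congr (`|_|); ring.
  by apply: le_trans (lK t t01); exact: cabs_Re.
have H2 : `|complex.Im (f (p 1)) - complex.Im (f (p 0))| <= K * cabs (w - a) * (1 - 0).
  apply: (@mvt_bound _ (fun t => complex.Im (f (p t))) (fun t => complex.Im (l t))) =>
    // t t01.
    apply: eps_is_derive => e /(D t t01)[d d0 {}D]; exists d => // s /D;
      apply: le_trans.
    apply: le_trans (cabs_Im _); case: (f (p s)) (f (p t)) (l t) => [? ?] [? ?] [? ?];
      simpc => /=.
    by rewrite le_eqVlt; apply/orP; left; apply/eqP; congr (`|_|); ring.
  by apply: le_trans (lK t t01); exact: cabs_Im.
have p1 : p 1 = w by rewrite /p mul1r addrC subrK.
have p0 : p 0 = a by rewrite /p mul0r addr0.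
move: H1 H2; rewrite subr0 mulr1 p1 p0 => H1 H2.
apply: le_trans (cabs_ReIm _) _; rewrite -mulrA mulrDl mul1r.
by apply: le_trans (lerD H1 H2); case: (f w) (f a) => [? ?] [? ?].
Qed.

(** Integrate f' = O((w - a)^m) along the segment from a to w. When f' has no
order at a, [order_at] is 0, and f is still Lipschitz at a. *)
Lemma order_growth f a : cnear a (cdiff f) -> exists2 K : R, 0 <= K &
  cnear a (fun w => cabs (f w - f a)
    <= K * cabs (w - a) ^+ (order_at (derive1 f) a).+1).
Proof.
move=> df; rewrite /order_at; case: xgetP => [m _ [h [dh _ hE]]|_]; last first.
  by have [K K0 H] := cdiff_lip (cnear_self df); exists K => //;
    apply: cnear_imp H => w; rewrite expr1.
have /nbhs_cnear/cnear_self/derivable_cdiff/cdiff_ccont/ccont_bnd hb := dh.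
pose H := cabs (h a) + 1; have H0 : 0 <= H by rewrite addr_ge0 ?cabs_ge0.
exists (2 * H); first by rewrite mulr_ge0.
have [d d0 Hd] := cnear_and df (cnear_and hb ((nbhs_cnear _ _).1 hE)).
exists d => // w wd; rewrite exprSr mulrA -[2 * H * _]mulrA.
apply: (@mvt_cplx f (derive1 f)) => v vw.
  have [[l dl] _] := Hd v (le_lt_trans vw wd).
  by rewrite (cdiffto_derive1 dl).
have [_ [hv ->]] := Hd v (le_lt_trans vw wd).
rewrite cabsM cabsX mulrC ler_pM ?exprn_ge0 ?cabs_ge0//.
by rewrite lerXn2r ?nnegrE ?cabs_ge0.
Qed.

Lemma fsbig_max_le (I : choiceType) (A : set I) (E : I -> R) (b : R) : 0 <= b ->
  (forall i, A i -> E i <= b) -> \big[Num.max/0]_(i \in A) E i <= b.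
Proof.
move=> b0 H; case: finite_supportP => [_|X XA _ _]; first by rewrite big_nil.
have {}XA i : i \in finmap.enum_fset X -> A i by move=> iX; apply: XA.
elim: (finmap.enum_fset X) XA => [|i s IH] sA; first by rewrite big_nil.
rewrite big_cons ge_max H/=; last by apply: sA; rewrite mem_head.
by apply: IH => j js; apply: sA; rewrite inE js orbT.
Qed.

Lemma fsbig_maxn_ge (I : choiceType) (s : seq I) (E : I -> nat) (i : I) : uniq s ->
  i \in s ->
  (E i <= \big[maxn/0%N]_(i \in [set` s]) E i)%N.
Proof. by move=> us si; rewrite -fsbig_seq//; exact: leq_bigmax_seq. Qed.

Lemma cexpi_surj (c : C) : cabs c = 1 -> exists t, cexpi t = c.
Proof.
case: c => u v c1; have E : u ^+ 2 + v ^+ 2 = 1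
  by rewrite -(sqr_cabs (Complex u v)) c1 expr1n.
have u1 : -1 <= u <= 1.
  by rewrite -ler_norml -(@ler_pXn2r _ 2%N) ?nnegrE// real_normK ?num_real// expr1n -E
    lerDl sqr_ge0.
have sE : Num.sqrt (1 - u ^+ 2) = `|v| by rewrite -E addrAC subrr add0r sqrtr_sqr.
have [v0|v0] := leP 0 v.
  by exists (acos u); rewrite /cexpi acosK// sin_acos// sE ger0_norm.
exists (- acos u); rewrite /cexpi cosN sinN acosK// sin_acos// sE ltr0_norm// opprK//.
Qed.

End Growth.

(** * The interpolation problem *)

Section Interpolation.

Variables (R : realType) (n : nat).
Local Notation C := R[i].
Local Notation D := (@unit_disc R).
Implicit Types (f g : C -> C) (a z w x y : C) (e d r : R) (O U : set C)
  (A : 'M[C]_n.+1).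

(** If the extremal problem has no solution, [extremal] is the zero function,
for which these facts are immediate. *)
Lemma extremal_facts O a z : [/\ forall w, O w -> cdiff (extremal O a z) w,
  forall w, O w -> cabs (extremal O a z w) < 1 & extremal O a z a = 0].
Proof.
rewrite /extremal; case: xgetP => [g _ [[hg g1] ga _]|_].
  by split=> // w Ow; apply/derivable_cdiff; exact: hg.
by split=> // w Ow; [exact: cdiff_cst|rewrite cabs0].
Qed.

Lemma spectrum_undup A : spectrum A = [set` undup (eigenvalues A)].
Proof. by rewrite spectrumE; apply/seteqP; split => x /=; rewrite mem_undup. Qed.

Lemma BfunE O A z w : Bfun O A z w = \prod_(a <- undup (eigenvalues A)) extremal O a z
  w ^+ min_mult A a.
Proof. by rewrite /Bfun spectrum_undup -fsbig_seq// undup_uniq. Qed.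

Lemma Bfun_cdiff O A z w : O w -> cdiff (Bfun O A z) w.
Proof.
move=> Ow; apply: (@cdiff_ext _
  (fun w => \prod_(a <- undup (eigenvalues A)) extremal O a z w ^+ min_mult A a)).
  by move=> v; rewrite BfunE.
by apply: cdiff_prod => a; apply: cdiffX; case: (extremal_facts O a z) => h _ _;
  exact: h.
Qed.

Lemma prod_le1 (s : seq C) (u : C -> C) : (forall a, a \in s -> cabs (u a) <= 1) ->
  cabs (\prod_(a <- s) u a) <= 1.
Proof.
move=> H; rewrite cabs_prod; elim: s H => [|a s IH] H; first by rewrite big_nil.
rewrite big_cons mulr_ile1 ?cabs_ge0//.
- by rewrite -cabs_prod cabs_ge0.
- by rewrite H// mem_head.
- by apply: IH => b bs; apply: H; rewrite inE bs orbT.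
Qed.

Lemma Bfun_split O A z x w : x \in eigenvalues A -> O w ->
  cabs (Bfun O A z w) <= cabs (extremal O x z w) ^+ min_mult A x.
Proof.
move=> xA Ow; have xu : x \in undup (eigenvalues A) by rewrite mem_undup.
rewrite BfunE (big_rem x xu)/= cabsM cabsX ler_piMr ?exprn_ge0 ?cabs_ge0//.
apply: prod_le1 => b _; rewrite cabsX exprn_ile1 ?cabs_ge0//.
by case: (extremal_facts O b z) => _ h _; rewrite ltW ?h.
Qed.

Lemma Bfun_lt1 O A z w : O w -> cabs (Bfun O A z w) < 1.
Proof.
move=> Ow; have [x xA] := eigenvalues_nonempty A.
apply: le_lt_trans (Bfun_split z xA Ow) _.
have m0 : (0 < min_mult A x)%N by apply: min_mult_gt0; rewrite -mem_eigenvalues.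
by case: (extremal_facts O x z) => _ h _; rewrite expr_lt1 ?cabs_ge0 ?h.
Qed.

Lemma Bfun_growth O A z x : (forall z, O z -> cnear z O) -> x \in eigenvalues A ->
  O x ->
  exists2 K : R, 0 <= K & cnear x
    (fun w => cabs (Bfun O A z w) <= K * cabs (w - x) ^+ min_mult A x).
Proof.
move=> opO xA Ox; have [dg g1 gx] := extremal_facts O x z.
have [K K0 H] := cdiff_lip (dg _ Ox).
exists (K ^+ min_mult A x); first exact: exprn_ge0.
apply: (cnear_imp2 _ H (opO _ Ox)) => w; rewrite gx subr0 => {}H Ow.
apply: le_trans (Bfun_split z xA Ow) _.
by rewrite -exprMn lerXn2r// nnegrE ?cabs_ge0// mulr_ge0 ?cabs_ge0.
Qed.

Lemma Bfun_root O A z x : x \in eigenvalues A -> O x -> Bfun O A z x = 0.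
Proof.
move=> xA Ox; have [_ _ gx] := extremal_facts O x z.
have m0 : (0 < min_mult A x)%N by apply: min_mult_gt0; rewrite -mem_eigenvalues.
apply/eqP; rewrite -cabs_eq0; apply/eqP/le_anti; rewrite cabs_ge0 andbT.
by apply: le_trans (Bfun_split z xA Ox) _; rewrite gx cabs0 expr0n eqn0Ngt m0.
Qed.

(** Near a root the other factors of the minimal polynomial are bounded below.
*)
Lemma minpoly_factor A x : x \in eigenvalues A -> exists2 K : R, 0 <= K &
  cnear x (fun w => cabs (w - x) ^+ min_mult A x <= K * cabs (mxminpoly A).[w]).
Proof.
move=> xA; set P := mxminpoly A; have P0 : P != 0 := monic_neq0 (mxminpoly_monic A).
have : ('X - x%:P) ^+ min_mult A x %| P by rewrite -mup_geq.
move=> /dvdpP[Q PE].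
have Qx : Q.[x] != 0.
  apply/negP => Qx0; have : ('X - x%:P) ^+ (min_mult A x).+1 %| P.
    rewrite PE exprS; apply: dvdp_mul => //.
    by rewrite dvdp_XsubCl.
  by rewrite -mup_geq// ltnn.
have : cnear x (fun w => cabs (Q.[x]) / 2 < cabs Q.[w]).
  have h0 : 0 < cabs Q.[x] / 2 by rewrite divr_gt0// cabs_gt0.
  apply: cnear_imp (cdiff_ccont (cdiff_horner Q x) h0) => w h.
  by have := cabsB_ge Q.[x] Q.[w]; rewrite cabs_distC; move: h; lra.
exists (cabs Q.[x] / 2)^-1; first by rewrite invr_ge0 divr_ge0 ?cabs_ge0.
apply: cnear_imp H => w h.
have h0 : 0 < cabs Q.[x] / 2 by rewrite divr_gt0// cabs_gt0.
rewrite PE hornerM horner_exp hornerXsubC cabsM cabsX mulrA.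
rewrite ler_peMl ?exprn_ge0 ?cabs_ge0//.
by rewrite mulrC ler_pdivlMr// mul1r ltW.
Qed.

Lemma cnear_unif (s : seq C) (Q : C -> C -> Prop) :
  (forall y, y \in s -> cnear y (Q y)) ->
  exists2 e : R, 0 < e & forall y x, y \in s -> cabs (x - y) < e -> Q y x.
Proof.
elim: s => [|y s IH] H; first by exists 1.
have [|e e0 {}IH] := IH; first by move=> x xs; apply: H; rewrite inE xs orbT.
have [e' e'0 H'] := H y (mem_head _ _).
exists (Num.min e e'); first by rewrite lt_min e0.
by move=> v x; rewrite inE lt_min => /predU1P[->|vs] /andP[x1 x2];
  [exact: H'|exact: IH].
Qed.

Lemma cdiff_prod_in (s : seq C) (G : C -> C -> C) z :
  (forall i, i \in s -> cdiff (G i) z) -> cdiff (fun w => \prod_(i <- s) G i w) z.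
Proof.
move=> H; elim: s H => [|i s IH] H.
  by apply: (@cdiff_ext _ (fun=> 1)) => [w|]; [rewrite big_nil|exact: cdiff_cst].
apply: (@cdiff_ext _ (fun w => G i w * \prod_(i <- s) G i w)) => [w|];
  first by rewrite big_cons.
by apply: cdiffM; [apply: H; rewrite mem_head|apply: IH => j js; apply: H;
  rewrite inE js orbT].
Qed.

Lemma pow_sum (x y : R) k : 0 <= x -> 0 <= y ->
  (x + y) ^+ k <= 2 ^+ k * (x ^+ k + y ^+ k).
Proof.
move=> x0 y0; have [xy|/ltW yx] := leP x y.
  apply: (@le_trans _ _ ((2 * y) ^+ k)).
    by rewrite lerXn2r ?nnegrE ?addr_ge0 ?mulr_ge0// mulr_natl mulr2n lerD2r.
  by rewrite exprMn ler_wpM2l ?exprn_ge0// lerDr exprn_ge0.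
apply: (@le_trans _ _ ((2 * x) ^+ k)).
  by rewrite lerXn2r ?nnegrE ?addr_ge0 ?mulr_ge0// mulr_natl mulr2n lerD2l.
by rewrite exprMn ler_wpM2l ?exprn_ge0// lerDl exprn_ge0.
Qed.

Section Interpolant.

Variables (F : C -> 'M[C]_n.+1) (O : set C).
Hypothesis dF : forall z, D z -> forall i j, cdiff (fun w => F w i j) z.
Hypothesis opO : forall z, O z -> cnear z O.
Hypothesis FO : forall z x, D z -> x \in eigenvalues (F z) -> O x.

Let opD := @unit_disc_open R.

(** An eigenvalue of F w is close to an eigenvalue y of F z0, at a distance
controlled by the multiplicity of y in the minimal polynomial of F z0. *)
Lemma eig_close z0 e : D z0 -> 0 < e -> exists2 K : R, 0 <= K &
  cnear z0 (fun w => forall x, x \in eigenvalues (F w) -> exists2 y,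
    y \in eigenvalues (F z0) &
    cabs (x - y) < e /\ cabs (x - y) ^+ min_mult (F z0) y <= K * cabs (w - z0)).
Proof.
move=> Dz0 e0; have [K K0 HK] := minpoly_lip (dF Dz0).
have /choice[M MP] y : exists M : R, y \in eigenvalues (F z0) -> 0 <= M /\
   cnear y (fun w => cabs (w - y) ^+ min_mult (F z0) y
     <= M * cabs (mxminpoly (F z0)).[w]).
  have [yF|_] := boolP (y \in eigenvalues (F z0)); last by exists 0.
  by have [M M0 H] := minpoly_factor yF; exists M.
pose N := \sum_(y <- eigenvalues (F z0)) `|M y|.
have MN y : y \in eigenvalues (F z0) -> M y <= N.
  move=> yF; rewrite /N (big_rem y)//= (le_trans (ler_norm _))// lerDl.
  exact: sumr_ge0.
have [e1 e10 H1] := @cnear_unif (eigenvalues (F z0))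
  (fun y w => cabs (w - y) ^+ min_mult (F z0) y <= M y * cabs (mxminpoly (F z0)).[w])
  (fun y yF => (MP y yF).2).
have e20 : 0 < Num.min e e1 by rewrite lt_min e0.
exists (N * K); first by rewrite mulr_ge0// sumr_ge0.
have hm := eigenvalues_multi_holo dF.
apply: (cnear_imp2 _ (multi_holo_close hm Dz0 e20) (cnear_and HK (opD Dz0))) =>
  w H [{}HK Dw] x xF.
have [y yF] := H Dw x xF; rewrite lt_min => /andP[xe xe1].
exists y => //; split=> //; apply: le_trans (H1 y x yF xe1) _.
rewrite -mulrA ler_pM ?cabs_ge0 ?MN ?HK//.
by case: (MP y yF).
Qed.

Variables (a z : C).
Hypothesis Da : D a.
Let B := Bfun O (F a) z.
Let psi := disc_aut a.

Lemma Bfun_multi_holo : multi_holo D n.+1 (fun w => map B (eigenvalues (F w))).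
Proof. by apply: (@multi_holo_comp _ D O) => //;
  [exact: eigenvalues_multi_holo|move=> w; exact: Bfun_cdiff]. Qed.

Lemma disc_aut_neq0 w : D w -> w != a -> psi w != 0.
Proof. by move=> Dw wa; rewrite disc_aut_eq0. Qed.

(** By [eig_close] and [Bfun_growth], B x = O(w - a) on the eigenvalues x of F
w near a. *)
Lemma Bfun_schwarz w x : D w -> x \in eigenvalues (F w) -> cabs (B x) <= cabs (psi w).
Proof.
move=> Dw xF.
have sub v : setD_seq D [::] v -> D v by case.
have /choice[M MP] y : exists M : R, y \in eigenvalues (F a) -> 0 <= M /\
   cnear y (fun w => cabs (B w) <= M * cabs (w - y) ^+ min_mult (F a) y).
  have [yF|_] := boolP (y \in eigenvalues (F a)); last by exists 0.
  by have [M M0 H] := Bfun_growth z opO yF (FO Da yF); exists M.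
pose N := \sum_(y <- eigenvalues (F a)) `|M y|.
have MN y : y \in eigenvalues (F a) -> M y <= N.
  move=> yF; rewrite /N (big_rem y)//= (le_trans (ler_norm _))// lerDl.
  exact: sumr_ge0.
have [e e0 H1] := @cnear_unif (eigenvalues (F a))
  (fun y w => cabs (B w) <= M y * cabs (w - y) ^+ min_mult (F a) y)
  (fun y yF => (MP y yF).2).
have [K K0 HK] := eig_close Da e0.
apply: (@multi_schwarz _ [::] n.+1 (fun w => map B (eigenvalues (F w))) a (N * K)) =>
  //; last exact: map_f.
- exact: multi_holo_sub Bfun_multi_holo.
- by move=> v u [Dv _] /mapP[t tF ->]; rewrite ltW// Bfun_lt1//; exact: FO tF.
- apply: cnear_imp HK => v H _ u /mapP[t tF ->].
  have [y yF [ty tm]] := H t tF.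
  apply: le_trans (H1 y t yF ty) _; rewrite -mulrA ler_pM ?exprn_ge0 ?cabs_ge0 ?MN//.
  by case: (MP y yF).
Qed.

Lemma quotient_multi_holo : multi_holo (setD_seq D [:: a]) n.+1
  (fun w => map (fun x => x / psi w) (map B (eigenvalues (F w)))).
Proof.
apply: multi_holo_scale.
- exact: setD_seq_open.
- by apply: multi_holo_sub Bfun_multi_holo => w [].
- by move=> w [Dw _]; exact: disc_aut_cdiff.
- by move=> w [Dw]; rewrite inE => wa; exact: disc_aut_neq0.
Qed.

Lemma quotient_le1 w y : setD_seq D [:: a] w ->
  y \in map (fun x => x / psi w) (map B (eigenvalues (F w))) -> cabs y <= 1.
Proof.
move=> [Dw]; rewrite inE => wa /mapP[_ /mapP[x xF ->] ->].
by rewrite cabsM cabsV ler_pdivrMr ?cabs_gt0 ?disc_aut_neq0// mul1r Bfun_schwarz.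
Qed.

(** By rigidity every point c psi w lies in the image under B of the
eigenvalues of F w, so x is an eigenvalue of F (psi^-1 (c^-1 B x)) for enough
points x: these accumulate at an eigenvalue of F a. The identity theorem
extends this to all x in O. *)
Lemma unimodular_case w1 c : connected O -> setD_seq D [:: a] w1 ->
  c \in map (fun x => x / psi w1) (map B (eigenvalues (F w1))) -> cabs c = 1 ->
  forall w, D w -> O `&` B @^-1` [set c * psi w] `<=` spectrum (F w).
Proof.
move=> cO Uw1 cw1 c1.
have Hc w : D w -> w != a -> exists2 x, x \in eigenvalues (F w) & B x = c * psi w.
  move=> Dw wa; have Uw : setD_seq D [:: a] w by split=> //; rewrite inE.
  have /mapP[_ /mapP[x xF ->] ->] :=
    multi_rigid quotient_multi_holo quotient_le1 c1 Uw1 cw1 Uw.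
  by exists x => //; rewrite divfK// disc_aut_neq0.
have cc : conjc c * c = 1 by rewrite mulrC mul_conjc c1 expr1n.
pose phi u := disc_aut (- a) u.
have Na : cabs (- a) < 1 by rewrite cabsN.
have phiK w : D w -> phi (psi w) = w.
  move=> Dw; have := disc_aut_den Da Dw; have := disc_aut_den Da Da.
  rewrite /phi /psi /disc_aut rmorphN /= mulNr !opprK => d1 d2.
  have -> : (w - a) / (1 - conjc a * w) + a = w * (1 - conjc a * a) / (1 - conjc a * w)
    by field.
  have -> : 1 + conjc a * ((w - a) / (1 - conjc a * w))
    = (1 - conjc a * a) / (1 - conjc a * w) by field.
  by field; rewrite d1 d2.
pose G x := phi (conjc c * B x).
have cB x : O x -> cabs (conjc c * B x) < 1 by move=> Ox;
  rewrite cabsM cabs_conj c1 mul1r Bfun_lt1.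
have GD x : O x -> D (G x) by move=> Ox; apply: disc_aut_lt1 => //; exact: cB.
have dG x : O x -> cdiff G x.
  move=> Ox; apply: (@cdiff_comp _ (fun x => conjc c * B x)).
    by apply: cdiffM; [exact: cdiff_cst|exact: Bfun_cdiff].
  by apply: disc_aut_cdiff => //; exact: cB.
have Gx w x : D w -> B x = c * psi w -> G x = w.
  by move=> Dw E; rewrite /G E mulrA cc mul1r phiK.
pose H x := root_prod (eigenvalues (F (G x))) x.
have dH x : O x -> cdiff H x.
  move=> Ox; apply: (@multi_holo_eval _ O n.+1 (fun x => eigenvalues (F (G x))) opO _
    id) => //; last exact: cdiff_id.
  apply: (@eigenvalues_multi_holo _ _ (fun x => F (G x))) => u Ou i j.
  by apply: (@cdiff_comp _ G (fun w => F w i j)); [exact: dG|exact: dF (GD _ Ou) i j].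
suff H0 : forall x, O x -> H x = 0.
  move=> w Dw x [Ox /= E]; have := H0 x Ox; rewrite /H (Gx _ _ Dw E) => /eqP.
  by rewrite root_prod_eq0 mem_eigenvalues.
apply: contrapT => nH.
have isol y : y \in eigenvalues (F a) -> cnear y (fun x => x != y -> H x != 0).
  move=> yF; have Oy := FO Da yF.
  have : cnear y (cdiff H) by apply: cnear_imp (opO Oy).
  move=> /isolated_zeros[Hy|//]; exfalso; apply: nH.
  by apply: (@identity_thm _ O H y) => //; apply/open_cnear.
have [e e0 He] := cnear_unif isol.
(* A point w <> a close to a: the eigenvalue x of F w with B x = c * psi w is
   near an eigenvalue y of F a, and x <> y because B y = 0. *)
have [K K0 [d d0 HK]] := eig_close Da e0.
have [d' d'0 Hd'] := opD Da.
pose w := a + (Num.min d d' / 2)%:C%C.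
have m0 : 0 < Num.min d d' by rewrite lt_min d0.
have wE : w - a = (Num.min d d' / 2)%:C%C by rewrite /w addrAC subrr add0r.
have wm : cabs (w - a) < Num.min d d'.
  by rewrite wE cabs_real gtr0_norm ?divr_gt0// ltr_pdivrMr// ltr_pMr// ltr1n.
move: wm; rewrite lt_min => /andP[wd wd'].
have wa : w != a by rewrite -subr_eq0 wE (inj_eq (@complexI R) _ 0) gt_eqF// divr_gt0.
have Dw := Hd' _ wd'.
have [x xF Bx] := Hc _ Dw wa.
have [y yF [xy _]] := HK _ wd x xF.
have xy0 : x != y.
  have By : B y = 0 := Bfun_root z yF (FO Da yF).
  apply/eqP => E; move: Bx; rewrite E By => /esym/eqP.
  by rewrite mulf_eq0 (negPf (disc_aut_neq0 Dw wa)) orbF -cabs_eq0 c1 oner_eq0.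
by have := He y x yF xy xy0; rewrite /H (Gx _ _ Dw Bx) root_prod_eq0 xF.
Qed.

Hypothesis v_lt1 : forall w x, D w -> w != a -> x \in eigenvalues (F w) ->
  cabs (B x / psi w) < 1.

(** Schwarz lemma at q for b (B x / psi w), with b the Blaschke product of
zeros nu / psi q and exponents qnum. Near q, let y be the eigenvalue of F q
close to x, m its multiplicity in the minimal polynomial of F q, d the order of
B - B y at y and k the least integer with d k >= m. The factor of b at B y /
psi q is O(|x - y|^d + |w - q|), the exponent qnum is at least k, and |x - y|^m
is O(w - q), so b is O(w - q). *)
Lemma two_point p q mu : D p -> D q -> p != a -> q != a -> mu \in eigenvalues (F p) ->
  \prod_(nu <- undup (map B (eigenvalues (F q)))) mobius_dist (B mu / psi p)
    (nu / psi q) ^+ qnum B (F q) nu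
    <= mobius_dist p q.
Proof.
move=> Dp Dq pa qa muF.
pose N := undup (map B (eigenvalues (F q))); pose s := psi q.
have s0 : s != 0 by exact: disc_aut_neq0.
have Ns nu : nu \in N -> cabs (nu / s) < 1.
  by rewrite mem_undup => /mapP[x xF ->]; exact: v_lt1.
pose Q nu := qnum B (F q) nu.
pose b y := \prod_(nu <- N) disc_aut (nu / s) y ^+ Q nu.
have b1 y : D y -> cabs (b y) <= 1.
  move=> Dy; apply: prod_le1 => nu nuN; rewrite cabsX exprn_ile1 ?cabs_ge0//.
  by rewrite ltW// disc_aut_lt1//; exact: Ns.
have db y : D y -> cdiff b y.
  move=> Dy; apply: cdiff_prod_in => nu nuN; apply: cdiffX.
  by apply: disc_aut_cdiff => //; exact: Ns.
pose v w := map (fun x => x / psi w) (map B (eigenvalues (F w))).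
have vlt w y : setD_seq D [:: a] w -> y \in v w -> D y.
  by move=> [Dw]; rewrite inE => wa /mapP[_ /mapP[x xF ->] ->]; exact: v_lt1.
have hbv : multi_holo (setD_seq D [:: a]) n.+1 (fun w => map b (v w)).
  by apply: (@multi_holo_comp _ (setD_seq D [:: a]) D) => //;
    [exact: setD_seq_open|exact: quotient_multi_holo].
have Up : setD_seq D [:: a] p by split=> //; rewrite inE.
have bp : b (B mu / psi p) \in map b (v p) by rewrite map_f// /v -map_comp; apply/mapP;
  exists mu.
suff [K HK] : exists K, cnear q (fun w => setD_seq D [:: a] w -> forall x,
  x \in map b (v w) -> cabs x <= K * cabs (w - q)).
  have := multi_schwarz Dq hbv _ HK Up bp; rewrite -/(mobius_dist p q).
  rewrite /b cabs_prod; under [in X in _ -> X]eq_bigr do rewrite -cabsX.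
  by apply => w x Uw /mapP[y yv ->]; apply: b1; exact: vlt yv.
(* dd y is the order of B - B y at y, when it has one. *)
pose dd y := (order_at (derive1 B) y).+1.
pose kk y := ((min_mult (F q) y).-1 %/ dd y).+1.
have kQ y : y \in eigenvalues (F q) -> (kk y <= Q (B y))%N.
  move=> yF; rewrite /Q /qnum.
  have -> : spectrum (F q) `&` B @^-1` [set B y]
    = [set` [seq x <- undup (eigenvalues (F q)) | B x == B y]].
    apply/seteqP; split=> x /=; rewrite mem_filter mem_undup mem_eigenvalues.
      by move=> [-> ->]; rewrite eqxx.
    by move=> /andP[/eqP xy xF].
  apply: (@fsbig_maxn_ge _ _
    (fun x => (((min_mult (F q) x).-1 %/ (order_at (derive1 B) x).+1).+1)) y).
    by rewrite filter_uniq// undup_uniq.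
  by rewrite mem_filter eqxx mem_undup.
have km y : y \in eigenvalues (F q) -> (min_mult (F q) y <= dd y * kk y)%N.
  rewrite mem_eigenvalues => /min_mult_gt0 m0;
    rewrite -[X in (X <= _)%N](prednK m0) mulnC.
  exact: ltn_ceil.
have /choice[M MP] y : exists M : R, y \in eigenvalues (F q) -> 0 <= M /\
   cnear y (fun w => cabs (B w - B y) <= M * cabs (w - y) ^+ dd y).
  have [yF|_] := boolP (y \in eigenvalues (F q)); last by exists 0.
  have [|M M0 H] := @order_growth R B y; last by exists M.
  by apply: cnear_imp (opO (FO Dq yF)) => w; exact: Bfun_cdiff.
pose MM := \sum_(y <- eigenvalues (F q)) `|M y|.
have MMle y : y \in eigenvalues (F q) -> M y <= MM.
  move=> yF; rewrite /MM (big_rem y)//= (le_trans (ler_norm _))// lerDl.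
  exact: sumr_ge0.
have MM0 : 0 <= MM by exact: sumr_ge0.
have [e1 e10 H1] := @cnear_unif (eigenvalues (F q))
  (fun y w => cabs (B w - B y) <= M y * cabs (w - y) ^+ dd y)
  (fun y yF => (MP y yF).2).
have e0 : 0 < Num.min e1 1 by rewrite lt_min e10 ltr01.
have [K K0 HK] := eig_close Dq e0.
have dpsiV : cdiff (fun w => (psi w)^-1) q by apply: cdiffV => //;
  exact: disc_aut_cdiff.
have [C2 C20 HC2] := cdiff_lip dpsiV.
pose C3 := cabs (psi q)^-1 + 1.
have C30 : 0 <= C3 by rewrite addr_ge0 ?cabs_ge0.
have HC3 := ccont_bnd (cdiff_ccont dpsiV).
pose C1 := \sum_(nu <- N) (1 - cabs (nu / s))^-1.
have C1le nu : nu \in N -> (1 - cabs (nu / s))^-1 <= C1.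
  move=> nuN; rewrite /C1 (big_rem nu)//= lerDl big_seq sumr_ge0// => x /mem_rem xN.
  by rewrite invr_ge0 subr_ge0 ltW// Ns.
have C10 : 0 <= C1.
  by rewrite /C1 big_seq sumr_ge0// => x xN; rewrite invr_ge0 subr_ge0 ltW// Ns.
pose lip := C1 * (MM * C3 + C2).
have lip0 : 0 <= lip by rewrite mulr_ge0// addr_ge0// mulr_ge0.
pose KK := \sum_(y <- eigenvalues (F q)) lip ^+ kk y * 2 ^+ kk y * (K + 1).
have K1 : 0 <= K + 1 by rewrite addr_ge0.
exists KK.
apply: (cnear_imp2 _ (cnear_and HK (cnear_ball q ltr01)) (cnear_and HC2 HC3)) =>
  w [{}HK w1] [{}HC2 {}HC3] Uw.
move=> u /mapP[t tv ->]; have Dt := vlt w t Uw tv.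
move: tv => /mapP[_ /mapP[x xF ->] tE].
have [y yF] := HK x xF; rewrite lt_min => -[/andP[xe1 x1] xm].
set eps := cabs (w - q) in w1 xm HC2 *; have eps0 : 0 <= eps := cabs_ge0 _.
pose nu := B y.
have nuN : nu \in N by rewrite mem_undup map_f.
have nus := Ns _ nuN.
pose A := cabs (x - y) ^+ dd y; have A0 : 0 <= A by rewrite exprn_ge0 ?cabs_ge0.
have BA : cabs (B x - B y) <= MM * A.
  by apply: le_trans (H1 y x yF xe1) _; rewrite ler_wpM2r// MMle.
have B1 : cabs (B y) <= 1 by rewrite ltW// Bfun_lt1//; exact: FO yF.
have tnu : cabs (t - nu / s) <= (MM * C3 + C2) * (A + eps).
  have -> : t - nu / s = (B x - B y) * (psi w)^-1 + B y * ((psi w)^-1 - (psi q)^-1)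
    by rewrite tE /nu /s; ring.
  apply: le_trans (cabsD _ _) _; rewrite !cabsM.
  apply: (@le_trans _ _ (MM * A * C3 + 1 * (C2 * eps))).
    by apply: lerD; rewrite ler_pM ?cabs_ge0.
  have -> : (MM * C3 + C2) * (A + eps) = MM * A * C3 + 1 * (C2 * eps) +
    (MM * C3 * eps + C2 * A) by ring.
  by rewrite lerDl addr_ge0// !mulr_ge0.
have taut : cabs (disc_aut (nu / s) t) <= lip * (A + eps).
  rewrite /disc_aut cabsM cabsV mulrC /lip -mulrA ler_pM ?invr_ge0 ?cabs_ge0//.
  apply: le_trans (C1le nu nuN); rewrite lef_pV2 ?posrE ?subr_gt0//.
    have := cabsB_ge 1 (conjc (nu / s) * t); rewrite cabs1 cabsM cabs_conj;
      apply: le_trans.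
    by rewrite lerD2l lerN2 ler_piMr ?cabs_ge0// ltW.
  by rewrite cabs_gt0; exact: disc_aut_den.
have bt : cabs (b t) <= cabs (disc_aut (nu / s) t) ^+ kk y.
  rewrite /b (big_rem nu)//= cabsM.
  apply: (@le_trans _ _ (cabs (disc_aut (nu / s) t ^+ Q nu))).
    rewrite ler_piMr ?cabs_ge0//; apply: prod_le1 => l /mem_rem lN.
    by rewrite cabsX exprn_ile1 ?cabs_ge0// ltW// disc_aut_lt1//; exact: Ns.
  by rewrite cabsX ler_wiXn2l ?cabs_ge0 ?kQ// ltW// disc_aut_lt1.
apply: le_trans bt _; apply: (@le_trans _ _ ((lip * (A + eps)) ^+ kk y)).
  by rewrite lerXn2r ?nnegrE ?cabs_ge0// mulr_ge0// addr_ge0.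
rewrite exprMn; apply: (@le_trans _ _ (lip ^+ kk y * (2 ^+ kk y * ((K + 1) * eps)))).
  rewrite ler_wpM2l ?exprn_ge0//; apply: le_trans (pow_sum _ A0 eps0) _.
  rewrite ler_wpM2l ?exprn_ge0// mulrDl mul1r lerD//.
    apply: le_trans xm; rewrite /A -exprM ler_wiXn2l ?cabs_ge0 ?km//.
    exact: ltW.
  by rewrite /kk exprS ler_piMr// exprn_ile1// ltW.
rewrite !mulrA ler_wpM2r// /KK (big_rem y)//= lerDl sumr_ge0// => l _.
by rewrite !mulr_ge0 ?exprn_ge0.
Qed.

End Interpolant.

End Interpolation.

Lemma mobius_distC (R : realType) (z w : R[i]) : mobius_dist z w = mobius_dist w z.
Proof.
rewrite /mobius_dist !cabsM !cabsV cabs_distC; congr (_ / _).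
rewrite -cabs_conj rmorphB rmorph1 rmorphM /= conjcK mulrC.
by [].
Qed.

Lemma Gidx_neq k : Gidx k != k.
Proof. by rewrite /Gidx; case: arg_maxnP => //; rewrite eq_sym neq_lift. Qed.

Lemma Lidx_neq k : Lidx k != k.
Proof. by rewrite /Lidx; case: arg_minnP => //; rewrite eq_sym neq_lift. Qed.

Lemma fun_calc_spectrum_undup (R : realType) (n : nat) (B : R[i] -> R[i])
  (A : 'M[R[i]]_n.+1) :
  spectrum (fun_calc B A) = [set` undup (map B (eigenvalues A))].
Proof.
rewrite fun_calc_spectrum spectrumE; apply/seteqP; split => x /=; rewrite mem_undup.
  by move=> [y yA <-]; exact: map_f.
by move=> /mapP[y yA ->]; exists y.
Qed.

Theorem theorem1p9 (R : realType) (n : nat) (Omega : set R[i])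
    (zeta : 'I_3 -> R[i]) (W : 'I_3 -> 'M[R[i]]_n.+1)
    (n_ge2 : (2 <= n.+1)%N)
    (Omega_domain : domain Omega)
    (Omega_hyp : caratheodory_hyperbolic Omega)
    (zeta_disc : forall j, unit_disc (zeta j))
    (zeta_inj : injective zeta)
    (W_S : forall j, spectral_domain Omega (W j)) :
  (exists F : R[i] -> 'M[R[i]]_n.+1,
    [/\ holomorphic_on (@unit_disc R) F,
        forall w, unit_disc w -> spectral_domain Omega (F w) &
        forall j, F (zeta j) = W j]) ->
  forall (k : 'I_3) (z : R[i]), (Omega `\` spectrum (W k)) z ->
  let B := Bfun Omega (W k) z in
  let G := Gidx k in
  let L := Lidx k in
  let psi := disc_aut (zeta k) in
  [/\ spectrum (fun_calc B (W G)) `<=` open_disc (cabs (psi (zeta G))),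
      spectrum (fun_calc B (W L)) `<=` open_disc (cabs (psi (zeta L))) &
      Num.max (max_prod B (W L) (psi (zeta L)) (W G) (psi (zeta G)))
              (max_prod B (W G) (psi (zeta G)) (W L) (psi (zeta L)))
        <= mobius_dist (zeta L) (zeta G)]
  \/
  exists theta : R,
    Omega `&` B @^-1` [set cexpi theta * psi (zeta G)] `<=` spectrum (W G) /\
    Omega `&` B @^-1` [set cexpi theta * psi (zeta L)] `<=` spectrum (W L).
Proof.
move=> [F [hF FS FW]] k z _ B G L psi.
have [/open_cnear opO cO _] := Omega_domain.
have dF w : unit_disc w -> forall i j, cdiff (fun w => F w i j) w.
  by move=> Dw i j; apply: derivable_entry; exact: hF.
have FO w x : unit_disc w -> x \in eigenvalues (F w) -> Omega x.
  by move=> Dw xF; apply: (FS w Dw); rewrite /spectrum /= -mem_eigenvalues.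
have Da := zeta_disc k.
have BE : B = Bfun Omega (F (zeta k)) z by rewrite /B FW.
have Gk : zeta G != zeta k by rewrite (inj_eq zeta_inj) Gidx_neq.
have Lk : zeta L != zeta k by rewrite (inj_eq zeta_inj) Lidx_neq.
clearbody B G L.
have [[w1 [c [Uw1 cw1 c1]]]|N] := pselect (exists w1 c,
    [/\ setD_seq (@unit_disc R) [:: zeta k] w1,
       c \in map (fun x => x / psi w1) (map B (eigenvalues (F w1))) & cabs c = 1]).
  right; have [theta thetaE] := cexpi_surj c1; exists theta; rewrite thetaE.
  rewrite BE in cw1 *; rewrite -!FW.
  by split; apply: (unimodular_case dF opO FO Da cO Uw1 cw1 c1).
left.
have v_lt1 w x : unit_disc w -> w != zeta k -> x \in eigenvalues (F w) ->
  cabs (B x / psi w) < 1.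
  move=> Dw wk xF; have Uw : setD_seq (@unit_disc R) [:: zeta k] w by split;
    [exact: Dw|rewrite inE].
  have xv : B x / psi w \in map (fun x => x / psi w) (map B (eigenvalues (F w))).
    exact: (map_f (fun x => x / psi w) (map_f B xF)).
  rewrite lt_neqAle; apply/andP; split; last first.
    by apply: (quotient_le1 dF opO FO Da (z := z) Uw); rewrite -BE.
  by apply/eqP => E; apply: N; exists w, (B x / psi w).
have spec j : zeta j != zeta k ->
  spectrum (fun_calc B (W j)) `<=` open_disc (cabs (psi (zeta j))).
  move=> jk; rewrite fun_calc_spectrum spectrumE -FW => _ [x xF <-].
  have := v_lt1 (zeta j) x (zeta_disc j) jk xF.
  have p0 : 0 < cabs (psi (zeta j)) by rewrite cabs_gt0; exact: disc_aut_neq0.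
  by rewrite cabsM cabsV (ltr_pdivrMr _ _ p0) mul1r.
have two i j : zeta i != zeta k -> zeta j != zeta k ->
    max_prod B (W i) (psi (zeta i)) (W j) (psi (zeta j))
      <= mobius_dist (zeta i) (zeta j).
  move=> ik jk; apply: fsbig_max_le; first exact: cabs_ge0.
  move=> mu; rewrite !fun_calc_spectrum_undup -!FW /= mem_undup => /mapP[m mF ->].
  rewrite -fsbig_seq ?undup_uniq//.
  have := @two_point _ _ F Omega dF opO FO (zeta k) z Da _ (zeta i) (zeta j) m
    (zeta_disc i) (zeta_disc j) ik jk mF.
  by rewrite -BE; apply.
split; [exact: spec|exact: spec|].
rewrite ge_max; apply/andP; split; first exact: two.
by rewrite mobius_distC; exact: two.
Qed.
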